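(* Let $\mathcal P$ be a set of prime labeled graphs stable under relabeling satisfying Condition (C). Then the number of labeled graphs of size $n$ in $\mathcal G_{\mathcal P}$ is asymptotically equivalent to $$C\,\frac{n!}{R^n n^{3/2}},\qquad\text{where } C=\frac{(1+K)R}{\mu\sqrt\pi},$$ with $R=\kappa-\Lambda(\kappa)$, $K=e^\kappa-1$ and $\mu=\sqrt{2R\Lambda''(\kappa)}$.
   Context: A graph is prime if it has at least 3 vertices and its only modules (vertex sets $M$ such that every vertex outside $M$ is adjacent to all or none of $M$) are trivial. Every labeled graph has a unique modular decomposition tree, obtained by recursively writing the graph as a join $\oplus[M_1,\dots,M_k]$, a disjoint union $\ominus[M_1,\dots,M_k]$, or a substitution $P[M_1,\dots,M_k]$ of modules into a prime graph $P$; the prime graphs so obtained (with labels induced by ordering modules by minimal label) are its prime decorations. $\mathcal P$ is stable under relabeling if permuting labels of a member yields a member; $\mathcal G_{\mathcal P}$ is the set of labeled graphs all of whose prime decorations lie in $\mathcal P$. $P(z)=\sum_{H\in\mathcal P}z^{|H|}/|H|!$, $R_0$ its radius, $\Lambda(w)=P(e^w-1)+e^w-1-w$. Condition (C): $R_0>0$ and $\Lambda'(\log(1+R_0))>1$ (limit from below, $+\infty$ if divergent). $\kappa$ is the unique solution in $[0,\log(1+R_0))$ of $\Lambda'(\kappa)=1$. *)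

(* Defs.v *)
From HB Require Import structures.
From mathcomp Require Import all_boot fingroup perm.
From mathcomp Require Import boolp.
From Stdlib Require Import Reals.
From Coquelicot Require Import Coquelicot.

Set Implicit Arguments.
Unset Strict Implicit.
Unset Printing Implicit Defensive.

Local Open Scope nat_scope.

(* Simple graphs on n vertices; the label of a vertex is the vertex itself,
   so that the labels are 0, ..., n-1 instead of 1, ..., n. *)
Definition is_graph n (E : {ffun 'I_n * 'I_n -> bool}) : bool :=
  [forall x, ~~ E (x, x)] && [forall x, forall y, E (x, y) == E (y, x)].

Record lgraph n := LGraph {
  edges :> {ffun 'I_n * 'I_n -> bool};
  lgraphP : is_graph edges }.

HB.instance Definition _ n := [isSub for @edges n].
HB.instance Definition _ n := [Finite of lgraph n by <:].

Definition adj n (G : lgraph n) (x y : 'I_n) : bool := edges G (x, y).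

Definition is_module n (G : lgraph n) (M : {set 'I_n}) : bool :=
  [forall v, (v \notin M) ==>
     ([forall x in M, adj G v x] || [forall x in M, ~~ adj G v x])].

Definition trivial_module n (M : {set 'I_n}) : bool :=
  (#|M| <= 1) || (M == [set: 'I_n]).

Definition prime_graph n (G : lgraph n) : bool :=
  (3 <= n) && [forall M, is_module G M ==> trivial_module M].

(* Sets of labeled graphs, sorted by size. *)
Definition graph_set := forall n, {set lgraph n}.

Definition relabeling n (s : 'S_n) (G H : lgraph n) : Prop :=
  forall x y, adj H (s x) (s y) = adj G x y.

Definition stable_under_relabeling (P : graph_set) : Prop :=
  forall n (s : 'S_n) (G H : lgraph n),
    relabeling s G H -> G \in P n -> H \in P n.

Inductive decoration k := Join | Union | Prime of lgraph k.

(* Trees with leaves labeled in 'I_n; the k children of an internal node are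
   indexed by 'I_k, i.e. by the vertices of its decoration. *)
Inductive tree n :=
| Leaf of 'I_n
| Node k of decoration k & ('I_k -> tree n).

Definition deco_adj k (d : decoration k) (i j : 'I_k) : bool :=
  match d with
  | Join => i != j
  | Union => false
  | Prime H => adj H i j
  end.

Fixpoint leaves n (t : tree n) : {set 'I_n} :=
  match t with
  | Leaf v => [set v]
  | Node k _ M => \bigcup_(i < k) leaves (M i)
  end.

(* Adjacency in the graph obtained from the tree by iterated substitution. *)
Fixpoint tree_adj n (t : tree n) (x y : 'I_n) : bool :=
  match t with
  | Leaf _ => false
  | Node k d M =>
      [exists i, tree_adj (M i) x y] ||
      [exists i, exists j,
         [&& deco_adj d i j, x \in leaves (M i) & y \in leaves (M j)]]
  end.

Definition min_label n (A : {set 'I_n}) : nat := \big[minn/n]_(x in A) x.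

Definition deco_ok k (d : decoration k) : bool :=
  match d with
  | Join | Union => 2 <= k
  | Prime H => prime_graph H
  end.

Definition same_linear_root n k (d : decoration k) (t : tree n) : bool :=
  match d, t with
  | Join, Node _ Join _ => true
  | Union, Node _ Union _ => true
  | _, _ => false
  end.

(* The conditions that make the decomposition tree of a graph unique: a join
   (resp. a disjoint union) has no child which is itself a join (resp. a
   disjoint union), and the children of a node, hence the vertices of a prime
   decoration, are ordered by minimal label. *)
Fixpoint canonical n (t : tree n) : bool :=
  match t with
  | Leaf _ => true
  | Node k d M =>
      [&& deco_ok d,
          [forall i, canonical (M i)],
          [forall i, ~~ same_linear_root d (M i)],
          [forall i, forall j,
             (i != j) ==> [disjoint leaves (M i) & leaves (M j)]] &
          [forall i : 'I_k, forall j : 'I_k,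
             (i < j) ==> (min_label (leaves (M i)) < min_label (leaves (M j)))]]
  end.

Definition modular_decomposition n (G : lgraph n) (t : tree n) : Prop :=
  [/\ canonical t,
      leaves t = [set: 'I_n] &
      forall x y, tree_adj t x y = adj G x y].

Fixpoint prime_decorations_in (P : graph_set) n (t : tree n) : bool :=
  match t with
  | Leaf _ => true
  | Node k d M =>
      (match d with Prime H => H \in P k | _ => true end) &&
      [forall i, prime_decorations_in P (M i)]
  end.

Definition in_class (P : graph_set) n (G : lgraph n) : Prop :=
  exists t : tree n, modular_decomposition G t /\ prime_decorations_in P t.

Definition class_count (P : graph_set) (n : nat) : nat :=
  #|[set G : lgraph n | `[< in_class P G >]]|.

Local Open Scope R_scope.

Definition egf_coef (P : graph_set) (n : nat) : R := INR #|P n| / INR n`!.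

Definition egf (P : graph_set) (z : R) : R := PSeries (egf_coef P) z.

Definition egf_radius (P : graph_set) : Rbar := CV_radius (egf_coef P).

Definition Lambda (P : graph_set) (w : R) : R :=
  egf P (exp w - 1) + exp w - 1 - w.

(* log (1 + x); the value at m_infty is irrelevant, a radius being >= 0. *)
Definition Rbar_ln1p (x : Rbar) : Rbar :=
  match x with
  | Finite r => Finite (ln (1 + r))
  | p_infty => p_infty
  | m_infty => m_infty
  end.

Definition log_bound (P : graph_set) : Rbar := Rbar_ln1p (egf_radius P).

(* The filter of approach from below, at a finite point or at p_infty. *)
Definition Rbar_at_left (x : Rbar) : (R -> Prop) -> Prop :=
  within (fun w : R => Rbar_lt w x) (Rbar_locally x).

Definition condition_C (P : graph_set) : Prop :=
  Rbar_lt 0 (egf_radius P) /\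
  exists l : Rbar,
    filterlim (Derive (Lambda P)) (Rbar_at_left (log_bound P)) (Rbar_locally l)
    /\ Rbar_lt 1 l.

(* [iota] is the definite description operator. *)
Definition kappa (P : graph_set) : R :=
  iota (fun w : R =>
    [/\ 0 <= w, Rbar_lt w (log_bound P) & Derive (Lambda P) w = 1]).

Definition rho (P : graph_set) : R := kappa P - Lambda P (kappa P).

Definition K (P : graph_set) : R := exp (kappa P) - 1.

Definition mu (P : graph_set) : R :=
  sqrt (2 * rho P * Derive_n (Lambda P) 2 (kappa P)).

Definition asymptotic_const (P : graph_set) : R := (1 + K P) * rho P / (mu P * sqrt PI).

(* Main.v *)
(** Let [T] and [N] be the exponential generating functions of the class and of
    its members whose decomposition tree is not rooted at a join. The children
    of a node are determined by the graph: the components or co-components for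
    a linear node, the maximal proper modules for a prime node. So the members
    rooted at a join are the sets of at least two [N]-structures, that is
    [T = e^N - 1], the same holds for unions with the same [N], and counting by
    the type of the root gives [z = N - Lambda(N)].

    By Lagrange inversion, [n [z^n] T = [w^(n-1)] e^w phi(w)^n] where
    [phi(w) = 1 / (1 - Lambda(w) / w)] has nonnegative coefficients. After
    weighting by the powers of [kappa], the right-hand side is an explicit factor
    times the probability that the sum of [n] independent variables of law
    [phi_k kappa^k / phi(kappa)] and of a Poisson variable equals [n - 1]. The
    equation [Lambda'(kappa) = 1] says that this law has mean 1, and it charges
    both 0 and 1, so a local limit theorem, proved by Fourier inversion, gives
    an equivalent of order [n^(-1/2)]. *)

From Stdlib Require Import Reals Ranalysis5 Factorial Lra Lia Psatz.
From Coquelicot Require Import Coquelicot.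

Local Open Scope R_scope.

(** * The Gaussian integral *)

(* Ring tactics do not see through Coquelicot's canonical structures on [R]. *)
Ltac eq_in_R := match goal with |- @eq _ ?a ?b => change (@eq R a b) end.

Lemma continuous_of_ex_derive (f : R -> R) x : ex_derive f x -> continuous f x.
Proof. exact (ex_derive_continuous f x). Qed.

Lemma ex_RInt_of_ex_derive (f : R -> R) a b : (forall x, ex_derive f x) -> ex_RInt f a b.
Proof.
intros H; apply (ex_RInt_continuous (V := R_CompleteNormedModule)); intros z _.
apply continuous_of_ex_derive, H.
Qed.

Definition gauss x := RInt (fun t => exp (- t ^ 2)) 0 x.

(* The classical companion of [gauss x ^ 2]: the two derivatives cancel. *)
Definition gauss_aux x := RInt (fun t => exp (- (x ^ 2 * (1 + t ^ 2))) / (1 + t ^ 2)) 0 1.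

Lemma one_plus_sqr_pos t : 0 < 1 + t ^ 2. Proof. nra. Qed.

Lemma is_derive_gauss (x : R) : is_derive gauss x (exp (- x ^ 2)).
Proof.
unfold gauss; apply (is_derive_RInt (fun t => exp (- t ^ 2)) _ 0).
  apply filter_forall; intros y; apply (RInt_correct (V := R_CompleteNormedModule)).
  apply ex_RInt_of_ex_derive; intros z; auto_derive; trivial.
apply continuous_of_ex_derive; auto_derive; trivial.
Qed.

Lemma is_derive_gauss_aux (x : R) : is_derive gauss_aux x (- 2 * exp (- x ^ 2) * gauss x).
Proof.
assert (pos := one_plus_sqr_pos).
assert (D : forall u t : R, is_derive (fun u => exp (- (u ^ 2 * (1 + t ^ 2))) / (1 + t ^ 2)) u
    (- 2 * u * exp (- (u ^ 2 * (1 + t ^ 2))))).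
  intros u t; auto_derive; [specialize (pos t); lra | simpl; field; specialize (pos t); lra].
evar_last.
  apply (is_derive_RInt_param
    (fun u t => exp (- (u ^ 2 * (1 + t ^ 2))) / (1 + t ^ 2)) 0 1 x).
  - apply filter_forall; intros u t _; eexists; apply D.
  - intros t _.
    apply (continuity_2d_pt_ext (fun u v => - 2 * u * exp (- (u ^ 2 * (1 + v ^ 2))))).
      intros u v; symmetry; apply is_derive_unique, D.
    apply continuity_2d_pt_mult.
      apply continuity_2d_pt_mult; [apply continuity_2d_pt_const | apply continuity_2d_pt_id1].
    apply (continuity_1d_2d_pt_comp exp (fun u v => - (u ^ 2 * (1 + v ^ 2)))).
      apply derivable_continuous_pt, derivable_pt_exp.
    apply continuity_2d_pt_opp, continuity_2d_pt_mult.
      apply (continuity_1d_2d_pt_comp (fun u => u ^ 2) (fun u v => u)).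
        apply derivable_continuous_pt, derivable_pt_pow.
      apply continuity_2d_pt_id1.
    apply continuity_2d_pt_plus; [apply continuity_2d_pt_const|].
    apply (continuity_1d_2d_pt_comp (fun u => u ^ 2) (fun u v => v)).
      apply derivable_continuous_pt, derivable_pt_pow.
    apply continuity_2d_pt_id2.
  - apply filter_forall; intros y; apply ex_RInt_of_ex_derive; intros t.
    auto_derive; specialize (pos t); lra.
set (f := fun s => -2 * exp (- x ^ 2) * exp (- s ^ 2)).
assert (ef : forall a b, ex_RInt f a b).
  intros a b; apply ex_RInt_of_ex_derive; intros z; unfold f; auto_derive; trivial.
transitivity (RInt f (x * 0 + 0) (x * 1 + 0)).
  rewrite <- (RInt_comp_lin (V := R_CompleteNormedModule) f x 0 0 1) by apply ef.
  apply RInt_ext; intros t _.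
  apply eq_trans with (- 2 * x * exp (- (x ^ 2 * (1 + t ^ 2)))).
    apply is_derive_unique, D.
  unfold f, scal; simpl; unfold mult; simpl.
  replace (- (x * (x * 1) * (1 + t * (t * 1)))) with
    (- (x * (x * 1)) + - ((x * t + 0) * ((x * t + 0) * 1))) by ring.
  rewrite exp_plus; eq_in_R; ring.
replace (x * 0 + 0) with 0 by ring; replace (x * 1 + 0) with x by ring.
apply (RInt_scal (V := R_CompleteNormedModule) (fun t => exp (- t ^ 2)) 0 x).
apply ex_RInt_of_ex_derive; intros z; auto_derive; trivial.
Qed.

Lemma gauss_sqr x : gauss x ^ 2 + gauss_aux x = PI / 4.
Proof.
assert (D : forall y : R, is_derive (fun y => gauss y ^ 2 + gauss_aux y) y 0).
  intros y; evar_last.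
    apply (is_derive_plus (fun y => gauss y ^ 2) gauss_aux).
      apply (is_derive_pow gauss 2); apply is_derive_gauss.
    apply is_derive_gauss_aux.
  unfold plus; simpl; ring.
replace (gauss x ^ 2 + gauss_aux x) with (gauss 0 ^ 2 + gauss_aux 0).
  unfold gauss, gauss_aux; rewrite RInt_point.
  rewrite (RInt_ext _ (fun t => / (1 + t ^ 2))).
    rewrite (is_RInt_unique _ 0 1 (atan 1 - atan 0)).
      rewrite atan_1, atan_0; unfold zero; simpl; field.
    apply (is_RInt_derive atan).
      intros t _; rewrite <- Rsqr_pow2; apply is_derive_atan.
    intros t _; apply continuous_of_ex_derive; auto_derive.
    assert (h := one_plus_sqr_pos t); simpl in h; lra.
  intros t _; replace (- (0 ^ 2 * (1 + t ^ 2))) with 0 by ring.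
  rewrite exp_0; eq_in_R; unfold Rdiv; ring.
destruct (MVT_gen (fun y => gauss y ^ 2 + gauss_aux y) 0 x (fun _ => 0)) as [c [_ E]].
- intros y _; apply D.
- intros y _; apply continuity_pt_filterlim.
  apply (continuous_of_ex_derive (fun y => gauss y ^ 2 + gauss_aux y)); eexists; apply D.
- lra.
Qed.

Lemma gauss_ge0 x : 0 <= x -> 0 <= gauss x.
Proof.
intros x0; unfold gauss; apply RInt_ge_0; trivial.
  apply ex_RInt_of_ex_derive; intros z; auto_derive; trivial.
intros t _; left; apply exp_pos.
Qed.

Lemma gauss_aux_bounds x : 0 <= gauss_aux x <= exp (- x ^ 2).
Proof.
assert (pos := one_plus_sqr_pos); unfold gauss_aux; split.
  apply RInt_ge_0; [lra| |].
    apply ex_RInt_of_ex_derive; intros t; auto_derive; specialize (pos t); lra.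
  intros t _; apply Rlt_le, Rdiv_lt_0_compat; [apply exp_pos|apply pos].
replace (exp (- x ^ 2)) with (RInt (fun _ => exp (- x ^ 2)) 0 1).
  apply RInt_le; [lra| | |].
  - apply ex_RInt_of_ex_derive; intros t; auto_derive; specialize (pos t); lra.
  - apply ex_RInt_const.
  - intros t t01; apply Rle_trans with (exp (- x ^ 2) / 1).
      apply Rmult_le_compat.
      + left; apply exp_pos.
      + left; apply Rinv_0_lt_compat, pos.
      + destruct (Rle_lt_or_eq_dec 0 (x ^ 2 * t ^ 2)) as [h|h].
        * apply Rmult_le_pos; apply pow2_ge_0.
        * left; apply exp_increasing; nra.
        * right; f_equal; nra.
      + apply Rinv_le_contravar; [lra|]; nra.
    unfold Rdiv; rewrite Rinv_1; lra.
rewrite RInt_const; unfold scal; simpl; unfold mult; simpl; ring.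
Qed.

Lemma is_lim_gauss : is_lim gauss p_infty (sqrt PI / 2).
Proof.
assert (L : is_lim gauss_aux p_infty 0).
  apply (is_lim_le_le_loc (fun _ => 0) (fun x => exp (- x))).
  - exists 1; intros x x1; destruct (gauss_aux_bounds x) as [h1 h2]; split; trivial.
    apply Rle_trans with (1 := h2); left; apply exp_increasing; nra.
  - apply is_lim_const.
  - apply (is_lim_comp exp Ropp p_infty 0 m_infty).
    + apply is_lim_exp_m.
    + apply (is_lim_opp (fun x => x) p_infty p_infty), is_lim_id.
    + exists 0; intros y _; discriminate.
apply is_lim_ext_loc with (fun x => sqrt (PI / 4 - gauss_aux x)).
  exists 0; intros x x0; rewrite <- (gauss_sqr x).
  replace (gauss x ^ 2 + gauss_aux x - gauss_aux x) with (gauss x ^ 2) by ring.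
  apply sqrt_pow2, gauss_ge0; lra.
replace (sqrt PI / 2) with (sqrt (PI / 4 - 0)).
  apply (is_lim_comp_continuous (fun x => PI / 4 - gauss_aux x) sqrt).
    apply (is_lim_minus _ _ _ (PI / 4) 0); [apply is_lim_const|exact L|reflexivity].
  apply continuous_sqrt.
assert (P := PI_RGT_0); rewrite Rminus_0_r, sqrt_div_alt by lra.
f_equal; replace 4 with (2 ^ 2) by ring; apply sqrt_pow2; lra.
Qed.

(** * A local limit theorem *)

Lemma nonneg_of_derive (f df : R -> R) : (forall x, is_derive f x (df x)) ->
  (forall x, 0 <= x -> 0 <= df x) -> f 0 = 0 -> forall x, 0 <= x -> 0 <= f x.
Proof.
intros D pos f0 x x0.
destruct (MVT_gen f 0 x df) as [c [[c0 _] E]].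
- intros y _; apply D.
- intros y _; apply continuity_pt_filterlim, (continuous_of_ex_derive f).
  exists (df y); apply D.
- rewrite Rmin_left in c0 by lra; specialize (pos c c0); nra.
Qed.

Lemma sin_le_id x : 0 <= x -> sin x <= x.
Proof.
intros x0; enough (0 <= x - sin x) by lra.
apply (nonneg_of_derive (fun x => x - sin x) (fun x => 1 - cos x)); trivial.
- intros y; auto_derive; trivial; ring.
- intros y _; destruct (COS_bound y); lra.
- rewrite sin_0; ring.
Qed.

Lemma cos_ge_quad x : 0 <= x -> 1 - x ^ 2 / 2 <= cos x.
Proof.
intros x0; enough (0 <= cos x - 1 + x ^ 2 / 2) by lra.
apply (nonneg_of_derive (fun x => cos x - 1 + x ^ 2 / 2) (fun x => x - sin x)); trivial.
- intros y; auto_derive; trivial; field.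
- intros y y0; assert (h := sin_le_id y y0); lra.
- rewrite cos_0; field.
Qed.

Lemma sin_ge_cubic x : 0 <= x -> x - x ^ 3 / 6 <= sin x.
Proof.
intros x0; enough (0 <= sin x - x + x ^ 3 / 6) by lra.
apply (nonneg_of_derive (fun x => sin x - x + x ^ 3 / 6) (fun x => cos x - 1 + x ^ 2 / 2)); trivial.
- intros y; auto_derive; trivial; field.
- intros y y0; assert (h := cos_ge_quad y y0); lra.
- rewrite sin_0; field.
Qed.

Lemma sin_ge_quad x : 0 <= x -> x - x ^ 2 / 2 <= sin x.
Proof.
intros x0; enough (0 <= x ^ 2 / 2 + sin x - x) by lra.
apply (nonneg_of_derive (fun x => x ^ 2 / 2 + sin x - x) (fun x => x + cos x - 1)); trivial.
- intros y; auto_derive; trivial; field.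
- intros y y0.
  apply (nonneg_of_derive (fun x => x + cos x - 1) (fun x => 1 - sin x)); trivial.
  + intros z; auto_derive; trivial; field.
  + intros z _; destruct (SIN_bound z); lra.
  + rewrite cos_0; field.
- rewrite sin_0; field.
Qed.

Lemma cos_le_cubic x : 0 <= x -> cos x <= 1 - x ^ 2 / 2 + x ^ 3 / 6.
Proof.
intros x0; enough (0 <= x ^ 3 / 6 - x ^ 2 / 2 + 1 - cos x) by lra.
apply (nonneg_of_derive (fun x => x ^ 3 / 6 - x ^ 2 / 2 + 1 - cos x)
  (fun x => x ^ 2 / 2 + sin x - x)); trivial.
- intros y; auto_derive; trivial; field.
- intros y y0; assert (h := sin_ge_quad y y0); lra.
- rewrite cos_0; field.
Qed.

Lemma Rabs_odd_le (f g : R -> R) : (forall x, f (- x) = - f x) ->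
  (forall x, 0 <= x -> Rabs (f x) <= g x) -> forall x, Rabs (f x) <= g (Rabs x).
Proof.
intros odd h x; destruct (Rle_dec 0 x) as [p|p].
  rewrite (Rabs_pos_eq x) by trivial; auto.
rewrite (Rabs_left x) by lra; rewrite <- Rabs_Ropp, <- odd; apply h; lra.
Qed.

Lemma Rabs_even_le (f g : R -> R) : (forall x, f (- x) = f x) ->
  (forall x, 0 <= x -> Rabs (f x) <= g x) -> forall x, Rabs (f x) <= g (Rabs x).
Proof.
intros even h x; destruct (Rle_dec 0 x) as [p|p].
  rewrite (Rabs_pos_eq x) by trivial; auto.
rewrite (Rabs_left x) by lra; rewrite <- even; apply h; lra.
Qed.

Lemma Rabs_sin_le x : Rabs (sin x) <= Rabs x.
Proof.
apply (Rabs_odd_le sin (fun x => x)); [apply sin_neg|].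
intros y y0; apply Rabs_le; assert (h := sin_le_id y y0).
destruct (Rle_dec y 1) as [y1|y1]; [|destruct (SIN_bound y); lra].
assert (h' := sin_ge_quad y y0); nra.
Qed.

Lemma Rabs_cos_sub1_le x : Rabs (cos x - 1) <= Rabs x.
Proof.
apply (Rabs_even_le (fun x => cos x - 1) (fun x => x)); [intros y; now rewrite cos_neg|].
intros y y0; apply Rabs_le; destruct (COS_bound y); split; [|lra].
destruct (Rle_dec y 2) as [y2|y2]; [|lra].
assert (h := cos_ge_quad y y0); nra.
Qed.

Lemma Rabs_sin_sub_le x : Rabs (sin x - x) <= Rabs x ^ 3.
Proof.
apply (Rabs_odd_le (fun x => sin x - x) (fun x => x ^ 3)).
  intros y; rewrite sin_neg; ring.
intros y y0; assert (h := sin_le_id y y0); assert (h' := sin_ge_cubic y y0).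
assert (0 <= y ^ 3) by (apply pow_le; trivial).
apply Rabs_le; lra.
Qed.

Lemma Rabs_cos_taylor2_le x : Rabs (cos x - 1 + x ^ 2 / 2) <= Rabs x ^ 3.
Proof.
apply (Rabs_even_le (fun x => cos x - 1 + x ^ 2 / 2) (fun x => x ^ 3)).
  intros y; rewrite cos_neg; field.
intros y y0; assert (h := cos_ge_quad y y0); assert (h' := cos_le_cubic y y0).
assert (0 <= y ^ 3) by (apply pow_le; trivial).
apply Rabs_le; lra.
Qed.

Lemma cos_le_strict t : 0 <= t <= PI -> cos t <= 1 - t ^ 2 / 18.
Proof.
intros [t0 tpi]; assert (P := PI_4).
assert (h := sin_ge_cubic (t / 2)).
replace t with (2 * (t / 2)) at 1 by field; rewrite cos_2a_sin.
assert (t / 2 / 3 <= sin (t / 2)) by nra.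
assert ((t / 2 / 3) * (t / 2 / 3) <= sin (t / 2) * sin (t / 2)) by (apply Rmult_le_compat; lra).
lra.
Qed.

Lemma exp_opp_taylor1 x : 0 <= x -> 0 <= exp (- x) - 1 + x <= x ^ 2 / 2.
Proof.
intros x0.
assert (h : forall y, 0 <= y -> 0 <= exp (- y) - 1 + y).
  intros y y0; assert (e := exp_ineq1_le (- y)); lra.
split; [auto|].
enough (0 <= x ^ 2 / 2 - (exp (- x) - 1 + x)) by lra.
apply (nonneg_of_derive (fun x => x ^ 2 / 2 - (exp (- x) - 1 + x))
  (fun x => exp (- x) - 1 + x)); trivial.
- intros y; auto_derive; trivial; field.
- rewrite Ropp_0, exp_0; field.
Qed.

Lemma is_series_le (a b : nat -> R) (la lb : R) : (forall n, a n <= b n) ->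
  is_series a la -> is_series b lb -> la <= lb.
Proof.
intros h ha hb.
apply (is_lim_seq_le (sum_n a) (sum_n b) la lb); trivial.
intros n; apply sum_n_m_le, h.
Qed.

Lemma is_series_Rabs_le (a r : nat -> R) (la lr : R) : (forall n, Rabs (a n) <= r n) ->
  is_series a la -> is_series r lr -> Rabs la <= lr.
Proof.
intros h ha hr; apply Rabs_le; split.
  enough (- la <= lr) by lra.
  apply (is_series_le (fun n => - a n) r); trivial.
    intros n; specialize (h n); apply Rabs_le_between in h; lra.
  apply (is_series_opp a la ha).
apply (is_series_le a r); trivial.
intros n; specialize (h n); apply Rabs_le_between in h; lra.
Qed.

Lemma ex_series_Rabs_le (a r : nat -> R) : (forall n, Rabs (a n) <= r n) ->
  ex_series r -> ex_series a.
Proof. intros h; apply (ex_series_le (V := R_CompleteNormedModule) a r h). Qed.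

Lemma is_series_zero : is_series (fun _ => 0) 0.
Proof.
change (is_lim_seq (sum_n (fun _ => 0)) 0).
apply is_lim_seq_ext with (fun _ => 0); [|apply is_lim_seq_const].
intros n; rewrite sum_n_const; eq_in_R; ring.
Qed.

(* Testing against the direction of the limit reduces to real series. *)
Lemma is_series_Cmod_le (x y r : nat -> R) (lx ly lr : R) :
  (forall k, 0 <= r k) -> (forall k, x k ^ 2 + y k ^ 2 <= r k ^ 2) ->
  is_series x lx -> is_series y ly -> is_series r lr -> Cmod (lx, ly) <= lr.
Proof.
intros r0 xy hx hy hr; set (m := Cmod (lx, ly)).
assert (m0 : 0 <= m) by apply Cmod_ge_0.
assert (m2 : m ^ 2 = lx ^ 2 + ly ^ 2).
  unfold m, Cmod; cbn [fst snd]; apply pow2_sqrt; nra.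
assert (h : lx * lx + ly * ly <= m * lr).
  apply (is_series_le (fun k => plus (scal lx (x k)) (scal ly (y k))) (fun k => scal m (r k))).
  - intros k; unfold plus, scal; simpl; unfold mult; simpl.
    specialize (xy k); specialize (r0 k).
    apply Rsqr_incr_0_var; [|nra]; unfold Rsqr.
    assert (0 <= (lx * y k - ly * x k) ^ 2) by apply pow2_ge_0.
    assert ((lx ^ 2 + ly ^ 2) * (x k ^ 2 + y k ^ 2) <= m ^ 2 * r k ^ 2).
      rewrite m2; apply Rmult_le_compat_l; [nra|trivial].
    nra.
  - exact (is_series_plus _ _ _ _ (is_series_scal lx x lx hx) (is_series_scal ly y ly hy)).
  - exact (is_series_scal m r lr hr).
destruct (Req_dec m 0) as [E|N].
  rewrite E; apply (is_series_le (fun _ => 0) r); trivial.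
  exact is_series_zero.
apply Rmult_le_reg_l with m; nra.
Qed.

Lemma sum_n_telescope_le (g r : nat -> R) N M : (forall k, Rabs (g k) <= r k) -> (N <= M)%nat ->
  Rabs (sum_n g M - sum_n g N) <= sum_n r M - sum_n r N.
Proof.
intros h; induction 1 as [|M NM IH].
  replace (_ - _) with 0 by ring; rewrite Rabs_R0; lra.
rewrite !sum_Sn; unfold plus; simpl.
replace (sum_n g M + g (S M) - sum_n g N) with (sum_n g M - sum_n g N + g (S M)) by ring.
eapply Rle_trans; [apply Rabs_triang|]; specialize (h (S M)); lra.
Qed.

Lemma series_tail_le (g r : nat -> R) (lg lr : R) N : (forall k, Rabs (g k) <= r k) ->
  is_series g lg -> is_series r lr -> Rabs (lg - sum_n g N) <= lr - sum_n r N.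
Proof.
intros h hg hr.
apply (is_lim_seq_le_loc (fun M => Rabs (sum_n g M - sum_n g N))
  (fun M => sum_n r M - sum_n r N) (Rabs (lg - sum_n g N)) (lr - sum_n r N)).
- exists N; intros M NM; apply sum_n_telescope_le; trivial.
- apply (is_lim_seq_abs (fun M => sum_n g M - sum_n g N) (lg - sum_n g N)).
  apply (is_lim_seq_minus' (sum_n g) (fun _ => sum_n g N)); [exact hg|apply is_lim_seq_const].
- apply (is_lim_seq_minus' (sum_n r) (fun _ => sum_n r N)); [exact hr|apply is_lim_seq_const].
Qed.

Lemma is_RInt_sum_n (g : nat -> R -> R) (I : nat -> R) a b N :
  (forall k, is_RInt (g k) a b (I k)) ->
  is_RInt (fun t => sum_n (fun k => g k t) N) a b (sum_n I N).
Proof.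
intros h; induction N as [|N IH].
  rewrite sum_O; apply (is_RInt_ext (g 0%nat)); [|apply h].
  intros t _; now rewrite sum_O.
rewrite sum_Sn; apply (is_RInt_ext (fun t => plus (sum_n (fun k => g k t) N) (g (S N) t))).
  intros t _; now rewrite sum_Sn.
apply (is_RInt_plus (V := R_NormedModule)); trivial.
Qed.

Lemma is_series_RInt (g : nat -> R -> R) (f : R -> R) (r I : nat -> R) (lr a b J : R) :
  a <= b -> (forall k t, Rabs (g k t) <= r k) -> is_series r lr ->
  (forall k, is_RInt (g k) a b (I k)) ->
  (forall t, is_series (fun k => g k t) (f t)) -> is_RInt f a b J -> is_series I J.
Proof.
intros ab h hr hI hf hJ.
change (is_lim_seq (sum_n I) J).
assert (B : forall N, Rabs (sum_n I N - J) <= (b - a) * (lr - sum_n r N)).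
  intros N; apply (norm_RInt_le_const (V := R_NormedModule)
    (fun t => minus (sum_n (fun k => g k t) N) (f t)) a b); trivial.
    intros t _; change (Rabs (sum_n (fun k => g k t) N - f t) <= lr - sum_n r N).
    rewrite Rabs_minus_sym; apply series_tail_le; trivial.
  apply (is_RInt_minus (V := R_NormedModule)); trivial; apply is_RInt_sum_n, hI.
apply is_lim_seq_ext with (fun N => (sum_n I N - J) + J); [intros; ring|].
replace (Finite J) with (Finite (0 + J)) by (f_equal; ring).
apply is_lim_seq_plus'; [|apply is_lim_seq_const].
apply is_lim_seq_abs_0.
apply (is_lim_seq_le_le (fun _ => 0) _ (fun N => (b - a) * (lr - sum_n r N))).
- intros N; split; [apply Rabs_pos|apply B].
- apply is_lim_seq_const.
- replace (Finite 0) with (Finite ((b - a) * (lr - lr))) by (f_equal; ring).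
  apply (is_lim_seq_mult' (fun _ => b - a)); [apply is_lim_seq_const|].
  apply is_lim_seq_minus'; [apply is_lim_seq_const|exact hr].
Qed.

Lemma is_series_single (m : nat) (x : R) : is_series (fun k => if Nat.eq_dec k m then x else 0) x.
Proof.
change (is_lim_seq (sum_n (fun k => if Nat.eq_dec k m then x else 0)) x).
apply is_lim_seq_ext_loc with (fun _ => x); [|apply is_lim_seq_const].
exists m; intros n; induction 1 as [|n mn IH].
  destruct m as [|m]; [rewrite sum_O; destruct (Nat.eq_dec 0 0); lia || trivial|].
  rewrite sum_Sn, (sum_n_ext_loc _ (fun _ => 0)), sum_n_const.
    destruct (Nat.eq_dec (S m) (S m)); [|lia]; unfold plus; simpl; ring.
  intros k km; destruct (Nat.eq_dec k (S m)); [lia|trivial].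
rewrite sum_Sn, <- IH; destruct (Nat.eq_dec (S n) m); [lia|].
unfold plus; simpl; ring.
Qed.

Definition expi (t : R) : C := (cos t, sin t).

Lemma expi_plus s t : expi (s + t) = (expi s * expi t)%C.
Proof.
unfold expi, Cmult; simpl; rewrite cos_plus, sin_plus; f_equal; ring.
Qed.

Lemma Cmod_expi t : Cmod (expi t) = 1.
Proof.
unfold Cmod, expi; cbn [fst snd]; rewrite Rplus_comm.
replace (sin t ^ 2 + cos t ^ 2) with 1; [apply sqrt_1|].
rewrite <- (sin2_cos2 t); unfold Rsqr; ring.
Qed.

Lemma expi_pow t n : (expi t ^ n)%C = expi (INR n * t).
Proof.
induction n as [|n IH].
  simpl; unfold expi; rewrite Rmult_0_l, cos_0, sin_0; reflexivity.
rewrite Cpow_S, IH, <- expi_plus, S_INR; f_equal; ring.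
Qed.

Definition fourier_sum (c : nat -> R) (f : R -> C) : Prop :=
  ex_series (fun k => Rabs (c k)) /\
  forall t, is_series (fun k => c k * cos (INR k * t)) (fst (f t)) /\
            is_series (fun k => c k * sin (INR k * t)) (snd (f t)).

Definition conv (a b : nat -> R) (n : nat) : R := sum_f_R0 (fun k => a k * b (n - k)%nat) n.

Fixpoint conv_pow (a : nat -> R) (n : nat) : nat -> R :=
  match n with
  | O => fun k => if Nat.eq_dec k 0 then 1 else 0
  | S m => conv a (conv_pow a m)
  end.

Lemma Rabs_trig_le c x : Rabs (c * cos x) <= Rabs c /\ Rabs (c * sin x) <= Rabs c.
Proof.
rewrite !Rabs_mult; assert (h := Rabs_pos c).
assert (Rabs (cos x) <= 1) by (apply Rabs_le; destruct (COS_bound x); lra).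
assert (Rabs (sin x) <= 1) by (apply Rabs_le; destruct (SIN_bound x); lra).
split; nra.
Qed.

Lemma fourier_sum_conv a b f g : fourier_sum a f -> fourier_sum b g ->
  fourier_sum (conv a b) (fun t => f t * g t)%C.
Proof.
intros [a1 fa] [b1 gb]; split.
  apply ex_series_Rabs_le with (fun n => sum_f_R0 (fun k => Rabs (a k) * Rabs (b (n - k)%nat)) n).
    intros n; rewrite Rabs_Rabsolu; eapply Rle_trans; [apply Rabs_triang_gen|].
    right; apply sum_eq; intros i _; apply Rabs_mult.
  destruct a1 as [la ha], b1 as [lb hb]; exists (la * lb).
  apply (is_series_mult (fun k => Rabs (a k)) (fun k => Rabs (b k)) la lb); trivial.
    apply ex_series_ext with (fun k => Rabs (a k)); [|exists la; trivial].
    intros k; now rewrite Rabs_Rabsolu.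
  apply ex_series_ext with (fun k => Rabs (b k)); [|exists lb; trivial].
  intros k; now rewrite Rabs_Rabsolu.
assert (abs_a : forall t, ex_series (fun k => Rabs (a k * cos (INR k * t))) /\
                          ex_series (fun k => Rabs (a k * sin (INR k * t)))).
  intros t; split; apply ex_series_Rabs_le with (fun k => Rabs (a k)); trivial;
    intros k; rewrite Rabs_Rabsolu; apply Rabs_trig_le.
assert (abs_b : forall t, ex_series (fun k => Rabs (b k * cos (INR k * t))) /\
                          ex_series (fun k => Rabs (b k * sin (INR k * t)))).
  intros t; split; apply ex_series_Rabs_le with (fun k => Rabs (b k)); trivial;
    intros k; rewrite Rabs_Rabsolu; apply Rabs_trig_le.
intros t; destruct (fa t) as [fc fs], (gb t) as [gc gs].
destruct (abs_a t) as [ac as_], (abs_b t) as [bc bs].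
assert (idx : forall n k, (k <= n)%nat -> INR n * t = INR k * t + INR (n - k) * t).
  intros n k kn; rewrite <- Rmult_plus_distr_r, <- plus_INR; do 2 f_equal; lia.
split; unfold Cmult; cbn [fst snd].
- refine (is_series_ext _ _ _ _ (is_series_minus _ _ _ _
    (is_series_mult _ _ _ _ fc gc ac bc) (is_series_mult _ _ _ _ fs gs as_ bs))).
  intros n; transitivity (
    sum_f_R0 (fun k => a k * cos (INR k * t) * (b (n - k)%nat * cos (INR (n - k) * t))) n -
    sum_f_R0 (fun k => a k * sin (INR k * t) * (b (n - k)%nat * sin (INR (n - k) * t))) n); [reflexivity|].
  unfold conv.
  rewrite (Rmult_comm (sum_f_R0 _ _)), scal_sum, <- minus_sum; apply sum_eq; intros k kn.
  rewrite (idx n k kn), cos_plus; ring.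
- refine (is_series_ext _ _ _ _ (is_series_plus _ _ _ _
    (is_series_mult _ _ _ _ fc gs ac bs) (is_series_mult _ _ _ _ fs gc as_ bc))).
  intros n; transitivity (
    sum_f_R0 (fun k => a k * cos (INR k * t) * (b (n - k)%nat * sin (INR (n - k) * t))) n +
    sum_f_R0 (fun k => a k * sin (INR k * t) * (b (n - k)%nat * cos (INR (n - k) * t))) n); [reflexivity|].
  unfold conv.
  rewrite (Rmult_comm (sum_f_R0 _ _)), scal_sum, <- plus_sum; apply sum_eq; intros k kn.
  rewrite (idx n k kn), sin_plus; ring.
Qed.

Lemma fourier_sum_pow a f n : fourier_sum a f ->
  fourier_sum (conv_pow a n) (fun t => f t ^ n)%C.
Proof.
intros ha; induction n as [|n IH].
  split.
    exists 1; apply is_series_ext with (fun k => if Nat.eq_dec k 0 then 1 else 0);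
      [|apply is_series_single].
    intros k; simpl; destruct (Nat.eq_dec k 0); [rewrite Rabs_R1|rewrite Rabs_R0]; trivial.
  intros t; simpl; split.
    apply is_series_ext with (fun k => if Nat.eq_dec k 0 then 1 else 0);
      [|apply is_series_single].
    intros k; destruct (Nat.eq_dec k 0) as [->|_]; simpl; [rewrite Rmult_0_l, cos_0|]; ring.
  apply is_series_ext with (fun k => 0); [|apply is_series_zero].
  intros k; destruct (Nat.eq_dec k 0) as [->|_]; simpl; [rewrite Rmult_0_l, sin_0|]; ring.
apply (fourier_sum_conv a (conv_pow a n) f (fun t => f t ^ n)%C); trivial.
Qed.

Definition ccontinuous (f : R -> C) : Prop :=
  forall t, continuous (fun t => fst (f t)) t /\ continuous (fun t => snd (f t)) t.

Lemma ccontinuous_mult f g : ccontinuous f -> ccontinuous g ->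
  ccontinuous (fun t => f t * g t)%C.
Proof.
intros hf hg t; destruct (hf t) as [f1 f2], (hg t) as [g1 g2]; split; simpl.
- apply (continuous_minus (fun t => fst (f t) * fst (g t)) (fun t => snd (f t) * snd (g t)));
    [apply (continuous_mult (fun t => fst (f t)))|apply (continuous_mult (fun t => snd (f t)))]; trivial.
- apply (continuous_plus (fun t => fst (f t) * snd (g t)) (fun t => snd (f t) * fst (g t)));
    [apply (continuous_mult (fun t => fst (f t)))|apply (continuous_mult (fun t => snd (f t)))]; trivial.
Qed.

Lemma ccontinuous_pow f n : ccontinuous f -> ccontinuous (fun t => f t ^ n)%C.
Proof.
intros hf; induction n as [|n IH].
  intros t; split; apply continuous_const.
exact (ccontinuous_mult f (fun t => f t ^ n)%C hf IH).
Qed.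

Lemma lipschitz_continuous (f : R -> R) L : (forall s t, Rabs (f s - f t) <= L * Rabs (s - t)) ->
  forall t, continuous f t.
Proof.
intros h t; apply continuity_pt_filterlim; intros e e0.
assert (L0 : 0 <= L).
  specialize (h 1 0); replace (1 - 0) with 1 in h by ring; rewrite Rabs_R1 in h.
  assert (p := Rabs_pos (f 1 - f 0)); lra.
exists (e / (L + 1)); split; [apply Rdiv_lt_0_compat; lra|].
intros s [_ hs]; unfold dist in *; simpl in *; unfold R_dist in *.
apply Rle_lt_trans with (1 := h s t).
apply Rle_lt_trans with ((L + 1) * Rabs (s - t)).
  apply Rmult_le_compat_r; [apply Rabs_pos|lra].
apply Rmult_lt_reg_r with (/ (L + 1)); [apply Rinv_0_lt_compat; lra|].
replace ((L + 1) * Rabs (s - t) * / (L + 1)) with (Rabs (s - t)) by (field; lra); trivial.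
Qed.

Lemma fourier_sum_continuous c f : fourier_sum c f ->
  ex_series (fun k => INR k * Rabs (c k)) -> ccontinuous f.
Proof.
intros [_ hf] [L hL] t.
assert (lip : forall g : R -> R, (forall x y, Rabs (g x - g y) <= Rabs (x - y)) ->
    forall k s r, Rabs (c k * g (INR k * s) - c k * g (INR k * r)) <=
       Rabs (s - r) * (INR k * Rabs (c k))).
  intros g hg k s r; rewrite <- Rmult_minus_distr_l, Rabs_mult.
  specialize (hg (INR k * s) (INR k * r)).
  rewrite <- Rmult_minus_distr_l, Rabs_mult, (Rabs_pos_eq (INR k)) in hg by apply pos_INR.
  assert (p := Rabs_pos (c k)); nra.
assert (mvt : forall g dg : R -> R, (forall x, is_derive g x (dg x)) ->
    (forall x, Rabs (dg x) <= 1) -> forall x y, Rabs (g x - g y) <= Rabs (x - y)).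
  intros g dg D b x y; destruct (MVT_gen g y x dg) as [z [_ E]].
  - intros u _; apply D.
  - intros u _; apply continuity_pt_filterlim, (continuous_of_ex_derive g); exists (dg u); apply D.
  - rewrite E, Rabs_mult; specialize (b z); assert (p := Rabs_pos (x - y)); nra.
split.
- apply (lipschitz_continuous _ L); intros s r; destruct (hf s) as [hs _], (hf r) as [hr _].
  rewrite Rmult_comm.
  apply (is_series_Rabs_le (fun k => c k * cos (INR k * s) - c k * cos (INR k * r))
    (fun k => Rabs (s - r) * (INR k * Rabs (c k)))).
  + intros k; apply (lip cos), (mvt cos (fun x => - sin x)).
      intros x; auto_derive; trivial; ring.
    intros x; rewrite Rabs_Ropp; apply Rabs_le; destruct (SIN_bound x); lra.
  + exact (is_series_minus _ _ _ _ hs hr).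
  + exact (is_series_scal _ _ _ hL).
- apply (lipschitz_continuous _ L); intros s r; destruct (hf s) as [_ hs], (hf r) as [_ hr].
  rewrite Rmult_comm.
  apply (is_series_Rabs_le (fun k => c k * sin (INR k * s) - c k * sin (INR k * r))
    (fun k => Rabs (s - r) * (INR k * Rabs (c k)))).
  + intros k; apply (lip sin), (mvt sin cos).
      intros x; auto_derive; trivial; ring.
    intros x; apply Rabs_le; destruct (COS_bound x); lra.
  + exact (is_series_minus _ _ _ _ hs hr).
  + exact (is_series_scal _ _ _ hL).
Qed.

Lemma is_RInt_cos_int (k m : nat) : is_RInt (fun t => cos ((INR k - INR m) * t)) 0 PI
  (if Nat.eq_dec k m then PI else 0).
Proof.
destruct (Nat.eq_dec k m) as [->|N].
  apply (is_RInt_ext (fun _ => 1)).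
    intros t _; replace ((INR m - INR m) * t) with 0 by ring; now rewrite cos_0.
  replace PI with (scal (PI - 0) 1) at 2 by (unfold scal; simpl; unfold mult; simpl; ring).
  apply (is_RInt_const (V := R_NormedModule)).
set (d := INR k - INR m).
assert (d0 : d <> 0) by (unfold d; intros E; apply N, INR_eq; lra).
assert (s : sin (d * PI) = 0).
  apply sin_eq_0_1; exists (Z.of_nat k - Z.of_nat m)%Z.
  unfold d; now rewrite minus_IZR, <- !INR_IZR_INZ.
replace 0 with (minus (sin (d * PI) / d) (sin (d * 0) / d)) at 2.
  apply (is_RInt_derive (fun t => sin (d * t) / d)).
    intros t _; auto_derive; trivial; field; trivial.
  intros t _; apply continuous_of_ex_derive; auto_derive; trivial.
unfold minus, plus, opp; simpl; rewrite Rmult_0_r, sin_0, s; field; trivial.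
Qed.

Lemma fourier_coef c f m J : fourier_sum c f ->
  is_RInt (fun t => cos (INR m * t) * fst (f t) + sin (INR m * t) * snd (f t)) 0 PI J ->
  J = PI * c m.
Proof.
intros [[r hr] hf] hJ; assert (P := PI_RGT_0).
assert (h : is_series (fun k => c k * (if Nat.eq_dec k m then PI else 0)) J).
  apply (is_series_RInt (fun k t => c k * cos ((INR k - INR m) * t))
    (fun t => cos (INR m * t) * fst (f t) + sin (INR m * t) * snd (f t))
    (fun k => Rabs (c k)) _ r 0 PI); trivial.
  - lra.
  - intros k t; apply Rabs_trig_le.
  - intros k; exact (is_RInt_scal _ _ _ (c k) _ (is_RInt_cos_int k m)).
  - intros t; destruct (hf t) as [hc hs].
    refine (is_series_ext _ _ _ _ (is_series_plus _ _ _ _ (is_series_scal (cos (INR m * t)) _ _ hc)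
      (is_series_scal (sin (INR m * t)) _ _ hs))).
    intros k; unfold plus, scal; simpl; unfold mult; simpl.
    rewrite Rmult_minus_distr_r, cos_minus; eq_in_R; ring.
rewrite <- (is_series_unique _ _ h); apply is_series_unique.
apply is_series_ext with (fun k => if Nat.eq_dec k m then PI * c m else 0); [|apply is_series_single].
intros k; destruct (Nat.eq_dec k m) as [->|_]; eq_in_R; ring.
Qed.

Lemma Cmod_pow_sub_le (u v : C) M n : Cmod u <= M -> Cmod v <= M ->
  Cmod (u ^ S n - v ^ S n) <= INR (S n) * Cmod (u - v) * M ^ n.
Proof.
intros hu hv; assert (u0 := Cmod_ge_0 u); assert (d0 := Cmod_ge_0 (u - v)).
induction n as [|n IH].
  replace (u ^ 1 - v ^ 1)%C with (u - v)%C by (simpl; ring); simpl; lra.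
replace (u ^ S (S n) - v ^ S (S n))%C with (u * (u ^ S n - v ^ S n) + (u - v) * v ^ S n)%C
  by (simpl; ring).
eapply Rle_trans; [apply Cmod_triangle|]; rewrite !Cmod_mult, Cmod_pow.
assert (V : Cmod v ^ S n <= M ^ S n) by (apply pow_incr; split; [apply Cmod_ge_0|trivial]).
rewrite (S_INR (S n)).
replace ((INR (S n) + 1) * Cmod (u - v) * M ^ S n) with
  (M * (INR (S n) * Cmod (u - v) * M ^ n) + Cmod (u - v) * M ^ S n) by (simpl; ring).
apply Rplus_le_compat; [|apply Rmult_le_compat_l; trivial].
apply Rmult_le_compat; trivial; apply Cmod_ge_0.
Qed.

Lemma exp_pow x n : exp (INR n * x) = exp x ^ n.
Proof.
induction n as [|n IH]; [simpl; now rewrite Rmult_0_l, exp_0|].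
rewrite S_INR, Rmult_plus_distr_r, Rmult_1_l, exp_plus, IH; simpl; ring.
Qed.

Section LocalLimit.

Variables (a b : nat -> R) (s : R).
Hypothesis a_ge0 : forall k, 0 <= a k.
Hypothesis b_ge0 : forall k, 0 <= b k.
Hypothesis a_sum : is_series a 1.
Hypothesis b_sum : is_series b 1.
Hypothesis a_mean : is_series (fun k => INR k * a k) 1.
Hypothesis a_var : is_series (fun k => (INR k - 1) ^ 2 * a k) s.
Hypothesis a_third : ex_series (fun k => INR k ^ 3 * a k).
Hypothesis b_first : ex_series (fun k => INR k * b k).
Hypothesis s_gt0 : 0 < s.
Hypothesis a0_gt0 : 0 < a 0%nat.
Hypothesis a1_gt0 : 0 < a 1%nat.

Definition fourier (c : nat -> R) (t : R) : C :=
  (Series (fun k => c k * cos (INR k * t)), Series (fun k => c k * sin (INR k * t))).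

Lemma fourier_sum_fourier c : ex_series (fun k => Rabs (c k)) -> fourier_sum c (fourier c).
Proof.
intros h; split; trivial.
intros t; split; apply Series_correct, ex_series_Rabs_le with (fun k => Rabs (c k)); trivial;
  intros k; apply Rabs_trig_le.
Qed.

Lemma ex_series_Rabs_pos (c : nat -> R) l : (forall k, 0 <= c k) -> is_series c l ->
  ex_series (fun k => Rabs (c k)).
Proof.
intros h hc; exists l; apply is_series_ext with c; trivial.
intros k; now rewrite Rabs_pos_eq.
Qed.

Lemma fourier_sum_pmf_le c : (forall k, 0 <= c k) -> is_series c 1 ->
  forall t, Cmod (fourier c t) <= 1.
Proof.
intros h hc t; destruct (fourier_sum_fourier c (ex_series_Rabs_pos c 1 h hc)) as [_ F].
destruct (F t) as [Fc Fs].
apply (is_series_Cmod_le (fun k => c k * cos (INR k * t)) (fun k => c k * sin (INR k * t)) c); trivial.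
intros k; assert (e := sin2_cos2 (INR k * t)); unfold Rsqr in e.
replace ((c k * cos (INR k * t)) ^ 2 + (c k * sin (INR k * t)) ^ 2) with
  (c k ^ 2 * (sin (INR k * t) * sin (INR k * t) + cos (INR k * t) * cos (INR k * t))) by ring.
rewrite e; lra.
Qed.

Let alpha := fourier a.
Let beta := fourier b.

Let Fa : fourier_sum a alpha.
Proof. apply fourier_sum_fourier, (ex_series_Rabs_pos a 1); trivial. Qed.
Let Fb : fourier_sum b beta.
Proof. apply fourier_sum_fourier, (ex_series_Rabs_pos b 1); trivial. Qed.

(* Since [a 0] and [a 1] are both positive, the phases of the first two terms
   separate away from [t = 0]. *)
Lemma alpha_decay : exists c, 0 < c /\
  forall t, 0 <= t <= PI -> Cmod (alpha t) <= exp (- (c * t ^ 2)).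
Proof.
set (S := a 0%nat + a 1%nat); set (p := a 0%nat * a 1%nat).
assert (p0 : 0 < p) by (unfold p; nra).
assert (S0 : 0 < S) by (unfold S; lra).
assert (pS : p <= S ^ 2 / 4).
  unfold p, S; assert (h := pow2_ge_0 (a 0%nat - a 1%nat)); nra.
exists (p / (18 * S)); split; [apply Rdiv_lt_0_compat; lra|].
intros t ht; set (x := p / (18 * S) * t ^ 2).
assert (P := PI_4).
assert (xS : x * (18 * S) = p * t ^ 2) by (unfold x; field; lra).
assert (t2 : 0 <= t ^ 2 <= 16) by nra.
assert (x0 : 0 <= x).
  unfold x; apply Rmult_le_pos; [apply Rlt_le, Rdiv_lt_0_compat; lra|lra].
assert (xS' : x <= S).
  assert (p * t ^ 2 <= S ^ 2 / 4 * 16) by (apply Rmult_le_compat; lra); nra.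
apply Rle_trans with (1 - x); [|assert (e := exp_ineq1_le (- x)); lra].
set (first := (a 0%nat + a 1%nat * cos t, a 1%nat * sin t) : C).
replace (alpha t) with (first + (alpha t - first))%C by ring.
eapply Rle_trans; [apply Cmod_triangle|].
apply Rle_trans with ((S - x) + (1 - S)); [|lra].
apply Rplus_le_compat.
  assert (h := cos_le_strict t ht).
  unfold Cmod, first; cbn [fst snd].
  rewrite <- (sqrt_pow2 (S - x)) by lra; apply sqrt_le_1_alt.
  replace ((a 0%nat + a 1%nat * cos t) ^ 2 + (a 1%nat * sin t) ^ 2) with
    (a 0%nat ^ 2 + 2 * p * cos t + a 1%nat ^ 2 * ((sin t)² + (cos t)²))
    by (unfold p, Rsqr; ring).
  rewrite sin2_cos2; unfold S in *; unfold p in *; nra.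
destruct Fa as [_ F]; destruct (F t) as [Fc Fs].
set (one j y k := if Nat.eq_dec k j then y else 0 : R).
apply (is_series_Cmod_le
  (fun k => a k * cos (INR k * t) - one 0%nat (a 0%nat) k - one 1%nat (a 1%nat * cos t) k)
  (fun k => a k * sin (INR k * t) - one 1%nat (a 1%nat * sin t) k)
  (fun k => a k - one 0%nat (a 0%nat) k - one 1%nat (a 1%nat) k)).
- intros k; specialize (a_ge0 k); unfold one; destruct k as [|[|k]]; simpl; lra.
- intros k; unfold one; destruct k as [|[|k]].
  + simpl; rewrite !Rmult_0_l, cos_0, sin_0; lra.
  + simpl; rewrite !Rmult_1_l; lra.
  + cbn [Nat.eq_dec]; generalize (INR (Datatypes.S (Datatypes.S k)) * t); intros y.
    assert (e := sin2_cos2 y); unfold Rsqr in e; simpl; nra.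
- replace (fst (alpha t) + _) with (fst (alpha t) - a 0%nat - a 1%nat * cos t)
    by (unfold first; simpl; ring).
  exact (is_series_minus _ _ _ _ (is_series_minus _ _ _ _ Fc (is_series_single 0 (a 0%nat)))
    (is_series_single 1 (a 1%nat * cos t))).
- exact (is_series_minus _ _ _ _ Fs (is_series_single 1 (a 1%nat * sin t))).
- replace (1 - S) with (1 - a 0%nat - a 1%nat) by (unfold S; ring).
  exact (is_series_minus _ _ _ _ (is_series_minus _ _ _ _ a_sum (is_series_single 0 (a 0%nat)))
    (is_series_single 1 (a 1%nat))).
Qed.

Let U t := (expi (- t) * alpha t)%C.
Let W t := (expi t * beta t)%C.

Lemma U_taylor : exists C1, 0 <= C1 /\ forall t, 0 <= t <= PI ->
  Cmod (U t - RtoC (exp (- (s * t ^ 2 / 2)))) <= C1 * t ^ 3.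
Proof.
assert (M : ex_series (fun k => Rabs (INR k - 1) ^ 3 * a k)).
  apply ex_series_Rabs_le with (fun k => INR k ^ 3 * a k + a k).
    intros k; rewrite Rabs_pos_eq.
      2: apply Rmult_le_pos; [apply pow_le, Rabs_pos|trivial].
    replace (INR k ^ 3 * a k + a k) with ((INR k ^ 3 + 1) * a k) by ring.
    apply Rmult_le_compat_r; trivial.
    destruct k as [|k].
      simpl; rewrite Rabs_left by lra; lra.
    rewrite S_INR; assert (h := pos_INR k); rewrite Rabs_pos_eq by lra.
    replace (INR k + 1 - 1) with (INR k) by ring; nra.
  exact (ex_series_plus _ _ a_third (ex_intro _ 1 a_sum)).
destruct M as [M hM].
assert (M0 : 0 <= M).
  apply (is_series_le (fun _ => 0) (fun k => Rabs (INR k - 1) ^ 3 * a k)); trivial.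
    intros k; apply Rmult_le_pos; [apply pow_le, Rabs_pos|trivial].
  apply is_series_zero.
exists (2 * M + s ^ 2); split; [nra|]; intros t [t0 tpi].
assert (P := PI_4).
replace (U t - RtoC (exp (- (s * t ^ 2 / 2))))%C with
  ((U t - RtoC (1 - s * t ^ 2 / 2)) + RtoC ((1 - s * t ^ 2 / 2) - exp (- (s * t ^ 2 / 2))))%C
  by (rewrite !RtoC_minus; ring).
eapply Rle_trans; [apply Cmod_triangle|]; rewrite Rmult_plus_distr_r; apply Rplus_le_compat.
- destruct Fa as [_ F]; destruct (F t) as [Fc Fs].
  set (x k := (INR k - 1) * t).
  apply (is_series_Cmod_le (fun k => a k * (cos (x k) - 1 + x k ^ 2 / 2))
     (fun k => a k * (sin (x k) - x k)) (fun k => 2 * t ^ 3 * (Rabs (INR k - 1) ^ 3 * a k))).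
  + intros k; repeat apply Rmult_le_pos; try apply pow_le; try apply Rabs_pos; trivial; lra.
  + intros k.
    assert (h1 := Rabs_cos_taylor2_le (x k)); assert (h2 := Rabs_sin_sub_le (x k)).
    replace (2 * t ^ 3 * (Rabs (INR k - 1) ^ 3 * a k)) with (2 * (a k * Rabs (x k) ^ 3)).
      2: unfold x; rewrite Rabs_mult, (Rabs_pos_eq t) by trivial; ring.
    set (X := Rabs (x k) ^ 3) in *.
    assert (X0 : 0 <= X) by (apply pow_le, Rabs_pos).
    assert (q : forall y, Rabs y <= X -> (a k * y) ^ 2 <= (a k * X) ^ 2).
      intros y hy; rewrite !Rpow_mult_distr; apply Rmult_le_compat_l; [apply pow2_ge_0|].
      apply pow_maj_Rabs; trivial.
    assert (q1 := q _ h1); assert (q2 := q _ h2).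
    assert (q3 := pow2_ge_0 (a k * X)); nra.
  + replace (fst (U t) + _) with
      (cos t * fst (alpha t) + sin t * snd (alpha t) - 1 + t ^ 2 / 2 * s)
      by (unfold U, expi; simpl; rewrite cos_neg, sin_neg; field).
    refine (is_series_ext _ _ _ _ (is_series_plus _ _ _ _ (is_series_minus _ _ _ _
      (is_series_plus _ _ _ _ (is_series_scal (cos t) _ _ Fc) (is_series_scal (sin t) _ _ Fs))
      a_sum) (is_series_scal (t ^ 2 / 2) _ _ a_var))).
    intros k; unfold minus, plus, opp, scal; simpl; unfold mult; simpl.
    replace (x k) with (INR k * t - t) by (unfold x; ring); rewrite cos_minus; eq_in_R; field.
  + replace (snd (U t) + _) with
      (cos t * snd (alpha t) - sin t * fst (alpha t) - t * (1 - 1))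
      by (unfold U, expi; simpl; rewrite cos_neg, sin_neg; ring).
    refine (is_series_ext _ _ _ _ (is_series_minus _ _ _ _ (is_series_minus _ _ _ _
       (is_series_scal (cos t) _ _ Fs) (is_series_scal (sin t) _ _ Fc))
       (is_series_scal t _ _ (is_series_minus _ _ _ _ a_mean a_sum)))).
    intros k; unfold minus, plus, opp, scal; simpl; unfold mult; simpl.
    replace (x k) with (INR k * t - t) by (unfold x; ring); rewrite sin_minus; eq_in_R; ring.
  + replace (2 * M * t ^ 3) with (2 * t ^ 3 * M) by ring.
    exact (is_series_scal _ _ _ hM).
- rewrite Cmod_R; assert (y0 : 0 <= s * t ^ 2 / 2) by nra.
  destruct (exp_opp_taylor1 _ y0) as [e1 e2].
  rewrite Rabs_minus_sym, Rabs_pos_eq by lra.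
  assert (t3 : 0 <= t ^ 3) by (apply pow_le; trivial).
  assert (s2 : 0 <= s ^ 2) by apply pow2_ge_0.
  assert (h : s ^ 2 * t ^ 3 * t <= s ^ 2 * t ^ 3 * 4) by (apply Rmult_le_compat_l; [nra|lra]).
  assert (0 <= s ^ 2 * t ^ 3) by (apply Rmult_le_pos; trivial).
  replace ((s * t ^ 2 / 2) ^ 2 / 2) with (s ^ 2 * t ^ 3 * t / 8) in e2 by field; lra.
Qed.

Lemma W_taylor : exists C2, 0 <= C2 /\ forall t, 0 <= t ->
  Cmod (W t - 1) <= C2 * t.
Proof.
destruct b_first as [L hL].
assert (L0 : 0 <= L).
  apply (is_series_le (fun _ => 0) (fun k => INR k * b k)); trivial.
    intros k; apply Rmult_le_pos; [apply pos_INR|trivial].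
  apply is_series_zero.
exists (2 * (L + 1)); split; [lra|]; intros t t0.
destruct Fb as [_ F]; destruct (F t) as [Fc Fs].
set (x k := (INR k + 1) * t).
apply (is_series_Cmod_le (fun k => b k * (cos (x k) - 1)) (fun k => b k * sin (x k))
  (fun k => 2 * t * (INR k * b k + b k))).
- intros k; specialize (b_ge0 k); assert (h := pos_INR k); repeat apply Rmult_le_pos; try lra; nra.
- intros k; replace (2 * t * (INR k * b k + b k)) with (2 * (b k * Rabs (x k))).
    2: unfold x; assert (h := pos_INR k); rewrite Rabs_pos_eq by nra; ring.
  assert (h1 := Rabs_cos_sub1_le (x k)); assert (h2 := Rabs_sin_le (x k)).
  set (X := Rabs (x k)) in *.
  assert (q : forall y, Rabs y <= X -> (b k * y) ^ 2 <= (b k * X) ^ 2).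
    intros y hy; rewrite !Rpow_mult_distr; apply Rmult_le_compat_l; [apply pow2_ge_0|].
    apply pow_maj_Rabs; trivial.
  assert (q1 := q _ h1); assert (q2 := q _ h2).
  assert (q3 := pow2_ge_0 (b k * X)); nra.
- replace (fst (W t) + _) with (cos t * fst (beta t) - sin t * snd (beta t) - 1)
    by (unfold W, expi; simpl; ring).
  refine (is_series_ext _ _ _ _ (is_series_minus _ _ _ _ (is_series_minus _ _ _ _
    (is_series_scal (cos t) _ _ Fc) (is_series_scal (sin t) _ _ Fs)) b_sum)).
  intros k; unfold minus, plus, opp, scal; simpl; unfold mult; simpl.
  replace (x k) with (INR k * t + t) by (unfold x; ring); rewrite cos_plus; eq_in_R; ring.
- replace (snd (W t) + _) with (cos t * snd (beta t) + sin t * fst (beta t))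
    by (unfold W, expi; simpl; ring).
  refine (is_series_ext _ _ _ _ (is_series_plus _ _ _ _
    (is_series_scal (cos t) _ _ Fs) (is_series_scal (sin t) _ _ Fc))).
  intros k; unfold minus, plus, opp, scal; simpl; unfold mult; simpl.
  replace (x k) with (INR k * t + t) by (unfold x; ring); rewrite sin_plus; eq_in_R; ring.
- replace (2 * (L + 1) * t) with (2 * t * (L + 1)) by ring.
  exact (is_series_scal _ _ _ (is_series_plus _ _ _ _ hL b_sum)).
Qed.

Lemma Cmod_W_le t : Cmod (W t) <= 1.
Proof.
unfold W; rewrite Cmod_mult, Cmod_expi, Rmult_1_l.
apply fourier_sum_pmf_le; trivial.
Qed.

(* [W t * U t ^ n] is the Fourier integrand of the coefficient of index [n - 1],
   centred thanks to the mean being 1. *)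
Lemma integrand_bound : exists c K1 K2, 0 < c /\ 0 <= K1 /\ 0 <= K2 /\
  forall m t, 0 <= t <= PI ->
  Cmod (W t * U t ^ S m - RtoC (exp (- (s * t ^ 2 / 2))) ^ S m) <=
  (INR (S m) * K1 * t ^ 3 + K2 * t) * exp (- (c * INR m * t ^ 2)).
Proof.
destruct alpha_decay as [c0 [c00 hd]], U_taylor as [K1 [K10 hU]], W_taylor as [K2 [K20 hW]].
exists (Rmin c0 (s / 2)), K1, K2; repeat split; trivial.
  apply Rmin_glb_lt; lra.
intros m t ht; specialize (hd t ht); specialize (hU t ht); specialize (hW t (proj1 ht)).
set (c := Rmin c0 (s / 2)); set (q := exp (- (s * t ^ 2 / 2))) in *.
set (M := exp (- (c * t ^ 2))).
assert (t2 := pow2_ge_0 t).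
assert (cle : c <= c0 /\ c <= s / 2) by (split; [apply Rmin_l|apply Rmin_r]).
assert (exp_le : forall x y, x <= y -> exp x <= exp y).
  intros x y [h| ->]; [left; now apply exp_increasing|lra].
assert (hUM : Cmod (U t) <= M).
  unfold U; rewrite Cmod_mult, Cmod_expi, Rmult_1_l.
  apply Rle_trans with (1 := hd), exp_le; nra.
assert (q0 : 0 < q) by apply exp_pos.
assert (hqM : Cmod (RtoC q) <= M).
  rewrite Cmod_R, Rabs_pos_eq by lra; apply exp_le; nra.
assert (M0 : 0 < M) by apply exp_pos.
assert (M1 : M <= 1).
  rewrite <- exp_0; apply exp_le; assert (0 < c) by (apply Rmin_glb_lt; lra); nra.
assert (EM : M ^ m = exp (- (c * INR m * t ^ 2))).
  unfold M; rewrite <- exp_pow; f_equal; ring.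
rewrite <- EM.
replace (W t * U t ^ S m - RtoC q ^ S m)%C with
  (W t * (U t ^ S m - RtoC q ^ S m) + (W t - 1) * RtoC q ^ S m)%C by ring.
eapply Rle_trans; [apply Cmod_triangle|]; rewrite !Cmod_mult, Cmod_pow.
rewrite Rmult_plus_distr_r; apply Rplus_le_compat.
  assert (h := Cmod_pow_sub_le (U t) (RtoC q) M m hUM hqM).
  assert (hW1 := Cmod_W_le t); assert (n0 := Cmod_ge_0 (U t ^ S m - RtoC q ^ S m)).
  apply Rle_trans with (1 * Cmod (U t ^ S m - RtoC q ^ S m)).
    apply Rmult_le_compat_r; trivial.
  rewrite Rmult_1_l; apply Rle_trans with (1 := h).
  apply Rmult_le_compat_r; [apply pow_le; lra|].
  rewrite Rmult_assoc; apply Rmult_le_compat_l; [apply pos_INR|trivial].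
apply Rmult_le_compat; trivial; [apply Cmod_ge_0|apply pow_le, Cmod_ge_0|].
apply Rle_trans with (M ^ S m).
  apply pow_incr; split; [apply Cmod_ge_0|trivial].
simpl; assert (h := pow_lt M m M0); nra.
Qed.

Lemma gauss_moments A B1 B2 : 0 < A -> exists J,
  is_RInt (fun t => (B1 * t ^ 3 + B2 * t) * exp (- (A * t ^ 2))) 0 PI J /\
  (0 <= B1 -> 0 <= B2 -> J <= B1 / (2 * A ^ 2) + B2 / (2 * A)).
Proof.
intros A0; assert (P := PI_RGT_0).
set (G t := - (B1 * (t ^ 2 / (2 * A) + 1 / (2 * A ^ 2)) + B2 / (2 * A)) * exp (- (A * t ^ 2))).
exists (minus (G PI) (G 0)); split.
  apply (is_RInt_derive G).
    intros t _; unfold G; auto_derive; [lra|simpl; field; lra].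
  intros t _; apply continuous_of_ex_derive; auto_derive; trivial.
intros B10 B20.
replace (B1 / (2 * A ^ 2) + B2 / (2 * A)) with (0 - G 0).
  apply Rplus_le_compat_r; unfold G.
  assert (e := exp_pos (- (A * PI ^ 2))).
  assert (0 <= PI ^ 2 / (2 * A)) by (apply Rmult_le_pos; [nra|left; apply Rinv_0_lt_compat; lra]).
  assert (A2 : 0 < A ^ 2) by nra.
  assert (0 <= 1 / (2 * A ^ 2)) by (apply Rmult_le_pos; [lra|left; apply Rinv_0_lt_compat; lra]).
  assert (0 <= B2 / (2 * A)) by (apply Rmult_le_pos; [lra|left; apply Rinv_0_lt_compat; lra]).
  assert (0 <= B1 * (PI ^ 2 / (2 * A) + 1 / (2 * A ^ 2))) by (apply Rmult_le_pos; lra).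
  nra.
unfold G; replace (- (A * 0 ^ 2)) with 0 by ring; rewrite exp_0; field; lra.
Qed.

Let Q m := RInt (fun t => exp (- (s * t ^ 2 / 2)) ^ S m) 0 PI.

Lemma coef_gauss_error : exists K, forall m, (1 <= m)%nat ->
  Rabs (PI * conv b (conv_pow a (S m)) m - Q m) <= K / INR (S m).
Proof.
destruct integrand_bound as [c [K1 [K2 [c0 [K10 [K20 hb]]]]]].
exists (2 * K1 / c ^ 2 + K2 / c); intros m m1.
assert (P := PI_RGT_0).
set (f t := (beta t * alpha t ^ S m)%C).
assert (Ff : fourier_sum (conv b (conv_pow a (S m))) f).
  apply fourier_sum_conv; trivial; apply fourier_sum_pow; trivial.
assert (ca : ccontinuous alpha).
  apply (fourier_sum_continuous a); trivial.
  exists 1; apply is_series_ext with (fun k => INR k * a k); trivial.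
  intros k; now rewrite (Rabs_pos_eq (a k)).
assert (cb : ccontinuous beta).
  apply (fourier_sum_continuous b); trivial.
  apply ex_series_ext with (fun k => INR k * b k); trivial.
  intros k; now rewrite (Rabs_pos_eq (b k)).
assert (cf : ccontinuous f) by (apply ccontinuous_mult, ccontinuous_pow; trivial).
set (g t := cos (INR m * t) * fst (f t) + sin (INR m * t) * snd (f t)).
assert (eg : ex_RInt g 0 PI).
  apply (ex_RInt_continuous (V := R_CompleteNormedModule)); intros t _; destruct (cf t) as [f1 f2].
  apply (continuous_plus (fun t => cos (INR m * t) * fst (f t)) (fun t => sin (INR m * t) * snd (f t))).
    apply (continuous_mult (fun t => cos (INR m * t))); trivial.
    apply continuous_of_ex_derive; auto_derive; trivial.
  apply (continuous_mult (fun t => sin (INR m * t))); trivial.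
  apply continuous_of_ex_derive; auto_derive; trivial.
destruct eg as [J hJ].
rewrite <- (fourier_coef _ f m J Ff hJ).
assert (hQ : is_RInt (fun t => exp (- (s * t ^ 2 / 2)) ^ S m) 0 PI (Q m)).
  apply (RInt_correct (V := R_CompleteNormedModule)), ex_RInt_of_ex_derive.
  intros t; apply ex_derive_pow; auto_derive; trivial.
assert (Im : 1 <= INR m) by (apply (le_INR 1); trivial).
assert (A0 : 0 < c * INR m) by nra.
destruct (gauss_moments (c * INR m) (INR (S m) * K1) K2 A0) as [E [hE E_le]].
apply Rle_trans with E.
  apply (norm_RInt_le (V := R_NormedModule)
    (fun t => minus (g t) (exp (- (s * t ^ 2 / 2)) ^ S m))
    (fun t => (INR (S m) * K1 * t ^ 3 + K2 * t) * exp (- (c * INR m * t ^ 2))) 0 PI); trivial.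
  - lra.
  - intros t ht; apply Rle_trans with (2 := hb m t ht).
    eapply Rle_trans; [|apply re_le_Cmod]; right.
    change (Rabs (g t - exp (- (s * t ^ 2 / 2)) ^ S m) =
      Rabs (fst (W t * U t ^ S m - RtoC (exp (- (s * t ^ 2 / 2))) ^ S m)%C)).
    f_equal; rewrite <- RtoC_pow.
    replace (W t * U t ^ S m)%C with (expi (- (INR m * t)) * f t)%C.
      unfold g, expi; simpl fst; rewrite cos_neg, sin_neg; simpl; ring.
    unfold W, U, f; rewrite Cpow_mult_l, expi_pow.
    replace (- (INR m * t)) with (t + INR (S m) * - t) by (rewrite S_INR; ring).
    rewrite expi_plus; ring.
  - apply (is_RInt_minus (V := R_NormedModule)); trivial.
apply Rle_trans with (INR (S m) * K1 / (2 * (c * INR m) ^ 2) + K2 / (2 * (c * INR m))).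
  apply E_le; trivial; apply Rmult_le_pos; [apply pos_INR|trivial].
assert (Sm : INR (S m) = INR m + 1) by apply S_INR.
set (n := INR (S m)) in *.
assert (n2 : n <= 2 * INR m) by lra.
assert (n0 : 0 < n) by lra.
rewrite Rdiv_plus_distr; apply Rplus_le_compat.
  apply Rmult_le_reg_r with (2 * (c * INR m) ^ 2 * n); [apply Rmult_lt_0_compat; nra|].
  replace (n * K1 / (2 * (c * INR m) ^ 2) * (2 * (c * INR m) ^ 2 * n)) with (K1 * (n * n))
    by (field; lra).
  replace (2 * K1 / c ^ 2 / n * (2 * (c * INR m) ^ 2 * n)) with (K1 * (2 * INR m * (2 * INR m)))
    by (field; lra).
  apply Rmult_le_compat_l; trivial; apply Rmult_le_compat; lra.
apply Rmult_le_reg_r with (2 * (c * INR m) * n); [apply Rmult_lt_0_compat; nra|].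
replace (K2 / (2 * (c * INR m)) * (2 * (c * INR m) * n)) with (K2 * n) by (field; lra).
replace (K2 / c / n * (2 * (c * INR m) * n)) with (K2 * (2 * INR m)) by (field; lra).
apply Rmult_le_compat_l; trivial.
Qed.

Lemma gauss_scaling m : sqrt (INR (S m)) * Q m =
  sqrt (2 / s) * gauss (PI * sqrt (INR (S m) * s / 2)).
Proof.
assert (n0 : 0 < INR (S m)) by apply lt_0_INR, Nat.lt_0_succ.
set (n := INR (S m)) in *; set (k := sqrt (n * s / 2)).
assert (k0 : 0 < k) by (apply sqrt_lt_R0; nra).
assert (k2 : k ^ 2 = n * s / 2) by (apply pow2_sqrt; nra).
assert (E : k * Q m = gauss (PI * k)).
  unfold gauss; replace 0 with (k * 0 + 0) by ring.
  replace (PI * k) with (k * PI + 0) by ring.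
  rewrite <- (RInt_comp_lin (V := R_CompleteNormedModule) (fun y => exp (- y ^ 2)) k 0 0 PI).
    unfold Q; rewrite <- (RInt_scal (V := R_CompleteNormedModule)).
      apply RInt_ext; intros t _; unfold scal; simpl; unfold mult; simpl.
      f_equal; change (exp (- (s * (t * (t * 1)) / 2)) * exp (- (s * (t * (t * 1)) / 2)) ^ m)
        with (exp (- (s * t ^ 2 / 2)) ^ S m).
      rewrite <- exp_pow; f_equal; fold n.
      replace (- ((k * t + 0) * ((k * t + 0) * 1))) with (- (k ^ 2 * t ^ 2)) by ring.
      rewrite k2; field.
    apply ex_RInt_of_ex_derive; intros t; apply ex_derive_pow; auto_derive; trivial.
  apply ex_RInt_of_ex_derive; intros t; auto_derive; trivial.
rewrite <- E, <- Rmult_assoc; f_equal; unfold k.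
rewrite <- sqrt_mult_alt by (apply Rlt_le, Rdiv_lt_0_compat; lra).
f_equal; field; lra.
Qed.

Theorem local_limit :
  is_lim_seq (fun m => sqrt (INR (S m)) * conv b (conv_pow a (S m)) m) (/ sqrt (2 * PI * s)).
Proof.
assert (P := PI_RGT_0).
destruct coef_gauss_error as [K hK].
assert (Linf : is_lim_seq (fun m => INR (S m)) p_infty).
  apply (is_lim_seq_incr_1 INR), is_lim_seq_INR.
assert (Lsqrt : forall x, 0 < x -> is_lim_seq (fun m => sqrt (INR (S m) * x)) p_infty).
  intros x x0.
  apply (is_lim_comp_seq sqrt (fun m => INR (S m) * x) p_infty p_infty filterlim_sqrt_p).
    exists 0%nat; intros; discriminate.
  replace p_infty with (Rbar_mult p_infty x); [apply is_lim_seq_scal_r; trivial|].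
  simpl; destruct (Rle_dec 0 x) as [h|]; [|lra].
  destruct (Rle_lt_or_eq_dec 0 x h); [trivial|lra].
assert (LQ : is_lim_seq (fun m => sqrt (INR (S m)) * Q m) (sqrt (2 / s) * (sqrt PI / 2))).
  apply is_lim_seq_ext with
    (fun m => sqrt (2 / s) * gauss (PI * sqrt (INR (S m) * s / 2))).
    intros m; now rewrite gauss_scaling.
  apply is_lim_seq_mult'; [apply is_lim_seq_const|].
  apply (is_lim_comp_seq gauss _ p_infty (sqrt PI / 2) is_lim_gauss).
    exists 0%nat; intros; discriminate.
  apply is_lim_seq_ext with (fun m => sqrt (INR (S m) * (PI ^ 2 * s / 2))).
    intros m; rewrite <- (sqrt_pow2 PI) at 2 by lra.
    rewrite <- sqrt_mult_alt by apply pow2_ge_0; f_equal; field.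
  apply Lsqrt; apply Rmult_lt_0_compat; [apply Rmult_lt_0_compat; nra|lra].
assert (LE : is_lim_seq (fun m => sqrt (INR (S m)) *
    (PI * conv b (conv_pow a (S m)) m - Q m)) 0).
  apply is_lim_seq_abs_0.
  apply (is_lim_seq_le_le_loc (fun _ => 0) _ (fun m => K * / sqrt (INR (S m)))).
  - exists 1%nat; intros m m1; split; [apply Rabs_pos|].
    assert (n0 : 0 < INR (S m)) by apply lt_0_INR, Nat.lt_0_succ.
    assert (r0 := sqrt_lt_R0 _ n0); assert (r2 := sqrt_sqrt (INR (S m)) (Rlt_le _ _ n0)).
    rewrite Rabs_mult, (Rabs_pos_eq (sqrt _)) by lra.
    apply Rle_trans with (sqrt (INR (S m)) * (K / INR (S m))).
      apply Rmult_le_compat_l; [lra|auto].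
    right; rewrite <- r2 at 2; field; lra.
  - apply is_lim_seq_const.
  - replace (Finite 0) with (Finite (K * 0)) by (f_equal; ring).
    apply is_lim_seq_mult'; [apply is_lim_seq_const|].
    replace (Finite 0) with (Rbar_inv p_infty) by reflexivity.
    apply is_lim_seq_inv; [|discriminate].
    apply is_lim_seq_ext with (fun m => sqrt (INR (S m) * 1)).
      intros m; now rewrite Rmult_1_r.
    apply Lsqrt; lra.
apply is_lim_seq_ext with (fun m => / PI * (sqrt (INR (S m)) *
    (PI * conv b (conv_pow a (S m)) m - Q m) + sqrt (INR (S m)) * Q m)).
  intros m; field; lra.
replace (/ sqrt (2 * PI * s)) with (/ PI * (0 + sqrt (2 / s) * (sqrt PI / 2))).
  apply is_lim_seq_mult'; [apply is_lim_seq_const|].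
  apply is_lim_seq_plus'; trivial.
assert (s2 : 0 < sqrt 2) by (apply sqrt_lt_R0; lra).
assert (sp : 0 < sqrt PI) by (apply sqrt_lt_R0; lra).
assert (ss : 0 < sqrt s) by (apply sqrt_lt_R0; lra).
rewrite sqrt_div_alt, !sqrt_mult_alt by nra.
rewrite <- (sqrt_sqrt PI) at 1 by lra.
replace (/ (sqrt 2 * sqrt PI * sqrt s)) with (sqrt 2 / (2 * sqrt PI * sqrt s)).
  field; repeat split; lra.
rewrite <- (sqrt_sqrt 2) at 2 by lra; field; repeat split; lra.
Qed.

End LocalLimit.

(** * Power series with nonnegative coefficients *)

Definition scomp (a b : nat -> R) (n : nat) : R :=
  sum_f_R0 (fun k => a k * conv_pow b k n) n.

Section NonnegSeries.

Variables (a b : nat -> R) (x A B : R).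
Hypothesis a_ge0 : forall k, 0 <= a k.
Hypothesis b_ge0 : forall k, 0 <= b k.
Hypothesis x_ge0 : 0 <= x.
Hypothesis hb : is_series (fun n => b n * x ^ n) B.

Lemma conv_ge0 c d : (forall k, 0 <= c k) -> (forall k, 0 <= d k) -> forall n, 0 <= conv c d n.
Proof. intros hc hd n; apply cond_pos_sum; intros k; apply Rmult_le_pos; trivial. Qed.

Lemma conv_pow_ge0 k n : 0 <= conv_pow b k n.
Proof.
revert n; induction k as [|k IH]; intros n; simpl.
  destruct (Nat.eq_dec n 0); lra.
apply conv_ge0; trivial.
Qed.

Lemma is_series_conv_pow k : is_series (fun n => conv_pow b k n * x ^ n) (B ^ k).
Proof.
induction k as [|k IH].
  apply is_series_ext with (fun n => if Nat.eq_dec n 0 then 1 else 0); [|apply is_series_single].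
  intros n; simpl; destruct (Nat.eq_dec n 0) as [->|_]; simpl; eq_in_R; ring.
assert (pos : forall c : nat -> R, (forall n, 0 <= c n) -> forall n, Rabs (c n * x ^ n) = c n * x ^ n).
  intros c hc n; apply Rabs_pos_eq, Rmult_le_pos; trivial; apply pow_le; trivial.
refine (is_series_ext _ _ _ _ (is_series_mult _ _ _ _ hb IH _ _)).
- intros n; simpl; unfold conv; rewrite (Rmult_comm (sum_f_R0 _ _)), scal_sum.
  apply sum_eq; intros i hi.
  replace (x ^ n) with (x ^ i * x ^ (n - i)) by (rewrite <- pow_add; f_equal; lia); ring.
- exists B; apply is_series_ext with (2 := hb); intros n; now rewrite pos.
- exists (B ^ k); apply is_series_ext with (2 := IH); intros n; rewrite pos; trivial.
  apply conv_pow_ge0.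
Qed.

Hypothesis b0 : b 0%nat = 0.

Lemma conv_pow_small k n : (n < k)%nat -> conv_pow b k n = 0.
Proof.
revert n; induction k as [|k IH]; intros n nk; [lia|]; simpl; unfold conv.
rewrite <- (sum_eq_R0 (fun _ => 0) n) by trivial; apply sum_eq; intros [|i] hi.
  rewrite b0; ring.
rewrite IH by lia; ring.
Qed.

Lemma scomp_widen n N : (n <= N)%nat -> scomp a b n = sum_f_R0 (fun k => a k * conv_pow b k n) N.
Proof.
induction 1 as [|N h IH]; trivial.
rewrite tech5, <- IH, conv_pow_small by lia; ring.
Qed.

Lemma scomp_ge0 n : 0 <= scomp a b n.
Proof. apply cond_pos_sum; intros k; apply Rmult_le_pos; trivial; apply conv_pow_ge0. Qed.

Let partial K M := sum_f_R0 (fun k => a k * sum_f_R0 (fun n => conv_pow b k n * x ^ n) M) K.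

Lemma scomp_partial M : sum_f_R0 (fun n => scomp a b n * x ^ n) M = partial M M.
Proof.
unfold partial.
transitivity (sum_f_R0 (fun n => sum_f_R0 (fun k => a k * (conv_pow b k n * x ^ n)) M) M).
  apply sum_eq; intros n hn; rewrite (scomp_widen n M hn), Rmult_comm, scal_sum.
  apply sum_eq; intros k _; ring.
enough (E : forall K, sum_f_R0 (fun n => sum_f_R0 (fun k => a k * (conv_pow b k n * x ^ n)) K) M =
   sum_f_R0 (fun k => a k * sum_f_R0 (fun n => conv_pow b k n * x ^ n) M) K) by apply E.
induction K as [|K IH]; simpl.
  rewrite scal_sum; apply sum_eq; intros n _; ring.
rewrite sum_plus, IH; f_equal; rewrite scal_sum; apply sum_eq; intros n _; ring.
Qed.

Lemma conv_pow_partial_le k M : sum_f_R0 (fun n => conv_pow b k n * x ^ n) M <= B ^ k.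
Proof.
rewrite <- sum_n_Reals; apply (is_lim_seq_incr_compare (sum_n (fun n => conv_pow b k n * x ^ n))).
  apply (is_series_conv_pow k).
intros n; rewrite sum_Sn; unfold plus; simpl.
assert (h := Rmult_le_pos _ _ (conv_pow_ge0 k (S n)) (pow_le x (S n) x_ge0)); simpl in h; lra.
Qed.

Hypothesis ha : is_series (fun k => a k * B ^ k) A.

(* All terms are nonnegative, so the double series may be summed by columns. *)
Theorem is_series_scomp : is_series (fun n => scomp a b n * x ^ n) A.
Proof.
assert (B0 : 0 <= B).
  apply (is_series_le (fun _ => 0) (fun n => b n * x ^ n)); trivial; [|apply is_series_zero].
  intros n; apply Rmult_le_pos; trivial; apply pow_le; trivial.
set (T := sum_n (fun n => scomp a b n * x ^ n)).
assert (Tinc : forall n, T n <= T (S n)).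
  intros n; unfold T; rewrite sum_Sn; unfold plus; simpl.
  assert (h := Rmult_le_pos _ _ (scomp_ge0 (S n)) (pow_le x (S n) x_ge0)); simpl in h; lra.
assert (TA : forall n, T n <= A).
  intros n; unfold T; rewrite sum_n_Reals, scomp_partial.
  apply Rle_trans with (sum_n (fun k => a k * B ^ k) n).
    rewrite sum_n_Reals; apply sum_Rle; intros k _.
    apply Rmult_le_compat_l; trivial; apply conv_pow_partial_le.
  apply (is_lim_seq_incr_compare (sum_n (fun k => a k * B ^ k))); [exact ha|].
  intros k; rewrite sum_Sn; unfold plus; simpl.
  assert (h := Rmult_le_pos _ _ (a_ge0 (S k)) (pow_le B (S k) B0)); simpl in h; lra.
destruct (ex_finite_lim_seq_incr T A Tinc TA) as [l hl].
enough (E : l = A) by (rewrite <- E; exact hl).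
apply Rle_antisym.
  apply (is_lim_seq_le T (fun _ => A) l A); trivial; apply is_lim_seq_const.
apply (is_lim_seq_le (sum_n (fun k => a k * B ^ k)) (fun _ => l) A l); trivial.
  2: apply is_lim_seq_const.
intros K; rewrite sum_n_Reals.
assert (L : is_lim_seq (partial K) (sum_f_R0 (fun k => a k * B ^ k) K)).
  unfold partial; induction K as [|K IH]; simpl sum_f_R0.
    apply is_lim_seq_mult'; [apply is_lim_seq_const|].
    apply is_lim_seq_ext with (2 := is_series_conv_pow 0); intros; apply sum_n_Reals.
  apply is_lim_seq_plus'; trivial.
  apply is_lim_seq_mult'; [apply is_lim_seq_const|].
  apply is_lim_seq_ext with (2 := is_series_conv_pow (S K)); intros; apply sum_n_Reals.
apply (is_lim_seq_le_loc (partial K) (fun _ => l) (sum_f_R0 (fun k => a k * B ^ k) K) l); trivial.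
  2: apply is_lim_seq_const.
exists K; intros M KM; apply Rle_trans with (T M).
  unfold T; rewrite sum_n_Reals, scomp_partial.
  enough (mono : forall N, (K <= N)%nat -> partial K M <= partial N M) by auto.
  induction 1 as [|N _ IH]; [lra|]; apply Rle_trans with (1 := IH).
  unfold partial; rewrite tech5.
  assert (h : 0 <= a (S N) * sum_f_R0 (fun n => conv_pow b (S N) n * x ^ n) M); [|lra].
  apply Rmult_le_pos; trivial; apply cond_pos_sum; intros n.
  apply Rmult_le_pos; [apply conv_pow_ge0|apply pow_le; trivial].
apply (is_lim_seq_incr_compare T); trivial.
Qed.

End NonnegSeries.

(** * Coefficient asymptotics at the critical point *)

Lemma exp_ge1 w : 0 <= w -> 1 <= exp w.
Proof.
intros w0; rewrite <- exp_0.
destruct w0 as [w0| <-]; [left; apply exp_increasing|right]; trivial.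
Qed.

Lemma PSeries_nonneg_incr (c : nat -> R) x y : (forall k, 0 <= c k) -> 0 <= x <= y ->
  Rbar_lt (Rabs y) (CV_radius c) -> 0 <= PSeries c x <= PSeries c y.
Proof.
intros hc [x0 xy] hy.
assert (hx : Rbar_lt (Rabs x) (CV_radius c)).
  apply Rbar_le_lt_trans with (2 := hy); simpl; rewrite !Rabs_pos_eq; lra.
assert (Sx : is_series (fun n => c n * x ^ n) (PSeries c x)).
  apply is_pseries_R, PSeries_correct, CV_radius_inside; trivial.
assert (Sy : is_series (fun n => c n * y ^ n) (PSeries c y)).
  apply is_pseries_R, PSeries_correct, CV_radius_inside; trivial.
split.
  apply (is_series_le (fun _ => 0) (fun n => c n * x ^ n)); trivial; [|apply is_series_zero].
  intros n; apply Rmult_le_pos; trivial; apply pow_le; trivial.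
apply (is_series_le (fun n => c n * x ^ n) (fun n => c n * y ^ n)); trivial.
intros n; apply Rmult_le_compat_l; trivial; apply pow_incr; lra.
Qed.

Lemma CV_radius_ge_of_series (c : nat -> R) x : ex_series (fun n => c n * x ^ n) ->
  Rbar_le (Rabs x) (CV_radius c).
Proof.
intros h; apply Rbar_not_lt_le; intros N.
apply (CV_disk_outside c x N), ex_series_lim_0; trivial.
Qed.

(* The coefficients of [x f'(x)], when [c] are those of [f]. *)
Definition theta (c : nat -> R) (k : nat) : R := INR k * c k.

Lemma theta_incr c n : theta c n = PS_incr_1 (PS_derive c) n.
Proof. destruct n as [|n]; [apply Rmult_0_l|reflexivity]. Qed.

Lemma CV_radius_theta c : CV_radius (theta c) = CV_radius c.
Proof.
rewrite (CV_radius_ext _ _ (theta_incr c)), CV_radius_incr_1; apply CV_radius_derive.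
Qed.

Lemma PSeries_theta c x : PSeries (theta c) x = x * PSeries (PS_derive c) x.
Proof. rewrite (PSeries_ext _ _ _ (theta_incr c)); apply PSeries_incr_1. Qed.

Lemma is_series_PSeries c x : Rbar_lt (Rabs x) (CV_radius c) ->
  is_series (fun n => c n * x ^ n) (PSeries c x).
Proof. intros h; apply is_pseries_R, PSeries_correct, CV_radius_inside; trivial. Qed.

Definition exp_coef (n : nat) : R := / INR (fact n).
Definition expm1_coef (n : nat) : R := match n with O => 0 | S _ => exp_coef n end.

Lemma exp_coef_gt0 n : 0 < exp_coef n.
Proof. apply Rinv_0_lt_compat, INR_fact_lt_0. Qed.

Lemma is_series_exp x : is_series (fun n => exp_coef n * x ^ n) (exp x).
Proof. apply is_pseries_R, is_exp_Reals. Qed.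

Lemma is_series_expm1 x : is_series (fun n => expm1_coef n * x ^ n) (exp x - 1).
Proof.
refine (is_series_ext _ _ _ _ (is_series_minus _ _ _ _ (is_series_exp x) (is_series_single 0 1))).
intros [|n]; unfold minus, plus, opp, expm1_coef, exp_coef; simpl; eq_in_R.
  rewrite Rinv_1; ring.
ring.
Qed.

Section Lambda.

Variable p : nat -> R.
Hypothesis p_ge0 : forall k, 0 <= p k.
Hypothesis p0 : p 0%nat = 0.
Hypothesis p1 : p 1%nat = 0.

Definition Lam w := PSeries p (exp w - 1) + exp w - 1 - w.
Definition dLam w := PSeries (PS_derive p) (exp w - 1) * exp w + exp w - 1.
Definition ddLam w := PSeries (PS_derive (PS_derive p)) (exp w - 1) * exp w * exp w +
  PSeries (PS_derive p) (exp w - 1) * exp w + exp w.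
Definition inside w := Rbar_lt (Rabs (exp w - 1)) (CV_radius p).

Lemma locally_inside w : inside w -> locally w inside.
Proof.
unfold inside; destruct (CV_radius p) as [r| |]; simpl; try easy.
  intros h; apply (locally_open (fun y => Rabs (exp y - 1) < r)); trivial.
  apply (open_comp (fun y => Rabs (exp y - 1)) (fun z => z < r)); [|apply open_lt].
  intros y _; apply (continuous_comp (fun y => exp y - 1) Rabs).
    apply continuous_of_ex_derive; auto_derive; trivial.
  apply continuous_Rabs.
intros _; apply filter_forall; trivial.
Qed.

Lemma inside_le w w' : 0 <= w <= w' -> inside w' -> inside w.
Proof.
intros [w0 ww'] h; apply (Rbar_le_lt_trans _ (Rabs (exp w' - 1)) _); [simpl|exact h].
assert (e1 := exp_ge1 w w0).
assert (exp w <= exp w') by (destruct ww' as [l| ->]; [left; apply exp_increasing|right]; trivial).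
rewrite !Rabs_pos_eq; lra.
Qed.

Lemma is_derive_Lam w : inside w -> is_derive Lam w (dLam w).
Proof.
intros h; unfold Lam, dLam.
assert (D := is_derive_PSeries p (exp w - 1) h).
assert (E : is_derive (fun w => exp w - 1) w (exp w)) by (auto_derive; trivial; ring).
assert (D2 := is_derive_comp (PSeries p) (fun w => exp w - 1) w _ _ D E).
assert (D3 : is_derive (fun w => exp w - 1 - w) w (exp w - 1)) by (auto_derive; trivial; ring).
apply (is_derive_ext (fun w => PSeries p (exp w - 1) + (exp w - 1 - w))).
  intros t; eq_in_R; ring.
evar_last; [exact (is_derive_plus _ _ _ _ _ D2 D3)|].
unfold plus, scal; simpl; unfold mult; simpl; eq_in_R; ring.
Qed.

Lemma is_derive_dLam w : inside w -> is_derive dLam w (ddLam w).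
Proof.
intros h; unfold dLam, ddLam.
assert (h' : Rbar_lt (Rabs (exp w - 1)) (CV_radius (PS_derive p))) by (rewrite CV_radius_derive; exact h).
assert (D := is_derive_PSeries _ (exp w - 1) h').
assert (E : is_derive (fun w => exp w - 1) w (exp w)) by (auto_derive; trivial; ring).
assert (D2 := is_derive_comp (PSeries (PS_derive p)) (fun w => exp w - 1) w _ _ D E).
assert (E' : is_derive exp w (exp w)) by (auto_derive; trivial; ring).
assert (D3 := is_derive_mult _ exp w _ _ D2 E' Rmult_comm).
apply (is_derive_ext (fun w => PSeries (PS_derive p) (exp w - 1) * exp w + (exp w - 1))).
  intros t; eq_in_R; ring.
evar_last; [exact (is_derive_plus _ _ _ _ _ D3 E)|].
unfold plus, mult, scal; simpl; unfold mult; simpl; eq_in_R; ring.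
Qed.

Lemma PS_derive_ge0 (c : nat -> R) : (forall k, 0 <= c k) -> forall k, 0 <= PS_derive c k.
Proof. intros h k; apply Rmult_le_pos; trivial; apply pos_INR. Qed.

Lemma dLam_increasing w w' : 0 <= w < w' -> inside w' -> dLam w < dLam w'.
Proof.
intros [w0 ww'] h; unfold dLam.
assert (e1 := exp_ge1 w w0).
assert (exp w < exp w') by (apply exp_increasing; trivial).
destruct (PSeries_nonneg_incr (PS_derive p) (exp w - 1) (exp w' - 1)) as [d1 d2].
- apply PS_derive_ge0; trivial.
- lra.
- rewrite CV_radius_derive; exact h.
- nra.
Qed.

Lemma dLam_0 : dLam 0 = 0.
Proof.
unfold dLam; rewrite exp_0; replace (1 - 1) with 0 by ring.
rewrite PSeries_0; unfold PS_derive; rewrite p1; ring.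
Qed.

Lemma ddLam_gt0 w : 0 <= w -> inside w -> 0 < ddLam w.
Proof.
intros w0 h; unfold ddLam.
assert (e1 := exp_ge1 w w0).
destruct (PSeries_nonneg_incr (PS_derive p) (exp w - 1) (exp w - 1)) as [d1 _].
- apply PS_derive_ge0; trivial.
- lra.
- rewrite CV_radius_derive; exact h.
- destruct (PSeries_nonneg_incr (PS_derive (PS_derive p)) (exp w - 1) (exp w - 1)) as [d2 _].
  + apply PS_derive_ge0, PS_derive_ge0; trivial.
  + lra.
  + rewrite !CV_radius_derive; exact h.
  + assert (0 <= PSeries (PS_derive (PS_derive p)) (exp w - 1) * exp w * exp w).
      apply Rmult_le_pos; [apply Rmult_le_pos|]; lra.
    assert (0 <= PSeries (PS_derive p) (exp w - 1) * exp w) by (apply Rmult_le_pos; lra).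
    lra.
Qed.

Lemma kappa_exists w1 : 0 <= w1 -> inside w1 -> 1 < dLam w1 ->
  exists k, 0 <= k /\ inside k /\ dLam k = 1.
Proof.
intros w0 h1 big.
assert (w1pos : 0 < w1) by (destruct w0 as [|E]; trivial; rewrite <- E, dLam_0 in big; lra).
destruct (IVT_interv (fun w => dLam w - 1) 0 w1) as [k [k01 E]]; trivial.
- intros w hw; apply continuity_pt_filterlim.
  apply (continuous_of_ex_derive (fun w => dLam w - 1)).
  assert (D := is_derive_dLam w (inside_le w w1 hw h1)).
  exists (minus (ddLam w) zero).
  exact (is_derive_minus _ _ _ _ _ D (is_derive_const 1 w)).
- rewrite dLam_0; lra.
- lra.
- exists k; split; [lra|split; [apply inside_le with w1; trivial|lra]].
Qed.

Definition lam_coef (n : nat) : R :=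
  scomp p expm1_coef n + expm1_coef n - (if Nat.eq_dec n 1 then 1 else 0).
(* The coefficients of [Lambda(w) / w] and of [1 / (1 - Lambda(w) / w)]. *)
Definition h_coef (n : nat) : R := lam_coef (S n).
Definition phi_coef : nat -> R := scomp (fun _ => 1) h_coef.

Lemma expm1_coef_ge0 n : 0 <= expm1_coef n.
Proof. destruct n; simpl; [lra|left; apply exp_coef_gt0]. Qed.

Lemma lam_coef_0 : lam_coef 0 = 0.
Proof. unfold lam_coef, scomp; simpl; rewrite p0; ring. Qed.

Lemma h_coef_0 : h_coef 0 = 0.
Proof.
unfold h_coef, lam_coef, scomp; cbn [sum_f_R0 Nat.eq_dec]; rewrite p0, p1.
unfold expm1_coef, exp_coef; simpl; field.
Qed.

Lemma h_coef_gt0 n : 0 < h_coef (S n).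
Proof.
unfold h_coef, lam_coef; destruct (Nat.eq_dec (S (S n)) 1); [lia|].
assert (h := scomp_ge0 p expm1_coef p_ge0 expm1_coef_ge0 (S (S n))).
assert (e := exp_coef_gt0 (S (S n))); unfold expm1_coef at 2; lra.
Qed.

Lemma h_coef_ge0 n : 0 <= h_coef n.
Proof. destruct n; [rewrite h_coef_0; lra|left; apply h_coef_gt0]. Qed.

Lemma is_series_lam w : 0 <= w -> inside w -> is_series (fun n => lam_coef n * w ^ n) (Lam w).
Proof.
intros w0 h.
assert (P := is_series_PSeries p (exp w - 1) h).
assert (C := is_series_scomp p expm1_coef w _ _ p_ge0 expm1_coef_ge0 w0 (is_series_expm1 w)
   eq_refl P).
replace (Lam w) with (PSeries p (exp w - 1) + (exp w - 1) - w) by (unfold Lam; ring).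
refine (is_series_ext _ _ _ _ (is_series_minus _ _ _ _ (is_series_plus _ _ _ _ C
  (is_series_expm1 w)) (is_series_single 1 w))).
intros n; unfold minus, plus, opp, lam_coef; simpl.
destruct (Nat.eq_dec n 1) as [->|_]; eq_in_R; simpl; ring.
Qed.

End Lambda.

Lemma conv_ext a a' b b' : (forall k, a k = a' k) -> (forall k, b k = b' k) ->
  forall n, conv a b n = conv a' b' n.
Proof. intros ha hb n; apply sum_eq; intros k _; now rewrite ha, hb. Qed.

Lemma conv_tilt a b x u v n :
  conv (fun k => a k * x ^ k * u) (fun k => b k * x ^ k * v) n = conv a b n * x ^ n * (u * v).
Proof.
unfold conv; rewrite Rmult_assoc, Rmult_comm, scal_sum; apply sum_eq; intros k kn.
replace (x ^ n) with (x ^ k * x ^ (n - k)) by (rewrite <- pow_add; f_equal; lia); ring.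
Qed.

Lemma conv_pow_tilt a x u k n :
  conv_pow (fun k => a k * x ^ k * u) k n = conv_pow a k n * x ^ n * u ^ k.
Proof.
revert n; induction k as [|k IH]; intros n; simpl.
  destruct (Nat.eq_dec n 0) as [->|_]; simpl; ring.
rewrite <- conv_tilt; apply conv_ext; trivial.
Qed.

Section Kappa.

Variable p : nat -> R.
Hypothesis p_ge0 : forall k, 0 <= p k.
Hypothesis p0 : p 0%nat = 0.
Hypothesis p1 : p 1%nat = 0.

Variable k : R.
Hypothesis k_ge0 : 0 <= k.
Hypothesis k_inside : inside p k.
Hypothesis k_crit : dLam p k = 1.

Let g w := w - Lam p w.
Let r := g k.
Let phi := phi_coef p.

Let k_gt0 : 0 < k.
Proof.
destruct k_ge0 as [|E]; trivial; exfalso; generalize k_crit; rewrite <- E, dLam_0; trivial; lra.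
Qed.

Let Dg w : inside p w -> is_derive g w (1 - dLam p w).
Proof.
intros h; exact (is_derive_minus _ _ _ _ _ (is_derive_id w) (is_derive_Lam p w h)).
Qed.

Lemma Lam_0 : Lam p 0 = 0.
Proof. unfold Lam; rewrite exp_0; replace (1 - 1) with 0 by ring; rewrite PSeries_0, p0; ring. Qed.

Lemma rho_gt0 : 0 < r.
Proof.
assert (ins : forall w, 0 <= w <= k -> inside p w) by (intros w hw; apply inside_le with k; trivial).
destruct (MVT_cor2 g (fun w => 1 - dLam p w) 0 k k_gt0) as [c [E hc]].
  intros w hw; apply is_derive_Reals, Dg, ins; trivial.
unfold r; replace (g k) with (g k - g 0) by (unfold g; rewrite Lam_0; ring); rewrite E.
assert (h := dLam_increasing p p_ge0 c k); rewrite k_crit in h.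
apply Rmult_lt_0_compat; [|lra].
assert (dLam p c < 1) by (apply h; [lra|trivial]); lra.
Qed.

Let good w := 0 < w /\ inside p w /\ 0 < g w.

Let locally_good : locally k good.
Proof.
apply filter_and; [|apply filter_and].
- apply (locally_open (fun y => 0 < y)); trivial; apply open_gt.
- apply locally_inside, k_inside.
- assert (C : continuous g k) by (apply (continuous_of_ex_derive g); eexists; apply Dg, k_inside).
  apply C, (locally_open (fun y => 0 < y)); trivial; [apply open_gt|apply rho_gt0].
Qed.

Lemma is_series_phi w : good w -> is_series (fun n => phi n * w ^ n) (w / g w).
Proof.
intros [w0 [hw gw]].
assert (H : is_series (fun n => h_coef p n * w ^ n) (Lam p w / w)).
  assert (L := is_series_lam p p_ge0 w (Rlt_le _ _ w0) hw).
  assert (L1 : is_series (fun n => lam_coef p (S n) * w ^ S n) (Lam p w)).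
    apply (is_series_incr_1 (fun n => lam_coef p n * w ^ n)).
    rewrite lam_coef_0 by trivial; unfold plus; simpl; rewrite Rmult_0_l, Rplus_0_r; exact L.
  refine (is_series_ext _ _ _ _ (is_series_scal_r (/ w) _ _ L1)).
  intros n; unfold h_coef; simpl; field; lra.
assert (q : 0 <= Lam p w / w < 1).
  split.
    apply (is_series_le (fun _ => 0) (fun n => h_coef p n * w ^ n)); trivial; [|apply is_series_zero].
    intros n; apply Rmult_le_pos; [apply h_coef_ge0; trivial|apply pow_le; lra].
  unfold g in gw; apply Rmult_lt_reg_r with w; trivial.
  replace (Lam p w / w * w) with (Lam p w) by (field; lra); lra.
replace (w / g w) with (/ (1 - Lam p w / w)) by (unfold g in *; field; lra).
apply (is_series_scomp (fun _ => 1) (h_coef p) w (/ (1 - Lam p w / w)) (Lam p w / w)); trivial.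
- intros; lra.
- apply h_coef_ge0; trivial.
- lra.
- apply h_coef_0; trivial.
- refine (is_series_ext _ _ _ _ (is_series_geom (Lam p w / w) _)).
    intros n; eq_in_R; ring.
  rewrite Rabs_pos_eq; lra.
Qed.

Lemma phi_radius_locally : exists w2, k < w2 /\ Rbar_le w2 (CV_radius phi).
Proof.
destruct locally_good as [e he].
assert (e0 := cond_pos e).
assert (G : good (k + e / 2)).
  apply he; unfold ball; simpl; unfold AbsRing_ball, abs, minus, plus, opp; simpl.
  replace (k + e / 2 + - k) with (e / 2) by ring; rewrite Rabs_pos_eq; lra.
exists (k + e / 2); split; [lra|].
rewrite <- (Rabs_pos_eq (k + e / 2)) by lra.
apply CV_radius_ge_of_series; exists ((k + e / 2) / g (k + e / 2)); apply is_series_phi, G.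
Qed.

Let locally_radius : locally k (fun w => Rbar_lt (Rabs w) (CV_radius phi)).
Proof.
destruct phi_radius_locally as [w2 [hw2 rad]].
apply (filter_imp (fun w => - w2 < w /\ w < w2)).
  intros w [h1 h2]; apply (Rbar_lt_le_trans _ w2 _); trivial; simpl; apply Rabs_def1; lra.
apply filter_and.
  apply (locally_open (fun w => - w2 < w)); trivial; [apply open_gt|lra].
apply (locally_open (fun w => w < w2)); trivial; apply open_lt.
Qed.

Let k_in : Rbar_lt (Rabs k) (CV_radius phi).
Proof. exact (locally_singleton _ _ locally_radius). Qed.

Let phi_locally : locally k (fun w => PSeries phi w = w / g w).
Proof.
apply (filter_imp good); [|apply locally_good].
intros w hw; unfold PSeries; apply is_series_unique, is_series_phi, hw.
Qed.

Let quot w := (g w - w * (1 - dLam p w)) / g w ^ 2.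

Let theta_locally : locally k (fun w => PSeries (theta phi) w = w * quot w).
Proof.
assert (L := filter_and _ _ locally_good
  (filter_and _ _ (locally_locally k _ phi_locally) locally_radius)).
revert L; apply filter_imp; intros w [[w0 [hw gw]] [L rad]]; rewrite PSeries_theta; f_equal.
rewrite <- (is_derive_unique _ _ _ (is_derive_PSeries phi w rad)).
apply is_derive_unique, (is_derive_ext_loc (fun w => w / g w)).
  revert L; apply filter_imp; intros; now symmetry.
evar_last; [exact (is_derive_div _ _ _ _ _ (is_derive_id w) (Dg w hw) (Rgt_not_eq _ _ gw))|].
unfold quot, one; simpl; field; lra.
Qed.

Lemma phi_sum : is_series (fun n => phi n * k ^ n) (k / r).
Proof. apply is_series_phi, (locally_singleton _ _ locally_good). Qed.

Lemma phi_first : is_series (fun n => theta phi n * k ^ n) (k / r).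
Proof.
assert (r0 := rho_gt0).
replace (k / r) with (PSeries (theta phi) k).
  apply is_series_PSeries; rewrite CV_radius_theta; apply k_in.
rewrite (locally_singleton _ _ theta_locally); unfold quot; fold r; rewrite k_crit.
field; lra.
Qed.

Lemma phi_second : is_series (fun n => theta (theta phi) n * k ^ n)
  (k / r + k ^ 3 * ddLam p k / r ^ 2).
Proof.
assert (r0 := rho_gt0).
assert (rad : Rbar_lt (Rabs k) (CV_radius (theta phi))) by (rewrite CV_radius_theta; apply k_in).
replace (k / r + k ^ 3 * ddLam p k / r ^ 2) with (PSeries (theta (theta phi)) k).
  apply is_series_PSeries; rewrite CV_radius_theta; exact rad.
rewrite PSeries_theta, <- (is_derive_unique _ _ _ (is_derive_PSeries (theta phi) k rad)).
rewrite (is_derive_unique _ k (1 / r + k ^ 2 * ddLam p k / r ^ 2)); [field; lra|].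
apply (is_derive_ext_loc (fun w => w * quot w)).
  revert theta_locally; apply filter_imp; intros; now symmetry.
assert (d2 : is_derive (fun w => 1 - dLam p w) k (- ddLam p k)).
  evar_last; [exact (is_derive_minus _ _ _ _ _ (is_derive_const 1 k) (is_derive_dLam p k k_inside))|].
  unfold minus, plus, opp, zero; simpl; ring.
assert (d1 := Dg k k_inside).
assert (d3 := is_derive_mult _ _ k _ _ (is_derive_id k) d2 Rmult_comm).
assert (d4 := is_derive_minus _ _ k _ _ d1 d3).
assert (d5 := is_derive_pow g 2 k _ d1).
assert (g2 : g k ^ 2 <> 0) by (apply pow_nonzero; fold r; lra).
assert (d6 := is_derive_div _ _ k _ _ d4 d5 g2).
evar_last; [exact (is_derive_mult _ _ k _ _ (is_derive_id k) d6 Rmult_comm)|].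
unfold minus, plus, opp, mult, one; simpl; unfold plus, mult, one; simpl.
fold r; rewrite k_crit; eq_in_R; field; lra.
Qed.

Let s := k ^ 2 * ddLam p k / r.

Theorem coefficient_asymptotics :
  is_lim_seq (fun m => sqrt (INR (S m)) *
     (conv exp_coef (conv_pow phi (S m)) m * r ^ S m)) (k * exp k / sqrt (2 * PI * s)).
Proof.
assert (r0 := rho_gt0).
set (u := r / k); assert (u0 : 0 < u) by (apply Rdiv_lt_0_compat; trivial).
set (a n := phi n * k ^ n * u); set (b n := exp_coef n * k ^ n * exp (- k)).
assert (phi0 : forall n, 0 <= phi n).
  intros n; apply scomp_ge0; [intros; lra|apply h_coef_ge0; trivial].
assert (S0 : is_series a 1).
  replace 1 with (u * (k / r)) by (unfold u; field; lra).
  refine (is_series_ext _ _ _ _ (is_series_scal u _ _ phi_sum)).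
  intros n; unfold a, scal; simpl; unfold mult; simpl; eq_in_R; ring.
assert (S1 : is_series (fun n => INR n * a n) 1).
  replace 1 with (u * (k / r)) by (unfold u; field; lra).
  refine (is_series_ext _ _ _ _ (is_series_scal u _ _ phi_first)).
  intros n; unfold a, theta, scal; simpl; unfold mult; simpl; eq_in_R; ring.
assert (S2 : is_series (fun n => INR n * (INR n * a n)) (1 + s)).
  replace (1 + s) with (u * (k / r + k ^ 3 * ddLam p k / r ^ 2)) by (unfold u, s; field; lra).
  refine (is_series_ext _ _ _ _ (is_series_scal u _ _ phi_second)).
  intros n; unfold a, theta, scal; simpl; unfold mult; simpl; eq_in_R; ring.
assert (lim := local_limit a b s).
assert (E : forall m, conv b (conv_pow a (S m)) m =
    / (k * exp k) * (conv exp_coef (conv_pow phi (S m)) m * r ^ S m)).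
  intros m; unfold b.
  rewrite (conv_ext _ (fun n => exp_coef n * k ^ n * exp (- k)) _
    (fun n => conv_pow phi (S m) n * k ^ n * u ^ S m)); trivial.
    2: intros n; unfold a; apply conv_pow_tilt.
  rewrite conv_tilt, exp_Ropp; unfold u, Rdiv; rewrite Rpow_mult_distr, pow_inv.
  simpl pow; assert (e := exp_pos k); field; repeat split; try apply pow_nonzero; lra.
apply is_lim_seq_ext with (fun m => k * exp k * (sqrt (INR (S m)) * conv b (conv_pow a (S m)) m)).
  intros m; rewrite E; assert (e := exp_pos k); field; lra.
clearbody u.
apply is_lim_seq_mult'; [apply is_lim_seq_const|].
assert (dd := ddLam_gt0 p p_ge0 k k_ge0 k_inside).
assert (kn : forall n, 0 <= k ^ n) by (intros; apply pow_le; trivial).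
apply lim; trivial.
- intros n; unfold a; repeat apply Rmult_le_pos; trivial; lra.
- intros n; unfold b; repeat apply Rmult_le_pos; trivial;
    [left; apply exp_coef_gt0|left; apply exp_pos].
- replace 1 with (exp (- k) * exp k) by (rewrite <- exp_plus, <- exp_0; f_equal; ring).
  refine (is_series_ext _ _ _ _ (is_series_scal (exp (- k)) _ _ (is_series_exp k))).
  intros n; unfold b, scal; simpl; unfold mult; simpl; eq_in_R; ring.
- replace s with (1 + s - 1 - 1 + 1) by ring.
  refine (is_series_ext _ _ _ _ (is_series_plus _ _ _ _ (is_series_minus _ _ _ _
    (is_series_minus _ _ _ _ S2 S1) S1) S0)).
  intros n; unfold minus, plus, opp; simpl; eq_in_R; ring.
- apply ex_series_ext with (fun n => scal u (theta (theta (theta phi)) n * k ^ n)).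
    intros n; unfold a, theta, scal; simpl; unfold mult; simpl; eq_in_R; ring.
  apply (ex_series_scal (V := R_NormedModule)); eexists; apply is_series_PSeries.
  rewrite !CV_radius_theta; apply k_in.
- apply ex_series_ext with (fun n => scal (exp (- k)) (theta exp_coef n * k ^ n)).
    intros n; unfold b, theta, scal; simpl; unfold mult; simpl; eq_in_R; ring.
  apply (ex_series_scal (V := R_NormedModule)); eexists; apply is_series_PSeries.
  rewrite CV_radius_theta; apply (Rbar_lt_le_trans _ (Rabs (k + 1)) _).
    simpl; rewrite !Rabs_pos_eq; lra.
  apply CV_radius_ge_of_series; exists (exp (k + 1)); apply is_series_exp.
- unfold s; apply Rdiv_lt_0_compat; trivial; apply Rmult_lt_0_compat; trivial; apply pow_lt; trivial.
- unfold a, phi, phi_coef, scomp; simpl; nra.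
- unfold a, phi, phi_coef, scomp, conv_pow, conv; simpl.
  assert (h := h_coef_gt0 p p_ge0 0).
  rewrite h_coef_0 by trivial.
  replace ((1 * 0 + 1 * (0 * 0 + h_coef p 1 * 1)) * (k * 1) * u) with (h_coef p 1 * k * u) by ring.
  repeat apply Rmult_lt_0_compat; trivial.
Qed.

End Kappa.

Close Scope R_scope.

From HB Require Import structures.
From mathcomp Require Import all_boot all_order all_algebra fingroup perm.
From mathcomp Require Import boolp Rstruct.
From mathcomp Require ring.
Require Import Defs.

Set Implicit Arguments.
Unset Strict Implicit.
Unset Printing Implicit Defensive.

(** * Formal power series and Lagrange inversion *)

Module Fps.

Import Order.TTheory GRing.Theory Num.Theory mathcomp.algebra_tactics.ring.
Local Open Scope ring_scope.

Definition fps (F : Type) := nat -> F.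

Section FpsRing.

Variable F : comNzRingType.
Implicit Types a b c : fps F.

HB.instance Definition _ := gen_eqMixin (fps F).
HB.instance Definition _ := gen_choiceMixin (fps F).

Definition fps_add a b : fps F := fun n => a n + b n.
Definition fps_opp a : fps F := fun n => - a n.
Definition fps_mul a b : fps F := fun n => \sum_(i < n.+1) a i * b (n - i)%N.
Definition fps_cst (x : F) : fps F := fun n => if n is 0%N then x else 0.

Fact fps_addA : associative fps_add.
Proof. by move=> a b c; apply/funext=> n; apply: addrA. Qed.
Fact fps_addC : commutative fps_add.
Proof. by move=> a b; apply/funext=> n; apply: addrC. Qed.
Fact fps_add0 : left_id (fun=> 0) fps_add.
Proof. by move=> a; apply/funext=> n; apply: add0r. Qed.
Fact fps_addN : left_inverse (fun=> 0) fps_opp fps_add.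
Proof. by move=> a; apply/funext=> n; apply: addNr. Qed.

HB.instance Definition _ := GRing.isZmodule.Build (fps F)
  fps_addA fps_addC fps_add0 fps_addN.

Definition trunc n a : {poly F} := \poly_(i < n.+1) a i.

Lemma coef_trunc n a i : (i <= n)%N -> (trunc n a)`_i = a i.
Proof. by move=> i_n; rewrite coef_poly ltnS i_n. Qed.

(* Ring identities between power series are read off truncated polynomials. *)
Lemma fps_mul_trunc N n a b : (n <= N)%N ->
  fps_mul a b n = (trunc N a * trunc N b)`_n.
Proof.
move=> nN; rewrite coefM; apply: eq_bigr => i _.
have iN : (i <= N)%N by apply: leq_trans nN; rewrite -ltnS.
by rewrite !coef_trunc // (leq_trans (leq_subr _ _)).
Qed.

Fact fps_mulA : associative fps_mul.
Proof.
move=> a b c; apply/funext=> n.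
transitivity ((trunc n a * (trunc n b * trunc n c))`_n).
  rewrite coefM; apply: eq_bigr => i _.
  by rewrite coef_trunc -1?ltnS // -fps_mul_trunc ?leq_subr.
rewrite mulrA coefM; apply: eq_bigr => i _.
by rewrite -fps_mul_trunc -1?ltnS // coef_trunc ?leq_subr.
Qed.

Fact fps_mulC : commutative fps_mul.
Proof.
by move=> a b; apply/funext=> n; rewrite !(@fps_mul_trunc n) // mulrC.
Qed.

Fact fps_mul1 : left_id (fps_cst 1) fps_mul.
Proof.
move=> a; apply/funext=> n; rewrite /fps_mul big_ord_recl /= mul1r subn0.
by rewrite big1 ?addr0 // => i _; rewrite mul0r.
Qed.

Fact fps_mulDl : left_distributive fps_mul fps_add.
Proof.
move=> a b c; apply/funext=> n; rewrite /fps_add /fps_mul -big_split /=.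
by apply: eq_bigr => i _; rewrite mulrDl.
Qed.

Fact fps_one_neq0 : fps_cst 1 != 0 :> fps F.
Proof.
by apply/eqP=> /(congr1 (fun a : fps F => a 0%N)) /eqP; rewrite (negbTE (oner_neq0 F)).
Qed.

HB.instance Definition _ := GRing.Zmodule_isComNzRing.Build (fps F)
  fps_mulA fps_mulC fps_mul1 fps_mulDl fps_one_neq0.

Lemma fps_addE a b n : (a + b) n = a n + b n. Proof. by []. Qed.
Lemma fps_oppE a n : (- a) n = - a n. Proof. by []. Qed.
Lemma fps_mulE a b n : (a * b) n = \sum_(i < n.+1) a i * b (n - i)%N.
Proof. by []. Qed.
Lemma fps_1E n : (1 : fps F) n = (n == 0%N)%:R. Proof. by case: n. Qed.

Lemma fps_natE k n : (k%:R : fps F) n = if n is 0%N then k%:R else 0.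
Proof. by elim: k n => [|k IH] [|n] //; rewrite !mulrS fps_addE IH //= addr0. Qed.

Lemma fps_cstM x a n : (fps_cst x * a) n = x * a n.
Proof.
rewrite fps_mulE big_ord_recl /= subn0 big1 ?addr0 // => i _.
by rewrite mul0r.
Qed.

Lemma fps_mul0 a b : (a * b) 0%N = a 0%N * b 0%N.
Proof. by rewrite fps_mulE big_ord_recl big_ord0 addr0. Qed.

Definition fps_X : fps F := fun n => (n == 1%N)%:R.

Lemma fps_XM a n : (fps_X * a) n = if n is m.+1 then a m else 0.
Proof.
rewrite fps_mulE; case: n => [|n].
  by rewrite big_ord_recl big_ord0 mul0r addr0.
rewrite big_ord_recl mul0r add0r big_ord_recl /= mul1r subSS subn0 big1 ?addr0 //.
by move=> i _; rewrite mul0r.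
Qed.

Lemma fps_XnM a k n : (fps_X ^+ k * a) n = if (k <= n)%N then a (n - k)%N else 0.
Proof.
elim: k n => [|k IH] n; first by rewrite mul1r subn0.
by rewrite exprS -mulrA fps_XM; case: n.
Qed.

Lemma fps_XnE k n : (fps_X ^+ k) n = (n == k)%:R.
Proof.
rewrite -[_ ^+ k]mulr1 fps_XnM fps_1E subn_eq0; case: ltngtP => //.
Qed.

Lemma fps_X_factor a : a 0%N = 0 -> a = fps_X * (fun n => a n.+1 : F).
Proof. by move=> a0; apply/funext=> -[|n]; rewrite fps_XM. Qed.

Lemma fps_exp_small a k n : a 0%N = 0 -> (n < k)%N -> (a ^+ k) n = 0.
Proof.
move=> /fps_X_factor -> nk.
by rewrite exprMn fps_XnM leqNgt nk.
Qed.

Definition fps_deriv a : fps F := fun n => a n.+1 *+ n.+1.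

Lemma fps_derivD a b : fps_deriv (a + b) = fps_deriv a + fps_deriv b.
Proof. by apply/funext=> n; rewrite /fps_deriv !fps_addE mulrnDl. Qed.

Lemma fps_deriv_cstM x a : fps_deriv (fps_cst x * a) = fps_cst x * fps_deriv a.
Proof. by apply/funext=> n; rewrite /fps_deriv !fps_cstM mulrnAr. Qed.

Lemma fps_derivM a b : fps_deriv (a * b) = fps_deriv a * b + a * fps_deriv b.
Proof.
apply/funext=> n; rewrite {1}/fps_deriv -[(a * b) _]/(fps_mul a b n.+1).
rewrite (@fps_mul_trunc n.+1) // -coef_deriv derivM coefD.
rewrite !coefM; congr (_ + _); apply: eq_bigr => i _; rewrite ?coef_deriv !coef_trunc //.
- by rewrite (leq_trans (leq_subr _ _)).
- by rewrite ltnS leq_subr.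
- by rewrite ltnW.
Qed.

Lemma fps_deriv_exp a k : fps_deriv (a ^+ k) = k%:R * a ^+ k.-1 * fps_deriv a.
Proof.
elim: k => [|k IH]; first by rewrite expr0 !mul0r; apply/funext=> n; rewrite /fps_deriv fps_1E mul0rn.
rewrite exprS fps_derivM IH /=; case: k {IH} => [|k] /=; first by ring.
by rewrite exprS; ring.
Qed.

Lemma fps_deriv_X : fps_deriv fps_X = 1.
Proof. by apply/funext=> -[|n]; rewrite fps_1E /fps_deriv /fps_X //= mul0rn. Qed.

Definition fps_comp a b : fps F := fun n => \sum_(k < n.+1) a k * (b ^+ k) n.

Lemma fps_comp_widen N n a b : b 0%N = 0 -> (n <= N)%N ->
  fps_comp a b n = \sum_(k < N.+1) a k * (b ^+ k) n.
Proof.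
move=> b0 nN; rewrite /fps_comp.
rewrite (big_ord_widen_cond _ predT (fun k => a k * (b ^+ k) n) (_ : n.+1 <= N.+1)%N) //.
rewrite [RHS](bigID (fun k : 'I_N.+1 => k < n.+1)%N) /= [X in _ = _ + X]big1 ?addr0 //.
by move=> k; rewrite -leqNgt => nk; rewrite fps_exp_small ?mulr0.
Qed.

Lemma fps_compD a a' b : fps_comp (a + a') b = fps_comp a b + fps_comp a' b.
Proof.
apply/funext=> n; rewrite fps_addE /fps_comp -big_split /=.
by apply: eq_bigr => k _; rewrite fps_addE mulrDl.
Qed.

Lemma fps_comp_cstM x a b : fps_comp (fps_cst x * a) b = fps_cst x * fps_comp a b.
Proof.
apply/funext=> n; rewrite fps_cstM /fps_comp mulr_sumr.
by apply: eq_bigr => k _; rewrite fps_cstM mulrA.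
Qed.

Lemma fps_compN a b : fps_comp (- a) b = - fps_comp a b.
Proof.
apply/funext=> n; rewrite fps_oppE /fps_comp -sumrN.
by apply: eq_bigr => k _; rewrite fps_oppE mulNr.
Qed.

Lemma fps_comp_Xn k b : b 0%N = 0 -> fps_comp (fps_X ^+ k) b = b ^+ k.
Proof.
move=> b0; apply/funext=> n; case: (ltnP n k) => nk.
  rewrite fps_exp_small // /fps_comp big1 // => i _.
  by rewrite fps_XnE ltn_eqF ?mul0r // (leq_ltn_trans _ nk) // -ltnS.
rewrite /fps_comp (bigD1 (Ordinal (nk : k < n.+1)%N)) //= fps_XnE eqxx mul1r.
rewrite big1 ?addr0 // => i; rewrite -val_eqE /= => ik.
by rewrite fps_XnE (negbTE ik) mul0r.
Qed.

Lemma fps_comp1 b : b 0%N = 0 -> fps_comp 1 b = 1.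
Proof. by move=> b0; have := fps_comp_Xn 0 b0; rewrite !expr0. Qed.

Lemma fps_compX b : b 0%N = 0 -> fps_comp fps_X b = b.
Proof. by move=> b0; have := fps_comp_Xn 1 b0; rewrite !expr1. Qed.

Lemma fps_compM a a' b : b 0%N = 0 -> fps_comp (a * a') b = fps_comp a b * fps_comp a' b.
Proof.
move=> b0; apply/funext=> n.
have -> : fps_comp (a * a') b n =
    \sum_(i < n.+1) \sum_(j < n.+1) a i * a' j * (b ^+ (i + j)) n.
  rewrite /fps_comp.
  under eq_bigr => k _ do rewrite fps_mulE mulr_suml.
  rewrite (eq_bigr (fun k : 'I_n.+1 => \sum_(i < n.+1 | (i < k.+1)%N)
     a i * a' (k - i)%N * (b ^+ k) n)); last first.
    move=> k _; rewrite (big_ord_widen n.+1 (fun i => a i * a' (k - i)%N * (b ^+ k) n)) //.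
  rewrite (exchange_big_dep predT) //=; apply: eq_bigr => i _.
  rewrite [RHS](bigID (fun j : 'I_n.+1 => (i + j < n.+1)%N)) /= [X in _ = _ + X]big1 ?addr0.
    rewrite -(big_mkord (fun k => (i < k.+1)%N) (fun k => a i * a' (k - i)%N * (b ^+ k) n)).
    rewrite -(big_mkord (fun j => (i + j < n.+1)%N) (fun j => a i * a' j * (b ^+ (i + j)) n)).
    have hi : (i <= n.+1)%N by apply: ltnW.
    rewrite (big_cat_nat (n := i)) //= big_nat_cond big1 ?add0r; last first.
      by move=> k /andP[/andP[_ ki]]; rewrite ltnS leqNgt ki.
    rewrite -{1}[i : nat]add0n big_addn.
    rewrite [RHS](big_cat_nat (n := (n.+1 - i)%N)) ?leq_subr //=.
    rewrite [X in _ = _ + X]big_nat_cond [X in _ = _ + X]big1 ?addr0; last first.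
      by move=> k /andP[/andP[h _]]; rewrite ltnNge -leq_subLR h.
    rewrite big_nat_cond [RHS]big_nat_cond; apply: eq_big => [k|k _].
      case: (ltnP k (n.+1 - i)) => [h|]; last by rewrite andbF.
      by rewrite ltnS leq_addl -ltn_subRL h.
    by rewrite addnK [(i + k)%N]addnC.
  by move=> j; rewrite -leqNgt => h; rewrite fps_exp_small ?mulr0.
rewrite fps_mulE.
have wid (x : fps F) m : (m <= n)%N -> fps_comp x b m = \sum_(k < n.+1) x k * (b ^+ k) m.
  exact: fps_comp_widen.
under [RHS]eq_bigr => p _.
  rewrite (wid a) -1?ltnS // (wid a') ?leq_subr // mulr_suml.
  under eq_bigr => i _ do rewrite mulr_sumr.
  over.
rewrite [RHS]exchange_big /=; apply: eq_bigr => i _.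
rewrite [RHS]exchange_big /=; apply: eq_bigr => j _.
rewrite exprD fps_mulE mulr_sumr; apply: eq_bigr => p _.
by rewrite mulrACA.
Qed.

Lemma fps_comp_exp a b k : b 0%N = 0 -> fps_comp (a ^+ k) b = fps_comp a b ^+ k.
Proof.
move=> b0; elim: k => [|k IH]; first by rewrite !expr0 fps_comp1.
by rewrite !exprS fps_compM // IH.
Qed.

Lemma fps_comp0 a b : fps_comp a b 0%N = a 0%N.
Proof. by rewrite /fps_comp big_ord_recl big_ord0 expr0 fps_1E mulr1 addr0. Qed.

Lemma fps_compA a b c : b 0%N = 0 -> c 0%N = 0 ->
  fps_comp (fps_comp a b) c = fps_comp a (fps_comp b c).
Proof.
move=> b0 c0; apply/funext=> n; rewrite {1}/fps_comp.
have wid m : (m < n.+1)%N -> fps_comp a b m = \sum_(k < n.+1) a k * (b ^+ k) m.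
  by move=> h; apply: fps_comp_widen.
under eq_bigr => m _ do rewrite wid // mulr_suml.
rewrite exchange_big /=; apply: eq_bigr => k _.
rewrite -fps_comp_exp // /fps_comp mulr_sumr.
by apply: eq_bigr => m _; rewrite mulrA.
Qed.

End FpsRing.

Section Lagrange.

Variable F : numFieldType.
Implicit Types a b : fps F.

Lemma fps_eq_deriv a b : a 0%N = b 0%N -> fps_deriv a = fps_deriv b -> a = b.
Proof.
move=> ab0 ab; apply/funext=> -[//|n].
have /(congr1 (fun f : fps F => f n)) := ab.
rewrite /fps_deriv -(mulr_natr (a _)) -(mulr_natr (b _)) => /mulIf; apply.
by rewrite pnatr_eq0.
Qed.

Section Inversion.

Variables (g psi phi N : fps F).
Hypotheses (gE : g = fps_X F * psi) (psi_phi : psi * phi = 1).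
Hypotheses (N0 : N 0%N = 0) (gN : fps_comp g N = fps_X F).

Let g0 : g 0%N = 0. Proof. by rewrite gE fps_XM. Qed.

Lemma lagrange_power n k :
  (fps_deriv (g ^+ k) * phi ^+ n.+1) n = (k == n.+1)%:R * n.+1%:R.
Proof.
case: k => [|k].
  have -> : fps_deriv (g ^+ 0) = 0.
    by apply/funext=> m; rewrite expr0 /fps_deriv fps_1E mul0rn.
  by rewrite !mul0r.
have gphi : g * phi = fps_X F by rewrite gE -mulrA psi_phi mulr1.
have Dgphi : fps_deriv g * phi = 1 - g * fps_deriv phi.
  by have := congr1 (@fps_deriv F) gphi; rewrite fps_derivM fps_deriv_X => <-; ring.
rewrite fps_deriv_exp /=; case: (ltnP n k) => nk.
  rewrite gtn_eqF ?ltnS // mul0r.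
  have -> : k.+1%:R * g ^+ k * fps_deriv g * phi ^+ n.+1 =
     fps_X F ^+ k * (k.+1%:R * psi ^+ k * fps_deriv g * phi ^+ n.+1).
    by rewrite gE exprMn; ring.
  by rewrite fps_XnM leqNgt nk.
have [m E] : exists m, n = (k + m)%N by exists (n - k)%N; rewrite subnKC.
have -> : k.+1%:R * g ^+ k * fps_deriv g * phi ^+ n.+1 =
   fps_X F ^+ k * (k.+1%:R * (phi ^+ m * (fps_deriv g * phi))).
  rewrite gE exprMn -gE E -addnS exprD exprS.
  transitivity (fps_X F ^+ k * (k.+1%:R * ((psi * phi) ^+ k * (phi ^+ m * (fps_deriv g * phi))))).
    by rewrite exprMn; ring.
  by rewrite psi_phi expr1n mul1r.
rewrite fps_XnM E leq_addr addKn Dgphi.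
have -> : (k.+1%:R : fps F) = fps_cst k.+1%:R.
  by apply/funext=> -[|i]; rewrite fps_natE.
rewrite fps_cstM; have -> : (k.+1 == (k + m).+1) = (m == 0)%N.
  by rewrite eqSS -{1}[k]addn0 eqn_add2l eq_sym.
case: m {E} => [|m].
  by rewrite expr0 mul1r fps_addE fps_1E fps_oppE fps_mul0 g0 /= addn0; ring.
suff -> : (phi ^+ m.+1 * (1 - g * fps_deriv phi)) m.+1 = 0 by rewrite mulr0 mul0r.
have -> : phi ^+ m.+1 * (1 - g * fps_deriv phi) =
    phi ^+ m.+1 - fps_X F * (phi ^+ m * fps_deriv phi).
  by rewrite -gphi exprS; ring.
rewrite fps_addE fps_oppE fps_XM.
have := congr1 (fun f : fps F => f m) (fps_deriv_exp phi m.+1).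
rewrite /= -mulrA.
have -> : (m.+1%:R : fps F) = fps_cst m.+1%:R.
  by apply/funext=> -[|i]; rewrite fps_natE.
rewrite fps_cstM {1}/fps_deriv -(mulr_natl ((phi ^+ _) _)) => /mulfI ->; first by rewrite subrr.
by rewrite pnatr_eq0.
Qed.

(* Both sides are linear in [a] and depend only on its terms of degree at most
   [n.+1]; they agree on the powers of [g], which form a triangular basis. *)
Theorem lagrange_inversion a n :
  n.+1%:R * fps_comp a N n.+1 = (fps_deriv a * phi ^+ n.+1) n.
Proof.
have psi0 : psi 0%N != 0.
  apply/eqP=> p0; have := congr1 (fun f : fps F => f 0%N) psi_phi.
  by rewrite fps_mul0 p0 mul0r fps_1E => /esym/eqP; rewrite oner_eq0.
pose low k a := forall i, (i < k)%N -> a i = 0.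
suff H d k (b : fps F) : (k + d = n.+2)%N -> low k b ->
    n.+1%:R * fps_comp b N n.+1 = (fps_deriv b * phi ^+ n.+1) n.
  by apply: (H n.+2 0%N).
elim: d k b => [|d IH] k b kd bk.
  have {}bk i : (i <= n.+1)%N -> b i = 0.
    by move=> i_n; apply: bk; rewrite -(addn0 k) kd.
  rewrite /fps_comp big1 ?mulr0; last first.
    by move=> i _; rewrite bk ?mul0r // -ltnS.
  rewrite fps_mulE big1 // => i _; rewrite /fps_deriv bk ?mul0rn ?mul0r //.
pose x := b k / psi 0%N ^+ k; pose b' := b - fps_cst x * g ^+ k.
have bE : b = fps_cst x * g ^+ k + b' by rewrite /b'; ring.
have gk i : (g ^+ k) i = if (k <= i)%N then (psi ^+ k) (i - k)%N else 0.
  by rewrite gE exprMn fps_XnM.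
have psik : (psi ^+ k) 0%N = psi 0%N ^+ k.
  by elim: (k) => [|j IHj]; rewrite ?expr0 ?fps_1E // !exprS fps_mul0 IHj.
have low' : low k.+1 b'.
  move=> i; rewrite ltnS leq_eqVlt => /orP[/eqP ->|ik].
    rewrite /b' fps_addE fps_oppE fps_cstM gk leqnn subnn psik /x divfK ?subrr //.
    by rewrite expf_neq0.
  by rewrite /b' fps_addE fps_oppE fps_cstM gk leqNgt ik mulr0 subr0 bk.
rewrite bE fps_compD fps_derivD mulrDl !fps_addE mulrDr; congr (_ + _); last first.
  by apply: (IH k.+1) => //; rewrite addSnnS.
rewrite fps_comp_cstM fps_deriv_cstM -mulrA !fps_cstM mulrCA; congr (_ * _).
rewrite lagrange_power fps_comp_exp // gN fps_XnE eq_sym.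
by rewrite mulrC.
Qed.

End Inversion.

Definition fps_geom : fps F := fun=> 1.

Lemma fps_geom_inv (h : fps F) : h 0%N = 0 -> (1 - h) * fps_comp fps_geom h = 1.
Proof.
move=> h0; have -> : 1 - h = fps_comp (1 - fps_X F) h.
  by rewrite fps_compD fps_compN fps_comp1 // fps_compX.
rewrite -fps_compM // -[RHS](fps_comp1 h0); congr fps_comp.
rewrite mulrBl mul1r; apply/funext=> -[|n]; rewrite fps_addE fps_oppE fps_XM fps_1E /=.
  by rewrite subr0.
by rewrite subrr.
Qed.

Definition fps_exp1 : fps F := fun n => n`!%:R^-1.

Lemma fps_deriv_exp1 : fps_deriv fps_exp1 = fps_exp1.
Proof.
apply/funext=> n; rewrite /fps_deriv /fps_exp1 factS natrM invfM.
by rewrite -(mulr_natl (_ * _)) mulVKf // pnatr_eq0.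
Qed.

End Lagrange.

End Fps.

Import Fps.

(** * Canonical trees *)

Local Open Scope nat_scope.

Notation edgefun n := {ffun 'I_n * 'I_n -> bool}.
Notation block n := ({set 'I_n} * edgefun n)%type.

Section MinLabel.

Variable n : nat.
Implicit Types (A B : {set 'I_n}) (x : 'I_n).

Lemma min_label_le A x : x \in A -> min_label A <= x.
Proof.
move=> xA; rewrite /min_label; have := mem_index_enum x.
elim: (index_enum _) => //= y s IH; rewrite inE big_cons.
case/predU1P=> [<-|/IH xs]; first by rewrite xA geq_minl.
by case: ifP => // _; rewrite geq_min xs orbT.
Qed.

Lemma min_label_mem A : A != set0 -> exists2 a, a \in A & min_label A = a.
Proof.
case/set0Pn => x xA.
have: min_label A = n \/ exists2 a, a \in A & min_label A = a.
  rewrite /min_label; apply: (big_ind (fun v : nat => v = n \/ exists2 a, a \in A & v = a)).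
  - by left.
  - move=> u v Hu Hv; rewrite /minn; case: ifP => _ //.
  - by move=> i iA; right; exists i.
by case=> // E; have := min_label_le xA; rewrite E leqNgt ltn_ord.
Qed.

Lemma min_label_lt A : A != set0 -> min_label A < n.
Proof. by move/min_label_mem=> [a _ ->]. Qed.

Lemma min_label_sub A B : A \subset B -> min_label B <= min_label A.
Proof.
move=> AB; have [->|A0] := eqVneq A set0.
  have [->|/min_label_lt/ltnW h] := eqVneq B set0 => //.
  by rewrite {2}/min_label big_set0.
have [a aA ->] := min_label_mem A0.
by apply: min_label_le; apply: (subsetP AB).
Qed.

End MinLabel.

Section Decorations.

Variable k : nat.
Implicit Types d : decoration k.

Lemma adjC (H : lgraph k) i j : adj H i j = adj H j i.
Proof. by have /andP[_ /forallP/(_ i)/forallP/(_ j)/eqP] := lgraphP H. Qed.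

Lemma adjxx (H : lgraph k) i : adj H i i = false.
Proof. by have /andP[/forallP/(_ i)/negbTE] := lgraphP H. Qed.

Lemma deco_adjC d i j : deco_adj d i j = deco_adj d j i.
Proof. by case: d => [||H] //=; [rewrite eq_sym | rewrite adjC]. Qed.

Lemma deco_adjxx d i : deco_adj d i i = false.
Proof. by case: d => [||H] //=; [rewrite eqxx | rewrite adjxx]. Qed.

Definition lin (b : bool) : decoration k := if b then Join k else Union k.

Lemma lin_adj b i j : deco_adj (lin b) i j = (i != j) && b.
Proof. by case: b; rewrite /= ?andbT ?andbF. Qed.

(* [b = true]: co-connected; [b = false]: connected. *)
Definition bconn n (b : bool) (A : {set 'I_n}) (E : 'I_n -> 'I_n -> bool) :=
  forall S : {set 'I_n}, S \subset A -> S != set0 -> S != A ->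
  exists x y, [/\ x \in S, y \in A :\: S & E x y != b].

Lemma prime_bconn b (H : lgraph k) : prime_graph H -> bconn b setT (adj H).
Proof.
case/andP=> k3 /forallP Hmod S _ S0 ST.
have [/existsP[x /existsP[y /and3P[h1 h2 h3]]]|/existsPn Hn] := boolP
    [exists x, exists y, [&& x \in S, y \in setT :\: S & adj H x y != b]].
  by exists x, y.
have cut x y : x \in S -> y \notin S -> adj H x y = b.
  move=> xS yS; have /existsPn/(_ y) := Hn x.
  by rewrite xS inE yS in_setT /= negbK => /eqP.
have mS : is_module H S.
  apply/forallP=> v; apply/implyP=> vS.
  case: (b) cut => cut; apply/orP; [left|right];
    apply/forallP=> x; apply/implyP=> xS; by rewrite adjC cut.
have mC : is_module H (~: S).
  apply/forallP=> v; apply/implyP; rewrite inE negbK=> vS.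
  case: (b) cut => cut; apply/orP; [left|right];
    apply/forallP=> x; apply/implyP; rewrite inE=> xS; by rewrite cut.
have := Hmod S; rewrite mS /= /trivial_module (negbTE ST) orbF => c1.
have := Hmod (~: S); rewrite mC /= /trivial_module => /orP[c2|/eqP E].
  have := cardsC S; rewrite card_ord => E.
  by have := leq_add c1 c2; rewrite E leqNgt k3.
by case/negP: S0; rewrite -[S]setCK E setCT.
Qed.

End Decorations.

Section Blocks.

Variable n : nat.
Implicit Types (A B S : {set 'I_n}) (E : edgefun n) (t : tree n).

Definition edges_on A E :=
  forall x y, E (x, y) -> [/\ x \in A, y \in A, x != y & E (y, x)].

Definition subst_edges k (d : decoration k) (l : k.-tuple (block n)) : edgefun n :=
  [ffun p => [exists i, (tnth l i).2 p] ||
     [exists i, exists j,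
        [&& deco_adj d i j, p.1 \in (tnth l i).1 & p.2 \in (tnth l j).1]]].

Definition tadj t : edgefun n := [ffun p => tree_adj t p.1 p.2].

Definition block_of t : block n := (leaves t, tadj t).

Lemma tadj_node k (d : decoration k) M :
  tadj (Node d M) = subst_edges d [tuple block_of (M i) | i < k].
Proof.
apply/ffunP=> -[x y]; rewrite !ffunE /=; congr (_ || _).
  by apply: eq_existsb => i; rewrite tnth_mktuple ffunE.
by apply: eq_existsb => i; apply: eq_existsb => j; rewrite !tnth_mktuple.
Qed.

Record wf_blocks k (l : k.-tuple (block n)) : Prop := WfBlocks {
  wf_nonempty : forall i, (tnth l i).1 != set0;
  wf_disjoint : forall i j, i != j -> [disjoint (tnth l i).1 & (tnth l j).1];
  wf_edges : forall i, edges_on (tnth l i).1 (tnth l i).2 }.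

Section Subst.

Variables (k : nat) (d : decoration k) (l : k.-tuple (block n)).
Hypothesis wfl : wf_blocks l.

Lemma wf_inj x i j : x \in (tnth l i).1 -> x \in (tnth l j).1 -> i = j.
Proof.
move=> xi xj; apply/eqP; apply/negPn/negP=> ij.
have /pred0P/(_ x) /= := wf_disjoint wfl ij; rewrite xi xj; done.
Qed.

Lemma subst_edges_across i j x y : i != j ->
  x \in (tnth l i).1 -> y \in (tnth l j).1 ->
  subst_edges d l (x, y) = deco_adj d i j.
Proof.
move=> ij xi yj; rewrite ffunE /=; apply/orP/idP => [[/existsP[m /(wf_edges wfl)]|]|dij].
- by case=> xm ym _ _; case/negP: ij; rewrite (wf_inj xi xm) (wf_inj yj ym).
- case/existsP=> i' /existsP[j' /and3P[dij xi' yj']].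
  by rewrite (wf_inj xi xi') (wf_inj yj yj').
- by right; apply/existsP; exists i; apply/existsP; exists j; rewrite dij xi yj.
Qed.

Lemma subst_edges_inside i x y :
  x \in (tnth l i).1 -> y \in (tnth l i).1 ->
  subst_edges d l (x, y) = (tnth l i).2 (x, y).
Proof.
move=> xi yi; rewrite ffunE /=; apply/orP/idP => [[/existsP[m h]|]|h].
- by case/(wf_edges wfl): (h) => xm _ _ _; rewrite (wf_inj xi xm).
- case/existsP=> i' /existsP[j' /and3P[dij xi' yj']].
  by move: dij; rewrite -(wf_inj xi xi') -(wf_inj yi yj') deco_adjxx.
- by left; apply/existsP; exists i.
Qed.

Lemma subst_edges_on : edges_on (\bigcup_i (tnth l i).1) (subst_edges d l).
Proof.
move=> x y; rewrite !ffunE /= => /orP[/existsP[i h]|].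
  case/(wf_edges wfl): (h) => xi yi xy h'; split=> //.
  - by apply/bigcupP; exists i.
  - by apply/bigcupP; exists i.
  - by apply/orP; left; apply/existsP; exists i.
case/existsP=> i /existsP[j /and3P[dij xi yj]]; split.
- by apply/bigcupP; exists i.
- by apply/bigcupP; exists j.
- apply/eqP=> E; rewrite E in xi; move: dij.
  by rewrite (wf_inj xi yj) deco_adjxx.
- apply/orP; right; apply/existsP; exists j; apply/existsP; exists i.
  by rewrite deco_adjC dij xi yj.
Qed.

Lemma subst_edges_restr i x y :
  (tnth l i).2 (x, y) =
  [&& x \in (tnth l i).1, y \in (tnth l i).1 & subst_edges d l (x, y)].
Proof.
apply/idP/and3P => [h|[xi yi]]; last by rewrite (subst_edges_inside xi yi).
by case/(wf_edges wfl): (h) => xi yi _ _; rewrite (subst_edges_inside xi yi).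
Qed.

Lemma subst_bconn b : 1 < k -> bconn b setT (deco_adj d) ->
  bconn b (\bigcup_i (tnth l i).1) (fun x y => subst_edges d l (x, y)).
Proof.
move=> k1 dconn S SA S0 SnA.
have [|Hn] := pselect (exists x y,
    [/\ x \in S, y \in \bigcup_i (tnth l i).1 :\: S & subst_edges d l (x, y) != b]).
  by [].
have cut x y : x \in S -> y \in \bigcup_i (tnth l i).1 -> y \notin S ->
    subst_edges d l (x, y) = b.
  move=> xS yA yS; apply/eqP/negPn/negP=> h; apply: Hn; exists x, y.
  by rewrite xS inE yS yA.
have memA i x : x \in (tnth l i).1 -> x \in \bigcup_i (tnth l i).1.
  by move=> xi; apply/bigcupP; exists i.
have nosplit i x x' : x \in (tnth l i).1 -> x' \in (tnth l i).1 ->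
    x \in S -> x' \in S.
  move=> xi x'i xS; apply/negPn/negP=> x'S.
  have [||u [j [/set1P -> ji dij]]] := dconn [set i] (subsetT _).
  - by apply/set0Pn; exists i; rewrite set11.
  - apply/eqP=> E; have := cards1 i; rewrite E cardsT card_ord => E1.
    by rewrite E1 in k1.
  move: ji; rewrite !inE andbT => ji.
  have /set0Pn[z zj] := wf_nonempty wfl j.
  have [zS|zS] := boolP (z \in S).
    have := cut _ _ zS (memA _ _ x'i) x'S.
    rewrite (subst_edges_across ji zj x'i) deco_adjC => E.
    by rewrite E eqxx in dij.
  have := cut _ _ xS (memA _ _ zj) zS.
  rewrite eq_sym in ji; rewrite (subst_edges_across ji xi zj) => E.
  by rewrite E eqxx in dij.
pose I := [set i | [exists x, (x \in S) && (x \in (tnth l i).1)]].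
have [||i [j [/[!inE] /existsP[x /andP[xS xi]] ]]] := dconn I (subsetT _).
- case/set0Pn: S0 => x xS; have /bigcupP[i _ xi] := subsetP SA _ xS.
  by apply/set0Pn; exists i; rewrite inE; apply/existsP; exists x; rewrite xS.
- apply: contraNneq SnA => IT; rewrite eqEsubset SA /=.
  apply/subsetP=> y /bigcupP[i _ yi]; have: i \in I by rewrite IT inE.
  by rewrite inE => /existsP[x /andP[xS xi]]; apply: (nosplit i x).
rewrite andbT => jI dij.
have /set0Pn[z zj] := wf_nonempty wfl j.
have zS : z \notin S.
  by apply/negP=> zS; case/negP: jI; apply/existsP; exists z; rewrite zS.
have ij : i != j.
  by apply/eqP=> E; rewrite -E in zj; case/negP: zS; apply: (nosplit i x).
exfalso; have := cut _ _ xS (memA _ _ zj) zS.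
by rewrite (subst_edges_across ij xi zj) => E; rewrite E eqxx in dij.
Qed.

End Subst.

End Blocks.

Section Uniqueness.

Variables (n k k' : nat) (d : decoration k) (d' : decoration k').
Variables (l : k.-tuple (block n)) (l' : k'.-tuple (block n)).
Hypotheses (wfl : wf_blocks l) (wfl' : wf_blocks l').
Hypothesis same_support :
  \bigcup_i (tnth l i).1 = \bigcup_i (tnth l' i).1.
Hypothesis same_edges : subst_edges d l = subst_edges d' l'.

(* A block of [l] cut by the blocks of [l'] would fail to be [b]-connected. *)
Lemma lin_refines b :
  (forall i, bconn b (tnth l i).1 (fun x y => (tnth l i).2 (x, y))) ->
  d' = lin k' b -> forall i, exists j, (tnth l i).1 \subset (tnth l' j).1.
Proof.
move=> lconn dE i; have /set0Pn[x xi] := wf_nonempty wfl i.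
have cover y : y \in (tnth l i).1 -> exists j, y \in (tnth l' j).1.
  move=> yi; have: y \in \bigcup_i (tnth l i).1 by apply/bigcupP; exists i.
  by rewrite same_support => /bigcupP[j _ yj]; exists j.
have [j xj] := cover x xi; exists j; apply/setIidPl/eqP/negPn/negP=> nE.
have [|u [v [/setIP[ui uj] /setDP[vi]]]] := lconn i _ (subsetIl _ _) _ nE.
  by apply/set0Pn; exists x; rewrite inE xi.
rewrite inE vi /= => vj; have [m vm] := cover v vi.
have jm : j != m by apply: contraNneq vj => ->.
by rewrite -(subst_edges_inside d wfl ui vi) same_edges
     (subst_edges_across d' wfl' jm uj vm) dE lin_adj jm eqxx.
Qed.

(* The blocks of [l'] are proper modules; the blocks of [l] met by such a module
   form a module of [H], hence there is only one of them. *)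
Lemma prime_refines H : d = Prime H -> prime_graph H -> 1 < k' ->
  forall j, exists i, (tnth l' j).1 \subset (tnth l i).1.
Proof.
move=> dE /andP[k3 /forallP Hmod] k'2 j; set X := (tnth l' j).1.
have cover y : y \in X -> exists i, y \in (tnth l i).1.
  move=> yi; have: y \in \bigcup_i (tnth l' i).1 by apply/bigcupP; exists j.
  by rewrite -same_support => /bigcupP[i _ xi]; exists i.
have cover' i y : y \in (tnth l i).1 -> y \notin X -> exists m, (j != m) /\ y \in (tnth l' m).1.
  move=> yi yX; have: y \in \bigcup_i (tnth l i).1 by apply/bigcupP; exists i.
  rewrite same_support => /bigcupP[m _ xm]; exists m; split=> //.
  by apply: contraNneq yX => E; rewrite /X E.
have Xmod i v x y : v \in (tnth l i).1 -> v \notin X -> x \in X -> y \in X ->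
    subst_edges d l (v, x) = subst_edges d l (v, y).
  move=> vi vX xX yX; have [m [jm vm]] := cover' _ _ vi vX; rewrite same_edges.
  by rewrite eq_sym in jm; rewrite !(subst_edges_across d' wfl' jm).
pose I := [set i | [exists x, (x \in X) && (x \in (tnth l i).1)]].
have II i x : x \in X -> x \in (tnth l i).1 -> i \in I.
  by move=> xX xi; rewrite inE; apply/existsP; exists x; rewrite xX.
have homog (J : {set 'I_k}) v :
    (forall i, i \in J -> adj H v i = adj H v (odflt v [pick i in J])) ->
    [forall i in J, adj H v i] || [forall i in J, ~~ adj H v i].
  move=> h; case: (boolP (adj H v (odflt v [pick i in J]))) => hb; apply/orP.
    by left; apply/forallP=> i; apply/implyP=> /h ->.
  by right; apply/forallP=> i; apply/implyP=> /h ->.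
have Imod : is_module H I.
  apply/forallP=> v; apply/implyP=> vI; apply: homog => i iI.
  have /set0Pn[z zv] := wf_nonempty wfl v.
  have zX : z \notin X by apply: contra vI => zX; apply: (II _ z).
  have toE m y : m \in I -> y \in X -> y \in (tnth l m).1 ->
      adj H v m = subst_edges d l (z, y).
    move=> mI yX ym; have vm : v != m by apply: contraNneq vI => ->.
    by rewrite (subst_edges_across d wfl vm zv ym) dE.
  case: pickP => [i' i'I|/(_ i)]; last by rewrite iI.
  move: (iI); rewrite inE => /existsP[x /andP[xX xi]].
  move: (i'I); rewrite inE => /existsP[x' /andP[x'X x'i']].
  by rewrite (toE i x) //= (toE i' x') // (Xmod v z x x').
have /set0Pn[x0 x0X] := wf_nonempty wfl' j.
have [i0 x0i0] := cover _ x0X.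
have := Hmod I; rewrite Imod /= /trivial_module => /orP[c1|/eqP IT].
  exists i0; apply/subsetP=> y yX; have [i yi] := cover _ yX.
  have /card_le1_eqP h := c1.
  by rewrite -(h _ _ (II _ _ x0X x0i0) (II _ _ yX yi)).
have [m [jm _]] : exists m, j != m /\ true.
  have : 0 < #|[set~ j]| by rewrite cardsC1 card_ord; case: (k') k'2 => [|[]].
  by case/card_gt0P=> m; rewrite !inE eq_sym => h; exists m.
have /set0Pn[v vm] := wf_nonempty wfl' m.
have vX : v \notin X.
  by apply/negP=> vX; case/negP: jm; apply/eqP/(wf_inj wfl' vX vm).
have [i vi] : exists i, v \in (tnth l i).1.
  have: v \in \bigcup_i (tnth l' i).1 by apply/bigcupP; exists m.
  by rewrite -same_support => /bigcupP[i _ xi]; exists i.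
have Cmod : is_module H [set~ i].
  apply/forallP=> u; apply/implyP; rewrite !inE negbK => /eqP ->.
  apply: homog => p pi.
  have toE q : q != i -> adj H i q = subst_edges d l (v, x0).
    move=> qi; have : q \in I by rewrite IT inE.
    rewrite inE => /existsP[y /andP[yX yq]]; rewrite -(Xmod i v y) //.
    by rewrite eq_sym in qi; rewrite (subst_edges_across d wfl qi vi yq) dE.
  case: pickP => [q qi|/(_ p)]; last by rewrite pi.
  by move: pi qi; rewrite !inE => pi qi; rewrite !toE.
have := Hmod [set~ i]; rewrite Cmod /= /trivial_module cardsC1 card_ord.
case/orP=> [|/eqP E]; first by rewrite -subn1 leq_subLR leqNgt k3.
by have : i \in [set~ i]; [rewrite E inE | rewrite !inE eqxx].
Qed.

End Uniqueness.

Definition min_sorted n := sorted (fun B C : {set 'I_n} => min_label B < min_label C).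

Lemma refines_eq n k k' (l : k.-tuple (block n)) (l' : k'.-tuple (block n)) :
  wf_blocks l -> wf_blocks l' ->
  (forall i, exists j, (tnth l i).1 \subset (tnth l' j).1) ->
  (forall j, exists i, (tnth l' j).1 \subset (tnth l i).1) ->
  min_sorted (map fst l) -> min_sorted (map fst l') -> map fst l = map fst l'.
Proof.
move=> wfl wfl' r r' s s'.
have half p p' (q : p.-tuple (block n)) (q' : p'.-tuple (block n)) :
    wf_blocks q -> (forall i, exists j, (tnth q i).1 \subset (tnth q' j).1) ->
    (forall j, exists i, (tnth q' j).1 \subset (tnth q i).1) ->
    {subset map fst q <= map fst q'}.
  move=> wq h h' B /mapP[b /tnthP[i ->] ->] {B b}.
  have [j ij] := h i; have [m jm] := h' j.
  have /set0Pn[x xi] := wf_nonempty wq i.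
  have xm := subsetP jm _ (subsetP ij _ xi).
  rewrite -(wf_inj wq xi xm) in jm.
  have -> : (tnth q i).1 = (tnth q' j).1 by apply/eqP; rewrite eqEsubset ij.
  by apply: map_f; rewrite mem_tnth.
apply: irr_sorted_eq s s' _.
- by move=> A B C; apply: ltn_trans.
- by move=> A; rewrite ltnn.
- by move=> B; apply/idP/idP; apply: half.
Qed.

Lemma subst_edges_inj n k (d d' : decoration k) (l l' : k.-tuple (block n)) :
  wf_blocks l -> wf_blocks l' -> map fst l = map fst l' ->
  subst_edges d l = subst_edges d' l' ->
  l = l' /\ forall i j, deco_adj d i j = deco_adj d' i j.
Proof.
move=> wfl wfl' E1 E2.
have fstE i : (tnth l i).1 = (tnth l' i).1.
  rewrite -!(tnth_map fst); congr tnth; exact: val_inj.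
have El : l = l'.
  apply: eq_from_tnth => i; move: (fstE i) (subst_edges_restr d wfl i)
     (subst_edges_restr d' wfl' i) => /=.
  case: (tnth l i) (tnth l' i) => [A E] [A' E'] /= <- h h'; congr pair.
  by apply/ffunP=> -[x y]; rewrite h h' E2.
split=> // i j; have [<-|ij] := eqVneq i j; first by rewrite !deco_adjxx.
have /set0Pn[x xi] := wf_nonempty wfl i.
have /set0Pn[y yj] := wf_nonempty wfl j.
rewrite -(subst_edges_across d wfl ij xi yj) E2.
by rewrite El in xi yj; rewrite (subst_edges_across d' wfl' ij xi yj).
Qed.

Lemma pairwise_tupleP T k (r : rel T) (l : k.-tuple T) :
  reflect (forall i j : 'I_k, i < j -> r (tnth l i) (tnth l j)) (pairwise r l).
Proof.
case: k l => [|k] l.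
  by rewrite tuple0; apply: ReflectT => -[].
have x0 := tnth l ord0; apply: (iffP (pairwiseP x0)) => h.
  move=> i j ij; rewrite !(tnth_nth x0); apply: h => //.
    by rewrite inE /= size_tuple.
  by rewrite inE /= size_tuple.
move=> i j; rewrite !inE /= !size_tuple => hi hj ij.
by have := h (Ordinal hi) (Ordinal hj) ij; rewrite !(tnth_nth x0).
Qed.

Section Forests.

Variable n : nat.
Implicit Types (A B : {set 'I_n}) (X : {set 'I_n} -> {set edgefun n}).

Definition forest X A (l : seq (block n)) : bool :=
  [&& all (fun b : block n => (b.1 != set0) && (b.2 \in X b.1)) l,
      pairwise (fun b c : block n => [disjoint b.1 & c.1] && (min_label b.1 < min_label c.1)) l
    & \bigcup_(b <- l) b.1 == A].

Definition forests X A k : {set k.-tuple (block n)} := [set l : k.-tuple _ | forest X A l].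

Lemma forest_size X A l : forest X A l -> size l <= n.
Proof.
case/and3P=> h1 h2 _.
have s : sorted ltn [seq min_label b.1 | b <- l].
  rewrite sorted_map; apply: pairwise_sorted; apply: sub_pairwise h2.
  by move=> b c /andP[].
rewrite -(size_map (fun b : block n => min_label b.1)) -[X in _ <= X](size_iota 0 n).
apply: uniq_leq_size; first exact: sorted_uniq ltn_trans ltnn _ s.
move=> m /mapP[b bl ->]; rewrite mem_iota /=; apply: min_label_lt.
by have /andP[] := allP h1 _ bl.
Qed.

Lemma forest_wf X A k (l : k.-tuple (block n)) :
  (forall B E, E \in X B -> edges_on B E) -> forest X A l -> wf_blocks l.
Proof.
move=> Xon /and3P[/all_tnthP h1 /pairwise_tupleP h2 _]; split.
- by move=> i; have /andP[] := h1 i.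
- move=> i j; rewrite neq_ltn => /orP[] /h2 /andP[//].
  by rewrite disjoint_sym.
- by move=> i; have /andP[_ /Xon] := h1 i.
Qed.

Lemma forest_cover X A k (l : k.-tuple (block n)) :
  forest X A l -> \bigcup_i (tnth l i).1 = A.
Proof. by case/and3P=> _ _ /eqP <-; rewrite big_tuple. Qed.

Lemma forest_sorted X A l : forest X A l -> min_sorted (map fst l).
Proof.
case/and3P=> _ h _; rewrite /min_sorted sorted_map; apply: pairwise_sorted.
by apply: sub_pairwise h => b c /andP[].
Qed.

End Forests.

Section Trees.

Variable n : nat.
Implicit Types (t : tree n) (A B : {set 'I_n}).

Lemma deco_ok_arity k (d : decoration k) : deco_ok d -> 1 < k.
Proof. by case: d => //= H /andP[/ltnW]. Qed.

Lemma leaves_neq0 t : canonical t -> leaves t != set0.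
Proof.
elim: t => [v _|k d M IH /= /and5P[/deco_ok_arity k1 /forallP c _ _ _]].
  by apply/set0Pn; exists v; rewrite /= set11.
case: k k1 d M IH c => // k _ d M IH c.
have /set0Pn[x x0] := IH ord0 (c ord0).
by apply/set0Pn; exists x; apply/bigcupP; exists ord0.
Qed.

Lemma node_forest k (d : decoration k) (M : 'I_k -> tree n)
    (X : {set 'I_n} -> {set edgefun n}) :
  canonical (Node d M) -> (forall i, tadj (M i) \in X (leaves (M i))) ->
  forest X (leaves (Node d M)) [tuple block_of (M i) | i < k].
Proof.
move=> /and5P[dok /forallP c _ /forallP dj /forallP mi] hX; apply/and3P; split.
- apply/all_tnthP => i; rewrite tnth_mktuple /= hX andbT.
  exact: leaves_neq0.
- apply/pairwise_tupleP => i j ij; rewrite !tnth_mktuple /=.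
  have /forallP/(_ j)/implyP -> := dj i; last by rewrite neq_ltn ij.
  by have /forallP/(_ j)/implyP -> := mi i.
- by rewrite big_tuple /=; apply/eqP; apply: eq_bigr => i _; rewrite tnth_mktuple.
Qed.

Lemma node_wf k (d : decoration k) (M : 'I_k -> tree n) :
  canonical (Node d M) -> (forall i, edges_on (leaves (M i)) (tadj (M i))) ->
  wf_blocks [tuple block_of (M i) | i < k].
Proof.
move=> c h; apply: forest_wf (@node_forest _ _ _ (fun A => [set E | `[< edges_on A E >]]) c _).
  by move=> B E; rewrite inE => /asboolP.
by move=> i; rewrite inE; apply/asboolP.
Qed.

Lemma leaves_node k (d : decoration k) (M : 'I_k -> tree n) :
  leaves (Node d M) = \bigcup_i (tnth [tuple block_of (M i) | i < k] i).1.
Proof. by rewrite /=; apply: eq_bigr => i _; rewrite tnth_mktuple. Qed.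

Lemma tadj_on t : canonical t -> edges_on (leaves t) (tadj t).
Proof.
elim: t => [v _ x y|k d M IH c]; first by rewrite ffunE.
rewrite tadj_node leaves_node; apply/subst_edges_on/(node_wf c) => i.
by apply: IH; case/and5P: c => _ /forallP.
Qed.

Lemma canonical_node_wf k (d : decoration k) (M : 'I_k -> tree n) :
  canonical (Node d M) -> wf_blocks [tuple block_of (M i) | i < k].
Proof.
move=> c; apply: (node_wf c) => i; apply: tadj_on.
by case/and5P: c => _ /forallP.
Qed.

Definition is_lin b t := same_linear_root (lin 0 b) t.

Lemma lin_bconn k b : 1 < k -> bconn b setT (deco_adj (lin k (~~ b))).
Proof.
move=> k1 S _ /set0Pn[x xS] ST.
have [y yS] : exists y, y \notin S.
  apply/existsP; apply: contraR ST => /existsPn h; rewrite eqEsubset subsetT.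
  by apply/subsetP=> y _; have := h y; rewrite negbK.
exists x, y; rewrite xS inE yS in_setT lin_adj; split=> //.
have -> : x != y by apply: contraNneq yS => <-.
by case: b.
Qed.

Lemma tadj_bconn b t : canonical t -> ~~ is_lin b t ->
  bconn b (leaves t) (fun x y => tadj t (x, y)).
Proof.
case: t => [v _ _|k d M c nl].
  move=> S /=; rewrite subset1 => /orP[/eqP ->|/eqP ->]; by rewrite eqxx.
rewrite leaves_node tadj_node; case/and5P: (c) => dok _ _ _ _.
apply: subst_bconn; [exact: canonical_node_wf c|exact: deco_ok_arity dok|].
case: d c nl dok => [c nl k1|c nl k1|H c _]; last exact: prime_bconn.
- by have := lin_bconn b k1; case: b nl.
- by have := lin_bconn b k1; case: b nl.
Qed.

Lemma is_linP b t : is_lin b t -> exists k (M : 'I_k -> tree n), t = Node (lin k b) M.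
Proof.
by case: t => [|k [||H] M]; case: b => //= _; exists k, M.
Qed.

Lemma tadj_not_bconn b t : canonical t -> is_lin b t ->
  ~ bconn b (leaves t) (fun x y => tadj t (x, y)).
Proof.
move=> c /is_linP[k [M E]]; subst t => h.
have wf := canonical_node_wf c.
have /deco_ok_arity k1 : deco_ok (lin k b) by case/and5P: c.
rewrite leaves_node tadj_node in h; set l := [tuple _ | _ < _] in wf h.
pose i := Ordinal (ltnW k1); pose j := Ordinal k1.
have ij : i != j by [].
have /set0Pn[z zj] := wf_nonempty wf j.
have zi : z \notin (tnth l i).1.
  by apply/negP=> /(wf_inj wf zj) /eqP; rewrite eq_sym (negbTE ij).
have [|||x [y [xi /setDP[/bigcupP[m _ ym]] yi]]] := h (tnth l i).1.
- by apply/subsetP=> x xi; apply/bigcupP; exists i.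
- exact: (wf_nonempty wf i).
- apply/eqP=> E; case/negP: zi; rewrite E; apply/bigcupP; by exists j.
have im : i != m by apply: contraNneq yi => ->.
by rewrite (subst_edges_across _ wf im xi ym) lin_adj im eqxx.
Qed.

End Trees.

Lemma card_sigT_dep (I : finType) (T : I -> finType) (p : pred I)
    (q : forall i, pred (T i)) :
  #|[set s : {i : I & T i} | p (tag s) && q (tag s) (tagged s)]| =
  \sum_(i | p i) #|[set x | q i x]|.
Proof.
rewrite -sum1_card (eq_bigl _ _ (in_set _)).
rewrite -(sig_big_dep (fun i => p i) (fun i j => q i j) (fun _ _ => 1)) /=.
by apply: eq_bigr => i _; rewrite -sum1_card (eq_bigl _ _ (in_set _)).
Qed.

Section Classes.

Variables (P : graph_set) (n : nat).
Implicit Types (t : tree n) (A B : {set 'I_n}) (E : edgefun n) (Q : pred (tree n)).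

Definition good t := canonical t && prime_decorations_in P t.

Definition trees_on (Q : pred (tree n)) A : {set edgefun n} :=
  [set E | `[< exists t, [/\ good t, Q t, leaves t = A & tadj t = E] >]].

Lemma trees_onP Q A E :
  reflect (exists t, [/\ good t, Q t, leaves t = A & tadj t = E]) (E \in trees_on Q A).
Proof. by rewrite inE; apply: asboolP. Qed.

Definition is_leaf t := if t is Leaf _ then true else false.
Definition is_prime t := if t is Node _ (Prime _) _ then true else false.

(* Edge functions of the trees on [A] with: any root; a root which is not, or
   which is, a join ([b = true]) or a union ([b = false]); a prime root. *)
Definition cls := trees_on predT.
Definition ncls b := trees_on (fun t => ~~ is_lin b t).
Definition lcls b := trees_on (is_lin b).
Definition pcls := trees_on is_prime.

Lemma trees_on_edges_on Q A E : E \in trees_on Q A -> edges_on A E.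
Proof. by case/trees_onP=> t [/andP[c _] _ <- <-]; apply: tadj_on. Qed.

Lemma forests_wf Q A k (l : k.-tuple (block n)) :
  l \in forests (trees_on Q) A k -> wf_blocks l.
Proof.
by rewrite inE; apply: forest_wf => B E; apply: trees_on_edges_on.
Qed.

Definition prime_in k (d : decoration k) :=
  if d is Prime H then H \in P k else true.

Lemma forest_tree Q k (d : decoration k) A (l : k.-tuple (block n)) :
  l \in forests (trees_on Q) A k -> deco_ok d -> prime_in d ->
  (forall t, Q t -> ~~ same_linear_root d t) ->
  exists M, [/\ good (Node d M), leaves (Node d M) = A &
                tadj (Node d M) = subst_edges d l].
Proof.
move=> lF dok dP dQ; have wf := forests_wf lF; move: lF; rewrite inE => F.
have /fin_all_exists[M HM] : forall i, exists t, [/\ good t, Q t,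
    leaves t = (tnth l i).1 & tadj t = (tnth l i).2].
  move=> i; case/and3P: F => /all_tnthP/(_ i)/andP[_ /trees_onP[t [g q e1 e2]]] _ _.
  by exists t.
have El : l = [tuple block_of (M i) | i < k].
  apply: eq_from_tnth => i; rewrite tnth_mktuple /block_of.
  by case: (HM i) => _ _ -> ->; case: (tnth l i).
exists M; split; last by rewrite tadj_node -El.
  apply/andP; split; last first.
    apply/andP; split; first by move: dP; case: (d).
    by apply/forallP=> i; case: (HM i) => /andP[].
  apply/and5P; split=> //.
  - by apply/forallP=> i; case: (HM i) => /andP[].
  - by apply/forallP=> i; apply: dQ; case: (HM i).
  - apply/forallP=> i; apply/forallP=> j; apply/implyP=> ij.
    by have := wf_disjoint wf ij; rewrite El !tnth_mktuple.
  - apply/forallP=> i; apply/forallP=> j; apply/implyP=> ij.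
    by case/and3P: F => _ /pairwise_tupleP/(_ i j ij)/andP[_]; rewrite El !tnth_mktuple.
by rewrite leaves_node -El; apply: forest_cover F.
Qed.

Lemma node_forests Q k (d : decoration k) (M : 'I_k -> tree n) :
  good (Node d M) -> (forall i, Q (M i)) ->
  [tuple block_of (M i) | i < k] \in forests (trees_on Q) (leaves (Node d M)) k.
Proof.
case/andP=> c /= /andP[_ /forallP p] q; rewrite inE.
apply: (node_forest c) => i; apply/trees_onP; exists (M i); split=> //.
by rewrite /good p andbT; case/and5P: c => _ /forallP.
Qed.

Lemma ncls_bconn b A E : E \in ncls b A -> bconn b A (fun x y => E (x, y)).
Proof.
by case/trees_onP=> t [/andP[c _] nl <- <-]; apply: tadj_bconn.
Qed.

Lemma lcls_not_bconn b A E : E \in lcls b A -> ~ bconn b A (fun x y => E (x, y)).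
Proof.
by case/trees_onP=> t [/andP[c _] nl <- <-]; apply: tadj_not_bconn.
Qed.

Lemma forests_map_fst_size Q A k k' (l : k.-tuple (block n)) (l' : k'.-tuple (block n)) :
  l \in forests (trees_on Q) A k -> map fst l = map fst l' -> k = k' /\ k < n.+1.
Proof.
rewrite inE => /forest_size; rewrite size_tuple ltnS => kn E; split=> //.
by rewrite -(size_tuple l) -(size_map fst) E size_map size_tuple.
Qed.

Lemma lin_forest_inj b A k k' (l : k.-tuple (block n)) (l' : k'.-tuple (block n)) :
  l \in forests (ncls b) A k -> l' \in forests (ncls b) A k' ->
  subst_edges (lin k b) l = subst_edges (lin k' b) l' -> map fst l = map fst l'.
Proof.
move=> lF lF' E; have wf := forests_wf lF; have wf' := forests_wf lF'.
move: lF lF'; rewrite !inE => F F'.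
have conn p (q : p.-tuple (block n)) : forest (ncls b) A q ->
    forall i, bconn b (tnth q i).1 (fun x y => (tnth q i).2 (x, y)).
  by case/and3P=> /all_tnthP h _ _ i; apply: ncls_bconn; case/andP: (h i).
have sup := etrans (forest_cover F) (esym (forest_cover F')).
apply: (refines_eq wf wf' _ _ (forest_sorted F) (forest_sorted F')).
  exact: (lin_refines wf wf' sup E (conn _ _ F) erefl).
exact: (lin_refines wf' wf (esym sup) (esym E) (conn _ _ F') erefl).
Qed.

Lemma prime_forest_inj Q Q' A k k' (H : lgraph k) (H' : lgraph k')
    (l : k.-tuple (block n)) (l' : k'.-tuple (block n)) :
  prime_graph H -> prime_graph H' ->
  l \in forests (trees_on Q) A k -> l' \in forests (trees_on Q') A k' ->
  subst_edges (Prime H) l = subst_edges (Prime H') l' -> map fst l = map fst l'.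
Proof.
move=> pH pH' lF lF' E; have wf := forests_wf lF; have wf' := forests_wf lF'.
move: lF lF'; rewrite !inE => F F'.
have sup := etrans (forest_cover F) (esym (forest_cover F')).
have [k1 k'1] : 1 < k /\ 1 < k'.
  by split; [case/andP: pH => /ltnW | case/andP: pH' => /ltnW].
apply: (refines_eq wf wf' _ _ (forest_sorted F) (forest_sorted F')).
  exact: (prime_refines wf' wf (esym sup) (esym E) erefl pH' k1).
exact: (prime_refines wf wf' sup E erefl pH k'1).
Qed.

Lemma card_lcls b A :
  #|lcls b A| = \sum_(k < n.+1 | 1 < k) #|forests (ncls b) A k|.
Proof.
pose T (k : 'I_n.+1) : finType := (nat_of_ord k).-tuple (block n).
pose D := [set s : {k : 'I_n.+1 & T k} |
  (1 < tag s) && (tagged s \in forests (ncls b) A (tag s))].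
pose f (s : {k : 'I_n.+1 & T k}) := subst_edges (lin (tag s) b) (tagged s).
have -> : lcls b A = f @: D.
  apply/setP=> E; apply/idP/imsetP.
    case/trees_onP=> t [g /is_linP[k [M Et]] eA <-]; subst t.
    have c : canonical (Node (lin k b) M) by case/andP: g.
    have F := @node_forests (fun t => ~~ is_lin b t) k (lin k b) M g.
    have {}F := F _; have lF : [tuple block_of (M i) | i < k] \in
        forests (ncls b) A k.
      rewrite -eA; apply: F => i; case/and5P: c => _ _ /forallP/(_ i) + _ _.
      by rewrite /is_lin; case: (b).
    have [_ kn] := forests_map_fst_size lF erefl.
    exists (Tagged T (i := Ordinal kn) [tuple block_of (M i) | i < k] : {k : 'I_n.+1 & T k}).
      by rewrite inE /= lF andbT; case/and5P: c => /deco_ok_arity.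
    by rewrite tadj_node.
  case=> -[k l] /=; rewrite inE /= => /andP[k1 lF] ->.
  have [|||M [g lE tE]] := forest_tree (d := lin k b) lF.
  - by case: (b).
  - by case: (b).
  - by rewrite /is_lin => t; case: (b).
  apply/trees_onP; exists (Node (lin k b) M); split=> //.
  by rewrite /is_lin; case: (b).
rewrite card_in_imset.
  rewrite /D (card_sigT_dep (fun k : 'I_n.+1 => 1 < k) (fun k => mem (forests (ncls b) A k))).
  by apply: eq_bigr => k _; apply: eq_card => l; rewrite inE.
move=> [k l] [k' l']; rewrite !inE /= => /andP[_ h] /andP[_ h'] E.
have F : l \in forests (ncls b) A k by rewrite inE.
have F' : l' \in forests (ncls b) A k' by rewrite inE.
have Em := lin_forest_inj F F' E.
have [/val_inj kk _] := forests_map_fst_size F Em; subst k'.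
by have [-> _] := subst_edges_inj (forests_wf F) (forests_wf F') Em E.
Qed.

Hypothesis Pprime : forall k (H : lgraph k), H \in P k -> prime_graph H.

Lemma card_pcls A :
  #|pcls A| = \sum_(k < n.+1) #|P k| * #|forests cls A k|.
Proof.
pose T (k : 'I_n.+1) : finType := (lgraph k * (nat_of_ord k).-tuple (block n))%type.
pose D := [set s : {k : 'I_n.+1 & T k} |
  true && (tagged s \in setX (P (tag s)) (forests cls A (tag s)))].
pose f (s : {k : 'I_n.+1 & T k}) := subst_edges (Prime (tagged s).1) (tagged s).2.
have -> : pcls A = f @: D.
  apply/setP=> E; apply/idP/imsetP.
    case/trees_onP=> [[v|k [||H] M] [g //= _ eA <-]].
    have := @node_forests predT k (Prime H) M g (fun _ => erefl).
    rewrite [leaves _]eA => lF.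
    have [_ kn] := forests_map_fst_size lF erefl.
    exists (Tagged T (i := Ordinal kn) (H, [tuple block_of (M i) | i < k])
       : {k : 'I_n.+1 & T k}).
      by rewrite inE /= in_setX lF andbT; case/andP: g => _ /andP[].
    by rewrite tadj_node.
  case=> -[k [H l]] /=; rewrite inE in_setX /= => /andP[HP lF] ->.
  have [|||M [g lE tE]] := forest_tree (d := Prime H) lF => //.
    exact: Pprime.
  by apply/trees_onP; exists (Node (Prime H) M).
rewrite card_in_imset.
  rewrite /D (card_sigT_dep predT (fun k : 'I_n.+1 => mem (setX (P k) (forests cls A k)))).
  apply: eq_bigr => k _; rewrite -cardsX.
  by apply: eq_card => l; rewrite inE.
move=> [k [H l]] [k' [H' l']]; rewrite !inE /= => /andP[h hl] /andP[h' hl'] E.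
have F : l \in forests cls A k by rewrite inE.
have F' : l' \in forests cls A k' by rewrite inE.
have Em := prime_forest_inj (Pprime h) (Pprime h') F F' E.
have [/val_inj kk _] := forests_map_fst_size F Em; subst k'.
have [-> e] := subst_edges_inj (forests_wf F) (forests_wf F') Em E.
suff -> : H = H' by [].
by apply: val_inj; apply/ffunP=> -[i j]; apply: (e i j).
Qed.

Lemma card_node k (d : decoration k) (M : 'I_k -> tree n) :
  canonical (Node d M) -> 1 < #|leaves (Node d M)|.
Proof.
move=> c; have wf := canonical_node_wf c; rewrite leaves_node.
have /deco_ok_arity k1 : deco_ok d by case/and5P: c.
set l := [tuple _ | _ < _] in wf *.
have /set0Pn[x x0] := wf_nonempty wf (Ordinal (ltnW k1)).
have /set0Pn[y y0] := wf_nonempty wf (Ordinal k1).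
apply/card_gt1P; exists x, y; split.
- by apply/bigcupP; exists (Ordinal (ltnW k1)).
- by apply/bigcupP; exists (Ordinal k1).
- by apply/eqP=> xy; rewrite xy in x0; have /eqP := wf_inj wf x0 y0.
Qed.

Lemma card_leafcls A : #|trees_on is_leaf A| = (#|A| == 1).
Proof.
case: (boolP (#|A| == 1)) => [/cards1P[v ->]|A1].
  suff -> : trees_on is_leaf [set v] = [set tadj (Leaf v)] by rewrite cards1.
  apply/setP=> E; apply/trees_onP/set1P => [[t]|->]; last by exists (Leaf v).
  by case: t => [u|k d M] [_ h] //= /set1_inj -> <-.
apply: eq_card0 => E; apply/negP=> /trees_onP[t]; case: t => [v|k d M] [_ h] // E1 _.
by rewrite -E1 cards1 in A1.
Qed.

Lemma trees_on_sub (Q Q' : pred (tree n)) A :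
  (forall t, Q t -> Q' t) -> trees_on Q A \subset trees_on Q' A.
Proof.
move=> h; apply/subsetP=> E /trees_onP[t [g q e1 e2]]; apply/trees_onP.
by exists t; split=> //; apply: h.
Qed.

Lemma card_trees_onU (Q Q1 Q2 : pred (tree n)) A : (forall t, Q t = Q1 t || Q2 t) ->
  (forall E, E \in trees_on Q1 A -> E \in trees_on Q2 A -> False) ->
  #|trees_on Q A| = #|trees_on Q1 A| + #|trees_on Q2 A|.
Proof.
move=> QE dis; rewrite -cardsUI.
have -> : trees_on Q1 A :&: trees_on Q2 A = set0.
  by apply/setP=> E; rewrite !inE; apply/negP=> /andP[h1 h2]; apply: (dis E); rewrite inE.
rewrite cards0 addn0; congr #|pred_of_set _|; apply/setP=> E; rewrite in_setU.
apply/idP/orP => [/trees_onP[t [g]]|[]]; last 2 first.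
- by apply/subsetP/trees_on_sub => t q; rewrite QE q.
- by apply/subsetP/trees_on_sub => t q; rewrite QE q orbT.
rewrite QE => /orP[] q e1 e2; [left|right]; apply/trees_onP; by exists t.
Qed.

Lemma card_ncls b A : #|cls A| = #|lcls b A| + #|ncls b A|.
Proof.
apply: card_trees_onU => [t|E]; first by rewrite orbN.
by move/lcls_not_bconn=> h1 /ncls_bconn.
Qed.

Lemma card_cls A :
  #|cls A| = (#|A| == 1) + #|lcls true A| + #|lcls false A| + #|pcls A|.
Proof.
have -> : #|cls A| = #|lcls true A| + #|ncls true A| := card_ncls true A.
have -> : #|ncls true A| = #|lcls false A| + #|trees_on (fun t => is_leaf t || is_prime t) A|.
  apply: card_trees_onU => [|E /lcls_not_bconn h h'].
    by case=> [v|k [||H] M].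
  apply/h/ncls_bconn; apply: (subsetP _ _ h').
  by apply: trees_on_sub => -[v|k [||H] M].
have -> : #|trees_on (fun t => is_leaf t || is_prime t) A| = (#|A| == 1) + #|pcls A|.
  rewrite -card_leafcls; apply: card_trees_onU => // E.
  case/trees_onP=> t; case: t => [v|k d M] [_ h] // <- _.
  case/trees_onP=> t; case: t => [w|k d M] [/andP[c _] h' e _] //.
  by move/card_node: c => c; rewrite e cards1 in c.
by rewrite addnA addnCA !addnA.
Qed.

Lemma card_class_count : class_count P n = #|cls setT|.
Proof.
rewrite /class_count -(card_imset _ val_inj); apply: eq_card => E.
apply/imsetP/trees_onP => [[G]|[t [g _ lt tE]]].
  rewrite inE => /asboolP[t [[c lt h] p]] ->; exists t; split=> //.
    by rewrite /good c.
  by apply/ffunP=> -[x y]; rewrite ffunE h.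
case/andP: g => c p.
have on := tadj_on c; rewrite tE in on.
have gE : is_graph E.
  apply/andP; split.
    by apply/forallP=> x; apply/negP=> /on[_ _]; rewrite eqxx.
  apply/forallP=> x; apply/forallP=> y; apply/eqP; apply/idP/idP.
    by case/on.
  by case/on.
exists (LGraph gE) => //; rewrite inE; apply/asboolP; exists t; split=> //; split=> //.
by move=> x y; rewrite /adj /= -tE ffunE.
Qed.

End Classes.

(** * Counting *)

(* Number of partitions of an [m]-set into [k] blocks, each block of size [j]
   carrying one of [f j] structures; [j.+1] is the size of the block of the
   minimum. *)
Fixpoint fcount (f : nat -> nat) k m : nat :=
  if k is k'.+1 then
    if m is m'.+1 then \sum_(j < m'.+1) 'C(m', j) * (f j.+1 * fcount f k' (m' - j))
    else 0
  else (m == 0).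

Lemma fcount_small f k m : m < k -> fcount f k m = 0.
Proof.
elim: k m => // k IH [|m] //= mk; apply: big1 => j _.
by rewrite IH ?muln0 ?muln0 //; move: mk; rewrite ltnS; apply: leq_ltn_trans; apply: leq_subr.
Qed.

Lemma sum_subsets_card (T : finType) (A : {set T}) (g : nat -> nat) :
  \sum_(B : {set T} | B \subset A) g #|B| = \sum_(j < #|A|.+1) 'C(#|A|, j) * g j.
Proof.
rewrite (partition_big (fun B : {set T} => inord #|B| : 'I_#|A|.+1) predT) //=.
apply: eq_bigr => j _; rewrite -cards_draws -sum_nat_const.
have P (B : {set T}) : B \subset A -> (inord #|B| == j) = (#|B| == j).
  move=> BA; rewrite -val_eqE /= inordK // ltnS; exact: subset_leq_card.
apply: eq_big => [B|B /andP[BA]]; last by rewrite P // => /eqP ->.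
by rewrite inE; case: (boolP (B \subset A)) => //= /P ->.
Qed.

Lemma sum_subsets_mem (T : finType) (A : {set T}) a (g : nat -> nat) :
  a \in A -> \sum_(B : {set T} | (a \in B) && (B \subset A)) g #|B| =
  \sum_(j < #|A|.-1.+1) 'C(#|A|.-1, j) * g j.+1.
Proof.
move=> aA; have -> : #|A|.-1 = #|A :\ a| by rewrite (cardsD1 a A) aA.
rewrite -(sum_subsets_card _ (fun j => g j.+1)).
rewrite (reindex_onto (fun B => a |: B) (fun B => B :\ a)) /=; last first.
  by move=> B /andP[aB _]; rewrite setD1K.
apply: eq_big => [B|B].
  rewrite setU11 /= subUset sub1set aA /= subsetD1.
  case: (boolP (B \subset A)) => //= BA.
  case: (boolP (a \in B)) => aB; last by rewrite setU1K ?eqxx.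
  by apply/negP=> /eqP E; move: aB; rewrite -E setD11.
move=> /andP[_ /eqP E]; have aB : a \notin B by rewrite -E setD11.
by rewrite cardsU1 aB.
Qed.

Lemma seq_bigcupP (I : eqType) (T : finType) (r : seq I) (F : I -> {set T}) x :
  reflect (exists2 i, i \in r & x \in F i) (x \in \bigcup_(i <- r) F i).
Proof.
elim: r => [|i r IH]; first by rewrite big_nil inE; apply: ReflectF => -[].
rewrite big_cons inE; apply: (iffP orP) => [[xi|/IH[j jr xj]]|[j]].
- by exists i; rewrite ?mem_head.
- by exists j; rewrite // inE jr orbT.
- rewrite inE => /predU1P[->|jr] xj; [by left | right; apply/IH; by exists j].
Qed.

Section ForestCount.

Variable n : nat.
Implicit Types (A B : {set 'I_n}) (X : {set 'I_n} -> {set edgefun n}).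

Lemma forest_nil X A : forest X A [::] = (A == set0).
Proof. by rewrite /forest /= big_nil eq_sym. Qed.

Lemma forest_cons X A a b l : a \in A -> min_label A = a ->
  forest X A (b :: l) =
  [&& a \in b.1, b.1 \subset A, b.2 \in X b.1 & forest X (A :\: b.1) l].
Proof.
move=> aA Ea; rewrite /forest /= big_cons; set U := \bigcup_(b <- l) b.1.
have subU c : c \in l -> c.1 \subset U.
  by move=> cl; apply/subsetP=> x xc; apply/seq_bigcupP; exists c.
apply/and3P/and4P.
  move=> [/andP[/andP[b0 bX] al] /andP[/allP pb pl] /eqP E].
  have bA : b.1 \subset A by rewrite -E subsetUl.
  have dU : [disjoint b.1 & U].
    apply/pred0P=> x; apply/negP=> /= /andP[xb /seq_bigcupP[c cl xc]].
    by have /andP[/pred0P/(_ x)/negP[]] := pb c cl; rewrite /= xb.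
  split=> //; last first.
    by rewrite al pl -E setDUl setDv set0U /= eq_sym; apply/eqP/setDidPl; rewrite disjoint_sym.
  move: (aA); rewrite -E inE => /orP[//|]; move=> /seq_bigcupP[c cl ac].
  have /andP[_] := pb c cl; rewrite ltnNge => /negP[].
  apply: leq_trans (min_label_le ac) _; rewrite -Ea.
  exact: min_label_sub.
case=> ab bA bX /and3P[al pl /eqP E]; split.
- by rewrite bX al andbT /= andbT; apply/set0Pn; exists a.
- rewrite pl andbT; apply/allP=> c cl.
  have cs : c.1 \subset A :\: b.1 by rewrite -E; apply: subU.
  have -> : [disjoint b.1 & c.1].
    by rewrite disjoint_sym; apply: disjointWl cs _; rewrite disjoints_subset; apply/subsetP=> x; rewrite !inE => /andP[].
  have c0 : c.1 != set0 by have /andP[] := allP al c cl.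
  have [x xc ->] := min_label_mem c0.
  have /setDP[xA xb] := subsetP cs _ xc.
  apply: leq_ltn_trans (min_label_le ab) _.
  rewrite ltn_neqAle -Ea min_label_le // andbT Ea.
  by apply: contraNneq xb => /val_inj <-.
- by rewrite E; apply/eqP/setP=> x; rewrite !inE; case: (boolP (x \in b.1)) => //= /(subsetP bA) ->.
Qed.

Lemma card_forests0 X A : #|forests X A 0| = (#|A| == 0).
Proof.
rewrite cards_eq0; case: eqP => [->|A0].
  suff -> : forests X set0 0 = [set [tuple]] by rewrite cards1.
  by apply/setP=> l; rewrite !inE tuple0 forest_nil !eqxx.
apply: eq_card0 => l; rewrite inE tuple0 forest_nil; exact/eqP.
Qed.

Lemma card_forestsS X A a k : a \in A -> min_label A = a ->
  #|forests X A k.+1| =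
  \sum_(B : {set 'I_n} | (a \in B) && (B \subset A)) #|X B| * #|forests X (A :\: B) k|.
Proof.
move=> aA Ea; pose h (p : block n * k.-tuple (block n)) := [tuple of p.1 :: p.2].
rewrite -sum1_card (reindex h) /=; last first.
  exists (fun l => (thead l, [tuple of behead l])) => [[p l] _|l _].
    by rewrite /h theadE; congr pair; apply: val_inj.
  by rewrite /h /= -tuple_eta.
rewrite (eq_bigl (fun p : block n * k.-tuple (block n) => [&& a \in p.1.1, p.1.1 \subset A, p.1.2 \in X p.1.1
    & p.2 \in forests X (A :\: p.1.1) k])); last first.
  by case=> b l; rewrite !inE (forest_cons _ _ _ aA Ea).
transitivity (\sum_(B : {set 'I_n} | (a \in B) && (B \subset A))
  \sum_(E | E \in X B) \sum_(l in forests X (A :\: B) k) 1).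
  rewrite pair_big_dep pair_big_dep /=.
  by apply: eq_bigl => -[[B E] l] /=; rewrite -!andbA.
by apply: eq_bigr => B _; rewrite sum_nat_const sum1_card.
Qed.

Lemma card_forests_set0 X k : #|forests X set0 k.+1| = 0.
Proof.
apply: eq_card0 => l; rewrite inE; apply/negP=> /and3P[/all_tnthP/(_ ord0)/andP[]].
case/set0Pn=> x xl _ _; rewrite big_tuple => /eqP E.
suff: x \in set0 by rewrite inE.
by rewrite -E; apply/bigcupP; exists ord0.
Qed.

Lemma card_forests X f A k : (forall B, B \subset A -> #|X B| = f #|B|) ->
  #|forests X A k| = fcount f k #|A|.
Proof.
elim: k A => [|k IH] A Xf; first exact: card_forests0.
have [->|A0] := eqVneq A set0; first by rewrite card_forests_set0 cards0.
have [a aA Ea] := min_label_mem A0.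
rewrite (card_forestsS _ _ aA Ea).
rewrite (eq_bigr (fun B => (fun j => f j * fcount f k (#|A| - j)) #|B|)); last first.
  move=> B /andP[aB BA]; rewrite Xf // IH ?cardsDS // => C CA.
  by apply: Xf; apply: subset_trans CA (subsetDl _ _).
rewrite (sum_subsets_mem (fun j => f j * fcount f k (#|A| - j)) aA) (cardsD1 a A) aA /=.
by apply: eq_bigr => j _; rewrite add1n subSS.
Qed.

Lemma card_forests_proper X f A k : 1 < k ->
  (forall B, B \proper A -> #|X B| = f #|B|) ->
  #|forests X A k| = fcount f k #|A|.
Proof.
case: k => [|[|k]] // _ Xf.
have [->|A0] := eqVneq A set0; first by rewrite card_forests_set0 cards0.
have [a aA Ea] := min_label_mem A0.
rewrite (card_forestsS _ _ aA Ea).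
rewrite (eq_bigr (fun B => (fun j => f j * fcount f k.+1 (#|A| - j)) #|B|)); last first.
  move=> B /andP[aB BA]; have [->|BnA] := eqVneq B A.
    by rewrite setDv card_forests_set0 subnn !muln0.
  have BpA : B \proper A by rewrite properEneq BnA.
  rewrite Xf // (@card_forests _ f) ?cardsDS // => C CA; apply: Xf.
  apply/properP; split; first exact: subset_trans CA (subsetDl _ _).
  by exists a => //; apply/negP=> /(subsetP CA); rewrite inE aB.
rewrite (sum_subsets_mem (fun j => f j * fcount f k.+1 (#|A| - j)) aA).
have -> : #|A| = #|A :\ a|.+1 by rewrite (cardsD1 a A) aA.
by apply: eq_bigr => j _; rewrite subSS.
Qed.

End ForestCount.

Section Recursion.

Variable P : graph_set.
Hypothesis Pprime : forall k (H : lgraph k), H \in P k -> prime_graph H.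

Definition ncount m := #|ncls P true [set: 'I_m]|.

Let c := class_count P.
Let v := ncount.

Let J m := \sum_(2 <= k < m.+1) fcount v k m.
Let Q m := \sum_(2 <= k < m.+1) #|P k| * fcount c k m.

Lemma P_small k : k < 2 -> #|P k| = 0.
Proof.
move=> k2; apply: eq_card0 => H; apply/negP=> /Pprime/andP[/ltnW k2' _].
by rewrite ltnNge k2' in k2.
Qed.

Lemma class_recursion m n (A : {set 'I_n}) b : #|A| = m ->
  #|cls P A| = (m == 1) + J m + J m + Q m /\ #|ncls P b A| = (m == 1) + J m + Q m.
Proof.
have [N] := ubnP m; elim: N m n A b => // N IH m n A b mN cA.
have IHc n' (B : {set 'I_n'}) : #|B| < m -> #|cls P B| = c #|B|.
  move=> Bm; rewrite /c card_class_count.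
  have [|-> _] := IH _ _ B true _ erefl; first exact: leq_trans Bm _.
  have [||-> _] // := IH #|B| _ [set: 'I_#|B|] true.
  - exact: leq_trans Bm _.
  - by rewrite cardsT card_ord.
have IHv n' b' (B : {set 'I_n'}) : #|B| < m -> #|ncls P b' B| = v #|B|.
  move=> Bm; rewrite /v /ncount.
  have [|_ ->] := IH _ _ B b' _ erefl; first exact: leq_trans Bm _.
  have [||_ ->] // := IH #|B| _ [set: 'I_#|B|] true.
  - exact: leq_trans Bm _.
  - by rewrite cardsT card_ord.
have mn : m <= n by rewrite -cA -[n in _ <= n]card_ord; apply: max_card.
have range (F : nat -> nat) : (forall k, m < k -> F k = 0) -> (forall k, k < 2 -> F k = 0) ->
    \sum_(k < n.+1) F k = \sum_(2 <= k < m.+1) F k.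
  move=> F0 F1; rewrite -(big_mkord predT F) (big_cat_nat (n := m.+1)) //=.
  have -> : \sum_(m.+1 <= k < n.+1) F k = 0.
    by rewrite big_nat big1 // => k /andP[km _]; apply: F0.
  rewrite addn0; case: (leqP 2 m.+1) => [h|h].
    rewrite (big_cat_nat (n := 2)) //=; have -> : \sum_(0 <= k < 2) F k = 0.
      by rewrite big_nat big1 // => k /andP[_ k2]; apply: F1.
    by [].
  rewrite [RHS]big_geq 1?ltnW // big_nat big1 // => k /andP[_ km].
  by apply: F1; apply: leq_trans km (ltnW h).
have HJ b' : #|lcls P b' A| = J m.
  rewrite card_lcls big_mkcond /=.
  rewrite (eq_bigr (fun k : 'I_n.+1 => (fun i => if 1 < i then fcount v i m else 0) k)); last first.
    move=> k _ /=; case: ifP => // k1; rewrite (@card_forests_proper _ _ v) ?cA //.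
    by move=> B /proper_card BA; apply: IHv; rewrite -cA.
  rewrite (range (fun i => if 1 < i then fcount v i m else 0)); first last.
  - by move=> k; rewrite ltnS => k1; rewrite ltnNge k1.
  - by move=> k km; rewrite fcount_small // if_same.
  by rewrite /J !big_nat; apply: eq_bigr => k /andP[-> _].
have HQ : #|pcls P A| = Q m.
  rewrite card_pcls //.
  rewrite (eq_bigr (fun k : 'I_n.+1 => (fun i => #|P i| * fcount c i m) k)); last first.
    move=> k _ /=; case: (leqP 2 k) => k1; last by rewrite P_small.
    rewrite (@card_forests_proper _ _ c) ?cA //.
    by move=> B /proper_card BA; apply: IHc; rewrite -cA.
  apply: range => [k km|k k2]; first by rewrite fcount_small ?muln0.
  by rewrite P_small.
have E : #|cls P A| = (m == 1) + J m + J m + Q m by rewrite card_cls cA !HJ HQ.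
split=> //; have := card_ncls P b A; rewrite E HJ => h.
apply/(@addnI (J m)); rewrite -h !addnA [J m + _]addnC; by [].
Qed.

Lemma class_count_rec m :
  class_count P m = (m == 1) + J m + J m + Q m.
Proof.
by have [] := @class_recursion m m setT true; rewrite ?cardsT ?card_ord // card_class_count.
Qed.

Lemma ncount_rec m : class_count P m = ncount m + J m.
Proof.
have [|E1 E2] := @class_recursion m m setT true; first by rewrite cardsT card_ord.
by rewrite /ncount card_class_count E1 E2 -!addnA [J m + Q m]addnC.
Qed.

Lemma class_count0 : class_count P 0 = 0.
Proof. by rewrite class_count_rec /J /Q !big_geq. Qed.

Lemma ncount0 : ncount 0 = 0.
Proof. by have := ncount_rec 0; rewrite class_count0; case: ncount. Qed.

End Recursion.

Module ClassSeries.

Import Order.TTheory GRing.Theory Num.Theory mathcomp.algebra_tactics.ring.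
Local Open Scope ring_scope.

Lemma fcount1 f m : fcount f 1 m.+1 = f m.+1.
Proof.
rewrite /= (bigD1 ord_max) //= big1 ?addn0; last first.
  move=> j; rewrite -val_eqE /= => jm; have : (m - j)%N != 0%N.
    by rewrite subn_eq0 -ltnNge ltn_neqAle jm /= -ltnS ltn_ord.
  by move/negbTE=> ->; rewrite !muln0.
by rewrite binn subnn eqxx mul1n muln1.
Qed.

Section Egf.

Variable F : numFieldType.

Definition egfs (f : nat -> nat) : fps F := fun m => (f m)%:R / m`!%:R.

Let factn0 m : (m`!%:R : F) != 0.
Proof. by rewrite pnatr_eq0 -lt0n fact_gt0. Qed.

Lemma fps_deriv_egfs f m : fps_deriv (egfs f) m = (f m.+1)%:R / m`!%:R.
Proof.
rewrite /fps_deriv /egfs factS natrM invfM -(mulr_natl (_ * _)).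
by rewrite mulrCA mulVKf // pnatr_eq0.
Qed.

Lemma egfs_fcount f k : f 0%N = 0%N ->
  egfs (fcount f k) = fps_cst (k`!%:R^-1) * egfs f ^+ k.
Proof.
move=> f0; elim: k => [|k IH].
  rewrite expr0 mulr1; apply/funext=> -[|m] /=; first by rewrite /egfs /= divr1 invr1.
  by rewrite /egfs /= mul0r.
have fh0 : egfs f 0%N = 0 by rewrite /egfs f0 mul0r.
apply: fps_eq_deriv; first by rewrite fps_cstM fps_exp_small // mulr0 /egfs mul0r.
rewrite fps_deriv_cstM fps_deriv_exp /=.
have -> : fps_cst (k.+1)`!%:R^-1 * (k.+1%:R * egfs f ^+ k * fps_deriv (egfs f)) =
   fps_deriv (egfs f) * egfs (fcount f k).
  rewrite IH; have -> : (k.+1%:R : fps F) = fps_cst k.+1%:R.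
    by apply/funext=> -[|i]; rewrite fps_natE.
  have -> : (fps_cst k`!%:R^-1 : fps F) = fps_cst (k.+1)`!%:R^-1 * fps_cst k.+1%:R.
    apply/funext=> m; rewrite fps_cstM; case: m => [|m] /=; last by rewrite mulr0.
    by rewrite factS natrM invfM mulrAC mulVf ?mul1r // pnatr_eq0.
  by ring.
apply/funext=> m; rewrite fps_deriv_egfs fps_mulE /= natr_sum mulr_suml.
apply: eq_bigr => j _; rewrite fps_deriv_egfs /egfs !natrM.
have jm : (j <= m)%N by rewrite -ltnS.
have /(congr1 (fun i : nat => i%:R : F)) := bin_fact jm.
rewrite !natrM => E; apply: (mulIf (factn0 m)).
rewrite divfK // -E; field.
by rewrite !factn0.
Qed.

Lemma comp_egfs (q : nat -> F) f m : f 0%N = 0%N ->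
  fps_comp (fun k => q k / k`!%:R) (egfs f) m =
  \sum_(0 <= k < m.+1) q k * ((fcount f k m)%:R / m`!%:R).
Proof.
move=> f0; rewrite big_mkord; apply: eq_bigr => k _.
by rewrite -mulrA -fps_cstM -egfs_fcount.
Qed.

Section Class.

Variable P : graph_set.
Hypothesis Pprime : forall k (H : lgraph k), H \in P k -> prime_graph H.

Let T := egfs (class_count P).
Let N := egfs (ncount P).

Definition p_fps : fps F := egfs (fun k => #|P k|).
Definition expm1_fps : fps F := fps_exp1 F - 1.
Definition Lambda_fps : fps F := fps_comp p_fps expm1_fps + expm1_fps - fps_X F.
Definition h_fps : fps F := fun n => Lambda_fps n.+1.
Definition phi_fps : fps F := fps_comp (fps_geom F) h_fps.

Let E0 : expm1_fps 0%N = 0.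
Proof. by rewrite /expm1_fps fps_addE fps_oppE fps_1E /fps_exp1 invr1 subrr. Qed.

Lemma expm1E n : expm1_fps n.+1 = n.+1`!%:R^-1.
Proof. by rewrite /expm1_fps fps_addE fps_oppE fps_1E subr0. Qed.

Let N0 : N 0%N = 0. Proof. by rewrite /N /egfs ncount0 // mul0r. Qed.

Lemma p_small k : (k < 3)%N -> p_fps k = 0.
Proof.
move=> k3; rewrite /p_fps /egfs (_ : #|P k| = 0%N) ?mul0r //.
apply: eq_card0 => H; apply/negP=> /Pprime/andP[k3' _].
by rewrite ltnNge k3' in k3.
Qed.

Let linear_sum m : \sum_(2 <= k < m.+1) ((fcount (ncount P) k m)%:R / m`!%:R : F) =
  (fps_comp (fps_exp1 F) N - 1 - N) m.
Proof.
have -> : fps_exp1 F = fun k => 1 / k`!%:R by apply/funext=> k; rewrite mul1r.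
rewrite !fps_addE !fps_oppE comp_egfs ?ncount0 // fps_1E.
case: m => [|m].
  by rewrite big_geq // big_nat1 N0 /= mul1r divr1; ring.
rewrite [X in _ = X - _ - _]big_ltn // [X in _ = _ + X - _ - _]big_ltn //.
rewrite mul0r mulr0 add0r subr0 fcount1 mul1r /N /egfs addrAC subrr add0r.
by apply: eq_bigr => k _; rewrite mul1r.
Qed.

Lemma class_exp : 1 + T = fps_comp (fps_exp1 F) N.
Proof.
suff -> : T = N + (fps_comp (fps_exp1 F) N - 1 - N) by ring.
apply/funext=> m; rewrite fps_addE -linear_sum {1}/T {1}/egfs ncount_rec // natrD.
by rewrite mulrDl natr_sum mulr_suml.
Qed.

Lemma class_eq : T = fps_X F + (T - N) + (T - N) + fps_comp p_fps T.
Proof.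
have -> : T - N = fps_comp (fps_exp1 F) N - 1 - N by rewrite -class_exp; ring.
move: (_ - N) linear_sum => D DE; apply/funext=> m; rewrite !fps_addE -DE.
rewrite {1}/T {1}/egfs class_count_rec // !natrD !natr_sum !mulrDl !mulr_suml.
congr (_ + _ + _ + _).
  by rewrite /fps_X; case: eqP => [->|_]; [exact: divr1 | exact: mul0r].
rewrite [RHS](comp_egfs (fun k => #|P k|%:R)) ?class_count0 //.
case: (ltnP m 1) => m1.
  rewrite big_geq 1?ltnW // big_nat big1 // => k /andP[_ km].
  by rewrite (P_small Pprime (leq_trans km (leqW m1))) mul0r.
rewrite [RHS](big_cat_nat (n := 2)) //= [X in _ = X + _]big_nat.
rewrite [X in _ = X + _]big1 ?add0r; last by move=> k /andP[_ k2]; rewrite P_small ?mul0r.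
by apply: eq_bigr => k _; rewrite natrM mulrA.
Qed.

Lemma Lambda_fps0 : Lambda_fps 0%N = 0.
Proof.
by rewrite /Lambda_fps !fps_addE fps_oppE E0 fps_comp0 p_small // /fps_X /= subr0 addr0.
Qed.

Lemma h_fps0 : h_fps 0%N = 0.
Proof.
rewrite /h_fps /Lambda_fps !fps_addE fps_oppE expm1E /fps_comp !big_ord_recl big_ord0.
by rewrite !p_small // !mul0r /fps_X /= invr1; ring.
Qed.

Lemma class_count_coef n :
  n.+1%:R * ((class_count P n.+1)%:R / n.+1`!%:R) = (fps_exp1 F * phi_fps ^+ n.+1) n.
Proof.
have gE : fps_X F - Lambda_fps = fps_X F * (1 - h_fps).
  rewrite mulrBr mulr1; congr (_ - _); exact: fps_X_factor Lambda_fps0.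
have gN : fps_comp (fps_X F - Lambda_fps) N = fps_X F.
  have EN : fps_comp expm1_fps N = T.
    by rewrite fps_compD fps_compN -class_exp fps_comp1 //; ring.
  rewrite fps_compD fps_compN /Lambda_fps 2!fps_compD fps_compN fps_compX // fps_compA //.
  rewrite EN; have E := class_eq.
  have -> : fps_comp p_fps T = T - fps_X F - (T - N) - (T - N).
    apply: (addrI (fps_X F + (T - N) + (T - N))); rewrite -E; ring.
  by ring.
have := lagrange_inversion gE (fps_geom_inv h_fps0) N0 gN (fps_exp1 F) n.
by rewrite fps_deriv_exp1 -class_exp fps_addE fps_1E add0r => <-.
Qed.

End Class.

End Egf.

End ClassSeries.

Import ClassSeries.

(** * Asymptotics of the class *)

From Stdlib Require Import Reals Lra.

Section Bridge.

Local Open Scope ring_scope.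

Lemma fps_mul_conv (a b : fps R) : a * b = conv a b.
Proof.
apply/funext=> n; rewrite /conv sum_f_R0E big_mkord fps_mulE.
by apply: eq_bigr => i _; rewrite minusE.
Qed.

Lemma fps_exp_conv_pow (a : fps R) k : a ^+ k = conv_pow a k.
Proof.
elim: k => [|k IH]; last by rewrite GRing.exprS fps_mul_conv IH.
by rewrite GRing.expr0; apply/funext=> -[|n]; rewrite fps_1E.
Qed.

Lemma fps_comp_scomp (a b : fps R) : fps_comp a b = scomp a b.
Proof.
apply/funext=> n; rewrite /scomp sum_f_R0E big_mkord.
by apply: eq_bigr => i _; rewrite fps_exp_conv_pow.
Qed.

Lemma fps_exp1_coef : fps_exp1 R = exp_coef.
Proof. by apply/funext=> n; rewrite /exp_coef INRE factE. Qed.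

End Bridge.

Section Final.

Local Open Scope R_scope.

Variable P : graph_set.
Hypothesis Pprime : forall k (H : lgraph k), H \in P k -> prime_graph H.

Let p := egf_coef P.

Lemma egf_coef_fps : p_fps R P = p.
Proof. by apply/funext=> n; rewrite /p /egf_coef !INRE RdivE. Qed.

Lemma egf_coef_ge0 (n : nat) : 0 <= p n.
Proof.
rewrite /p /egf_coef; apply: Rmult_le_pos; first exact: pos_INR.
by apply/Rlt_le/Rinv_0_lt_compat/lt_0_INR/ltP/fact_gt0.
Qed.

Lemma egf_coef_small (n : nat) : leq n 2 -> p n = 0.
Proof. by move=> n3; rewrite -egf_coef_fps p_small. Qed.

Lemma phi_fps_coef : phi_fps R P = phi_coef p.
Proof.
have E1 : expm1_fps R = expm1_coef.
  apply/funext=> n; rewrite /expm1_fps fps_addE fps_oppE fps_1E fps_exp1_coef.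
  case: n => [|n] /=; last exact: GRing.subr0.
  by rewrite /exp_coef /= RinvE GRing.invr1 GRing.subrr.
have Eh : h_fps R P = h_coef p.
  apply/funext=> n; rewrite /h_fps /Lambda_fps !fps_addE fps_oppE fps_comp_scomp.
  rewrite egf_coef_fps E1 /h_coef /lam_coef; congr (_ + _ - _).
  by rewrite /fps_X; case: Nat.eq_dec => [[->]|]; case: eqP.
by rewrite /phi_fps fps_comp_scomp Eh.
Qed.

Lemma class_count_conv n :
  INR n.+1 * (INR (class_count P n.+1) / INR (n.+1)`!) =
  conv exp_coef (conv_pow (phi_coef p) n.+1) n.
Proof.
have := class_count_coef R Pprime n.
by rewrite fps_mul_conv fps_exp_conv_pow phi_fps_coef fps_exp1_coef -!INRE -RdivE -RmultE.
Qed.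

Lemma inside_log_bound w : 0 <= w -> Rbar_lt 0 (egf_radius P) ->
  Rbar_lt w (log_bound P) <-> inside p w.
Proof.
move=> w0; rewrite /inside /log_bound -/(egf_radius P).
have e1 := exp_ge1 w w0.
rewrite Rabs_pos_eq; last lra.
case: egf_radius => [r| |] //= r0; split=> h.
- have := exp_increasing _ _ h; rewrite exp_ln; lra.
- by apply: exp_lt_inv; rewrite exp_ln; lra.
Qed.

Lemma Derive_Lambda w : inside p w -> Derive (Lambda P) w = dLam p w.
Proof. by move=> h; apply: is_derive_unique; apply: is_derive_Lam. Qed.

Lemma condition_C_large : condition_C P ->
  exists w, [/\ 0 <= w, inside p w & 1 < dLam p w].
Proof.
case=> r0 [l [lim l1]].
have big : Rbar_locally l (fun y => 1 < y).
  case: l l1 {lim} => [l| |] //= l1; last by exists 1.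
  exact: (locally_open (fun y => 1 < y) _ (open_gt 1)).
suff [w [w0 wL dw]] : exists w, [/\ 0 <= w, Rbar_lt w (log_bound P) & 1 < Derive (Lambda P) w].
  have wi : inside p w by apply/inside_log_bound.
  by exists w; split=> //; rewrite -Derive_Lambda.
have := lim _ big; rewrite /filtermap /Rbar_at_left /within.
have L0 : Rbar_lt 0 (log_bound P).
  rewrite /log_bound; case: egf_radius r0 => [r| |] //= r0.
  by rewrite -ln_1; apply: ln_increasing; lra.
case: (log_bound P) L0 => [L| |] //= L0.
- case=> e He; have e0 := cond_pos e.
  set w := Rmax (L / 2) (L - e / 2).
  have w1 : L / 2 <= w by apply: Rmax_l.
  have w2 : L - e / 2 <= w by apply: Rmax_r.
  have w3 : w < L by apply: Rmax_lub_lt; lra.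
  exists w; split=> //; first lra.
  apply: He => //; change (Rabs (w + - L) < e).
  by apply: Rabs_def1; lra.
- case=> M HM; exists (Rmax 0 M + 1).
  have m1 := Rmax_l 0 M; have m2 := Rmax_r 0 M.
  by split=> //; [lra | apply: HM => //; lra].
Qed.

Section Asymptotics.

Hypothesis PC : condition_C P.

Lemma kappa_spec : [/\ 0 <= kappa P, inside p (kappa P) & dLam p (kappa P) = 1].
Proof.
have p0 := egf_coef_ge0; have p1 := egf_coef_small (n := 1) isT.
have r0 : Rbar_lt 0 (egf_radius P) by case: PC.
have [w [w0 wi wbig]] := condition_C_large PC.
have [k [k0 [ki kc]]] := kappa_exists p p1 w w0 wi wbig.
suff -> : kappa P = k by [].
apply: (iota_unique (V := R_CompleteNormedModule)); last first.
  by split=> //; [apply/inside_log_bound | rewrite Derive_Lambda].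
move=> y [y0 yL dy]; have yi : inside p y by apply/inside_log_bound.
rewrite Derive_Lambda // in dy.
case: (Rtotal_order y k) => [yk|[//|yk]]; exfalso.
  by have := dLam_increasing p p0 y k (conj y0 yk) ki; lra.
by have := dLam_increasing p p0 k y (conj k0 yk) yi; lra.
Qed.

Lemma Derive2_Lambda : Derive_n (Lambda P) 2 (kappa P) = ddLam p (kappa P).
Proof.
have [k0 ki kc] := kappa_spec.
apply: is_derive_unique; apply: (is_derive_ext_loc (dLam p)); last exact: is_derive_dLam.
apply: filter_imp (locally_inside p (kappa P) ki) => w wi /=.
by symmetry; exact: (Derive_Lambda wi).
Qed.

Lemma class_count_ratio n :
  INR (class_count P n.+1) =
  sqrt (INR n.+1) * (conv exp_coef (conv_pow (phi_coef p) n.+1) n * rho P ^ n.+1) *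
  (INR (n.+1)`! / (rho P ^ n.+1 * Rpower (INR n.+1) (3 / 2))).
Proof.
have [k0 ki kc] := kappa_spec.
have r0 : 0 < rho P.
  exact: (rho_gt0 p egf_coef_ge0 (egf_coef_small (n := 0) isT) (egf_coef_small (n := 1) isT) (kappa P)).
have n0 : 0 < INR n.+1 by apply/lt_0_INR/ltP.
have f0 : INR (n.+1)`! <> 0 by apply/not_0_INR/eqP; rewrite -lt0n fact_gt0.
have rn : rho P ^ n.+1 <> 0 by apply: pow_nonzero; lra.
have s0 : 0 < sqrt (INR n.+1) by apply: sqrt_lt_R0.
have -> : Rpower (INR n.+1) (3 / 2) = INR n.+1 * sqrt (INR n.+1).
  rewrite (_ : 3 / 2 = 1 + / 2); last lra.
  by rewrite Rpower_plus Rpower_1 // Rpower_sqrt.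
rewrite -class_count_conv; field; do !split=> //; lra.
Qed.

Lemma asymptotic_constE : 0 < asymptotic_const P /\ asymptotic_const P =
  kappa P * exp (kappa P) /
  sqrt (2 * PI * (kappa P ^ 2 * ddLam p (kappa P) / rho P)).
Proof.
have [k0 ki kc] := kappa_spec.
have p0 := egf_coef_ge0; have p1 := egf_coef_small (n := 1) isT.
have r0 : 0 < rho P := rho_gt0 p p0 (egf_coef_small (n := 0) isT) p1 (kappa P) k0 ki kc.
have D0 := ddLam_gt0 p p0 (kappa P) k0 ki.
have k_gt0 : 0 < kappa P.
  by case: k0 => // E; move: kc; rewrite -E dLam_0 //; lra.
have e0 := exp_pos (kappa P); have P0 := PI_RGT_0.
rewrite /asymptotic_const /K /mu Derive2_Lambda.
set D := ddLam p (kappa P) in D0 *; set k := kappa P in k_gt0 e0 *.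
set r := rho P in r0 *.
have m0 : 0 < sqrt (2 * r * D).
  by apply: sqrt_lt_R0; apply: Rmult_lt_0_compat => //; lra.
have q0 : 0 < sqrt PI by apply: sqrt_lt_R0.
have -> : 2 * PI * (k ^ 2 * D / r) = (k / r * sqrt (2 * r * D) * sqrt PI) ^ 2.
  rewrite !Rpow_mult_distr !pow2_sqrt; last 2 first.
  - by lra.
  - by apply: Rmult_le_pos; lra.
  by field; lra.
rewrite sqrt_pow2; last first.
  apply: Rmult_le_pos; [apply: Rmult_le_pos|]; [|lra|lra].
  by apply: Rlt_le; apply: Rdiv_lt_0_compat.
split; last by field; do !split; lra.
apply: Rdiv_lt_0_compat; apply: Rmult_lt_0_compat => //; lra.
Qed.

End Asymptotics.

End Final.

Theorem theorem4p16 (P : graph_set) :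
  (forall n (H : lgraph n), H \in P n -> prime_graph H) ->
  stable_under_relabeling P ->
  condition_C P ->
  is_equiv eventually
    (fun n : nat => INR (class_count P n))
    (fun n : nat =>
       (asymptotic_const P * (INR n`! / (rho P ^ n * Rpower (INR n) (3 / 2))))%R).
Proof.
move=> Pprime _ PC.
have [k0 ki kc] := kappa_spec Pprime PC.
have [C0 CE] := asymptotic_constE Pprime PC.
set C := asymptotic_const P in C0 CE *.
set b := fun n : nat => (INR n`! / (rho P ^ n * Rpower (INR n) (3 / 2)))%R.
set q := fun n : nat => (sqrt (INR n.+1) *
  (conv exp_coef (conv_pow (phi_coef (egf_coef P)) n.+1) n * rho P ^ n.+1))%R.
have lim : is_lim_seq q C.
  rewrite CE; apply: coefficient_asymptotics => //.
  - exact: egf_coef_ge0.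
  - exact: (egf_coef_small Pprime (n := 0)).
  - exact: (egf_coef_small Pprime (n := 1)).
move=> eps; have e0 := cond_pos eps.
have Ce : (0 < eps * C)%R by apply: Rmult_lt_0_compat.
have /is_lim_seq_spec/(_ (mkposreal _ Ce)) [N HN] := lim.
exists N.+1 => -[|n] /leP // Nn; have {HN} /= h := HN n (elimT (@leP N n) Nn).
change (Rabs (C * b n.+1 + - INR (class_count P n.+1)) <= eps * Rabs (C * b n.+1))%R.
rewrite (class_count_ratio Pprime PC) -/(q n) -/(b n.+1).
rewrite -Ropp_mult_distr_l_reverse -Rmult_plus_distr_r (Rabs_mult (C + - q n)) (Rabs_mult C).
rewrite -Rmult_assoc; apply: Rmult_le_compat_r; first exact: Rabs_pos.
rewrite (Rabs_pos_eq C); last exact: Rlt_le.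
by rewrite -Rabs_Ropp Ropp_plus_distr Ropp_involutive Rplus_comm; apply: Rlt_le.
Qed.
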